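(* Let $E$ be an r.i. space and let $b,\ uw_1(u),\ w_2(u),\ uw_3(u),\ w_4(u)\in SV(0,1)$. Let $1<p_0<p_1<\infty$, $1\le q_0,q_1\le\infty$, and put $$\rho(u)=u^{\frac1{p_0}-\frac1{p_1}}\,\frac{w_2(u)^{1/p_0}\,\|(tw_1(t))^{1/q_0}\|_{\widetilde L_{q_0}(u,1)}}{w_4(u)^{1/p_1}\,\|(tw_3(t))^{1/q_1}\|_{\widetilde L_{q_1}(u,1)}},\qquad u\in(0,1).$$ (a) If $0<\theta<1$, then $\big(G\Gamma(p_0,q_0,w_1,w_2),G\Gamma(p_1,q_1,w_3,w_4)\big)_{\theta,b,E}=L_{p,B_\theta,E}$, where $\frac1p=\frac{1-\theta}{p_0}+\frac{\theta}{p_1}$ and, for $u\in(0,1)$, $$B_\theta(u)=\Big(w_2(u)^{1/p_0}\|(tw_1(t))^{1/q_0}\|_{\widetilde L_{q_0}(u,1)}\Big)^{1-\theta}\Big(w_4(u)^{1/p_1}\|(tw_3(t))^{1/q_1}\|_{\widetilde L_{q_1}(u,1)}\Big)^{\theta}b(\rho(u)).$$ (b) If $\theta=0$, then $$\big(G\Gamma(p_0,q_0,w_1,w_2),G\Gamma(p_1,q_1,w_3,w_4)\big)_{0,b,E}=L^{\mathcal L}_{p_0,B_0,E,w_2(u)^{1/p_0},L_{p_0}}\cap L^{\mathcal L,\mathcal L}_{p_0,\,b\circ\rho,\,E,\,(uw_1(u))^{1/q_0},\,L_{q_0},\,w_2(u)^{1/p_0},\,L_{p_0}},$$ where $B_0(u)=\|(tw_1(t))^{1/q_0}\|_{\widetilde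 L_{q_0}(u,1)}\,b(\rho(u))$, $u\in(0,1)$. (c) If $\theta=1$ and $\|b\|_{\widetilde E(0,1)}<\infty$, then $$\big(G\Gamma(p_0,q_0,w_1,w_2),G\Gamma(p_1,q_1,w_3,w_4)\big)_{1,b,E}=L^{\mathcal L,\mathcal R}_{p_1,\,b\circ\rho,\,E,\,(uw_3(u))^{1/q_1},\,L_{q_1},\,w_4(u)^{1/p_1},\,L_{p_1}}.$$
   Context: Notation. An r.i. space $E$ is a rearrangement invariant Banach function space on $(0,\infty)$ with the Fatou property; $\widetilde E$ is the corresponding space for the measure $dt/t$, with $\|g\|_{\widetilde E}=\|g^\star\|_E$ ($g^\star$ the non-increasing rearrangement with respect to $dt/t$); for an interval $I$, $\|g\|_{\widetilde E(I)}=\|g\chi_I\|_{\widetilde E}$. So $\|g\|_{\widetilde L_q(I)}=(\int_I|g(s)|^q\,ds/s)^{1/q}$ and $\widetilde L_\infty=L_\infty$. A positive finite measurable $b$ on $(0,1)$ is in $SV(0,1)$ if for all $\varepsilon>0$, $t^\varepsilon b(t)$ is equivalent to a non-decreasing function and $t^{-\varepsilon}b(t)$ to a non-increasing one on $(0,1)$. Convention on weights: only the behaviour near $0$ of the weights matters. In $b(\rho(u))$, $b$ is extended to $[1,\infty)$ by $b(s)=1$ for $s\ge1$. The weights $b\circ\rho$, $B_\theta$, $B_0$, when used as parameters of the spaces on the right-hand sides, are given by the displayed formulas for $0<u<1/2$ and are set equal to $1$ for $1/2\le u<1$ (norms over $(u,1)$ degenerate as $u\to1$). Interpolation spaces: for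 (quasi-)Banach spaces with $Y_1\hookrightarrow Y_0$, $(Y_0,Y_1)_{\theta,b,E}$ is the set of $f\in Y_0$ with $\|t^{-\theta}b(t)K(t,f;Y_0,Y_1)\|_{\widetilde E(0,1)}<\infty$, $0\le\theta\le1$, where $K$ is Peetre's $K$-functional. Function spaces: functions are measurable on $(0,1)$ with Lebesgue measure, $f^*$ is the non-increasing rearrangement. Each space is the set of measurable $f$ with finite indicated norm (innermost norm in $s$, next in $t$, outermost in $u$), $1<p<\infty$: - $L_{p,b,E}$: $\|t^{1/p}b(t)f^*(t)\|_{\widetilde E(0,1)}$; - $L^{\mathcal L}_{p,b,E,a,F}$: $\big\|b(t)\|s^{1/p}a(s)f^*(s)\|_{\widetilde F(0,t)}\big\|_{\widetilde E(0,1)}$; - $L^{\mathcal L,\mathcal L}_{p,c,E,b,F,a,G}$: $\Big\|c(u)\big\|b(t)\|s^{1/p}a(s)f^*(s)\|_{\widetilde G(0,t)}\big\|_{\widetilde F(0,u)}\Big\|_{\widetilde E(0,1)}$; - $L^{\mathcal L,\mathcal R}_{p,c,E,b,F,a,G}$: $\Big\|c(u)\big\|b(t)\|s^{1/p}a(s)f^*(s)\|_{\widetilde G(u,t)}\big\|_{\widetilde F(u,1)}\Big\|_{\widetilde E(0,1)}$. Generalized Gamma space with double weights: for $1\le p<\infty$, $1\le q\le\infty$ and weights $w_1,w_2$ on $(0,1)$ such that (i) $w_2(2t)\le C w_2(t)$ for $t\in(0,1/2)$ and some $C>0$, and $L^p(0,1;w_2)\hookrightarrow L^1(0,1)$; (ii)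 the function $t\mapsto\int_0^tw_2(s)\,ds$ belongs to $L^{q/p}(0,1;w_1)$; $G\Gamma(p,q,w_1,w_2)$ is the set of measurable $f$ on $(0,1)$ with $$\bigg(\int_0^1w_1(t)\Big(\int_0^tw_2(s)(f^*(s))^p\,ds\Big)^{q/p}dt\bigg)^{1/q}<\infty$$ (essential supremum over $t$ of $\big(\int_0^tw_2(s)(f^*(s))^p\,ds\big)^{1/p}$ if $q=\infty$, with the convention $(uw_1(u))^{1/\infty}=1$). The pairs $(w_1,w_2)$ with $(p_0,q_0)$ and $(w_3,w_4)$ with $(p_1,q_1)$ are assumed to satisfy (i)–(ii). Equality of spaces means equality as sets with equivalent norms. *)

(* Defs.v *)
From mathcomp Require Import all_boot all_order all_algebra.
From mathcomp Require Import all_classical all_reals all_analysis.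
From mathcomp Require Import measurable_realfun ess_sup_inf.
Import Order.TTheory GRing.Theory Num.Theory.
Import numFieldNormedType.Exports.
Set Implicit Arguments.
Unset Strict Implicit.
Unset Printing Implicit Defensive.
Local Open Scope classical_set_scope.
Local Open Scope ring_scope.

(* A function on a subset D of R is a total function on R of which only the   *)
(* values on D matter.  "Measurable" means Borel measurable, and functions on *)
(* (0,1) are real-valued.                                                     *)

Section Rearrangement.
Context {R : realType}.
Local Open Scope ereal_scope.
Local Notation lambda := (@lebesgue_measure R).

Definition distr_fun (mu : set R -> \bar R) (D : set R) (g : R -> \bar R)
    (l : \bar R) : \bar R :=
  mu (D `&` [set x | l < `|g x|]).

Definition rearrangement (mu : set R -> \bar R) (D : set R) (g : R -> \bar R)
    (t : R) : \bar R :=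
  ereal_inf [set l | 0 <= l /\ distr_fun mu D g l <= t%:E].

(* f^* for f on (0,1) *)
Definition star (f : R -> R) : R -> \bar R :=
  rearrangement lambda `]0%R, 1%R[ (EFin \o f).

(* the measure dt/t on (0,oo) *)
Definition dt_over_t (A : set R) : \bar R := \int[lambda]_(t in A) (t^-1)%:E.

(* essential supremum over I of a nonnegative g ([g \_ I] is 0 outside I) *)
Definition ess_sup_on (I : set R) (g : R -> \bar R) : \bar R :=
  ess_sup lambda (g \_ I).

End Rearrangement.

Section RISpaces.
Context {R : realType}.
Local Open Scope ereal_scope.
Local Notation lambda := (@lebesgue_measure R).

Definition nonneg_measurable (g : R -> \bar R) : Prop :=
  measurable_fun `](0 : R)%R, +oo[ g /\ forall x, (0 < x)%R -> 0 <= g x.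

Definition ae_pos (P : R -> Prop) : Prop :=
  {ae lambda, forall x : R, (0 < x)%R -> P x}.

(* Rearrangement invariant Banach function norm on (0,oo), in the sense of    *)
(* Bennett and Sharpley; [ri_fatou] is the Fatou property.  A general g has   *)
(* norm [ri_norm |g|], and the space is the set of g of finite norm.          *)
Record ri_space := RISpace {
  ri_norm : (R -> \bar R) -> \bar R;
  ri_ge0 : forall g, nonneg_measurable g -> 0 <= ri_norm g;
  ri_eq0 : forall g, nonneg_measurable g ->
    ri_norm g = 0 <-> ae_pos (fun x => g x = 0);
  ri_scale : forall (a : R) g, (0 <= a)%R -> nonneg_measurable g ->
    ri_norm (fun x => a%:E * g x) = a%:E * ri_norm g;
  ri_triangle : forall g h, nonneg_measurable g -> nonneg_measurable h ->
    ri_norm (fun x => g x + h x) <= ri_norm g + ri_norm h;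
  ri_monotone : forall g h, nonneg_measurable g -> nonneg_measurable h ->
    ae_pos (fun x => g x <= h x) -> ri_norm g <= ri_norm h;
  ri_fatou : forall (g_ : nat -> R -> \bar R) g,
    (forall n, nonneg_measurable (g_ n)) -> nonneg_measurable g ->
    (forall n, ae_pos (fun x => g_ n x <= g_ n.+1 x)) ->
    ae_pos (fun x => g_ n x @[n --> \oo] --> g x) ->
    ri_norm (g_ n) @[n --> \oo] --> ri_norm g;
  ri_indic : forall A : set R, measurable A -> A `<=` `]0%R, +oo[ ->
    lambda A < +oo -> ri_norm (EFin \o \1_A) < +oo;
  ri_integral : forall A : set R, measurable A -> A `<=` `]0%R, +oo[ ->
    lambda A < +oo ->
    exists2 C : R, (0 < C)%R & forall g, nonneg_measurable g ->
      \int[lambda]_(x in A) g x <= C%:E * ri_norm g;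
  ri_rearr : forall g h, nonneg_measurable g -> nonneg_measurable h ->
    (forall l : R, (0 <= l)%R ->
      distr_fun lambda `]0%R, +oo[ g l%:E =
      distr_fun lambda `]0%R, +oo[ h l%:E) ->
    ri_norm g = ri_norm h }.

(* Norms g |-> ||g||_X(I), indexed by the interval I *)
Definition local_norm := set R -> (R -> \bar R) -> \bar R.

(* the norm of E~(I) *)
Definition tilde (E : ri_space) : local_norm := fun I g =>
  ri_norm E (rearrangement dt_over_t `]0%R, +oo[ (g \_ I)).

(* the norm of L_q~(I), 1 <= q <= oo *)
Definition tildeL (q : \bar R) : local_norm := fun I g =>
  match q with
  | r%:E => (\int[lambda]_(s in I) (`|g s| `^ r * (s^-1)%:E)) `^ r^-1
  | _ => ess_sup_on I (abse \o g)
  end.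

End RISpaces.
Arguments ri_space R : clear implicits.

Section SlowlyVarying.
Context {R : realType}.

Definition equiv_on01 (f g : R -> R) : Prop :=
  exists2 C : R, 0 < C &
    forall t, 0 < t < 1 -> C^-1 * g t <= f t <= C * g t.

Definition SV (b : R -> R) : Prop :=
  [/\ measurable_fun `](0 : R), 1[ b,
      forall t, 0 < t < 1 -> 0 < b t &
      forall e, 0 < e ->
        (exists2 g : R -> R,
           {in `]0, 1[ &, {homo g : s t / s <= t}} &
           equiv_on01 (fun t => t `^ e * b t) g) /\
        (exists2 g : R -> R,
           {in `]0, 1[ &, {homo g : s t / s <= t >-> t <= s}} &
           equiv_on01 (fun t => t `^ (- e) * b t) g)].

(* b(s) = 1 for s >= 1 *)
Definition ext1 (b : R -> R) (s : R) : R := if s < 1 then b s else 1.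

(* w(u) for 0 < u < 1/2 and 1 for 1/2 <= u < 1 *)
Definition cut_half (w : R -> R) (u : R) : R := if u < 2^-1 then w u else 1.

End SlowlyVarying.

Section FunctionSpaces.
Context {R : realType}.
Local Open Scope ereal_scope.
Local Notation lambda := (@lebesgue_measure R).

(* A (quasi-)normed space of functions on (0,1); [fnorm] is only meaningful   *)
(* on [carrier], whose elements are not quotiented by a.e. equality.          *)
Record fspace := FSpace {
  carrier : set (R -> R);
  fnorm : (R -> R) -> \bar R }.

Definition finite_space (N : (R -> R) -> \bar R) : fspace :=
  FSpace [set f | measurable_fun `](0 : R)%R, 1%R[ f /\ N f < +oo] N.

Definition same_space (X Y : fspace) : Prop :=
  carrier X = carrier Y /\
  exists2 C : R, (0 < C)%R & forall f, carrier X f ->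
    fnorm X f <= C%:E * fnorm Y f /\ fnorm Y f <= C%:E * fnorm X f.

Definition capspace (X Y : fspace) : fspace :=
  FSpace (carrier X `&` carrier Y)
         (fun f => Order.max (fnorm X f) (fnorm Y f)).

(* Peetre's K-functional *)
Definition Kfun (Y0 Y1 : fspace) (t : R) (f : R -> R) : \bar R :=
  ereal_inf [set k | exists f0 f1 : R -> R,
    [/\ carrier Y0 f0, carrier Y1 f1,
        {ae lambda, forall x : R, (0 < x < 1)%R -> f x = (f0 x + f1 x)%R} &
        k = fnorm Y0 f0 + t%:E * fnorm Y1 f1]].

(* (Y0, Y1)_{theta,b,E}, for Y1 continuously embedded in Y0 *)
Definition interp (Y0 Y1 : fspace) (theta : R) (b : R -> R) (E : ri_space R) :
    fspace :=
  let N f := tilde E `]0%R, 1%R[%classic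
    (fun t => (t `^ (- theta) * b t)%:E * Kfun Y0 Y1 t f) in
  FSpace [set f | carrier Y0 f /\ N f < +oo] N.

Definition spaceL (p : R) (b : R -> R) (E : local_norm) : fspace :=
  finite_space (fun f =>
    E `]0%R, 1%R[%classic (fun t => (t `^ p^-1 * b t)%:E * star f t)).

Definition spaceLL (p : R) (b : R -> R) (E : local_norm)
    (a : R -> R) (F : local_norm) : fspace :=
  finite_space (fun f =>
    E `]0%R, 1%R[%classic (fun t => (b t)%:E *
      F `]0%R, t[%classic (fun s => (s `^ p^-1 * a s)%:E * star f s))).

Definition spaceLLL (p : R) (c : R -> R) (E : local_norm)
    (b : R -> R) (F : local_norm) (a : R -> R) (G : local_norm) : fspace :=
  finite_space (fun f =>
    E `]0%R, 1%R[%classic (fun u => (c u)%:E *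
      F `]0%R, u[%classic (fun t => (b t)%:E *
        G `]0%R, t[%classic (fun s => (s `^ p^-1 * a s)%:E * star f s)))).

Definition spaceLLR (p : R) (c : R -> R) (E : local_norm)
    (b : R -> R) (F : local_norm) (a : R -> R) (G : local_norm) : fspace :=
  finite_space (fun f =>
    E `]0%R, 1%R[%classic (fun u => (c u)%:E *
      F `]u, 1%R[%classic (fun t => (b t)%:E *
        G `]u, t[%classic (fun s => (s `^ p^-1 * a s)%:E * star f s)))).

(* Generalized Gamma space with double weights *)
Definition GGamma_norm (p : R) (q : \bar R) (w1 w2 : R -> R) (f : R -> R) :
    \bar R :=
  let inner t := \int[lambda]_(s in `]0%R, t[) ((w2 s)%:E * star f s `^ p) in
  match q with
  | r%:E =>
      (\int[lambda]_(t in `]0%R, 1%R[) ((w1 t)%:E * inner t `^ (r / p)))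
        `^ r^-1
  | _ => ess_sup_on `]0%R, 1%R[ (fun t => inner t `^ p^-1)
  end.

Definition GGamma (p : R) (q : \bar R) (w1 w2 : R -> R) : fspace :=
  finite_space (GGamma_norm p q w1 w2).

(* w2 is doubling and L^p(0,1;w2) embeds continuously into L^1(0,1) *)
Definition GGamma_cond1 (p : R) (w2 : R -> R) : Prop :=
  (exists2 C : R, (0 < C)%R &
     forall t : R, (0 < t < 2^-1)%R -> (w2 (2 * t) <= C * w2 t)%R) /\
  (exists2 C : R, (0 < C)%R &
     forall f : R -> R, measurable_fun `](0 : R)%R, 1%R[ f ->
       \int[lambda]_(x in `]0%R, 1%R[) `|(f x)%:E| <=
       C%:E * (\int[lambda]_(x in `]0%R, 1%R[)
                 (`|(f x)%:E| `^ p * (w2 x)%:E)) `^ p^-1).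

(* t |-> \int_0^t w2 is in L^(q/p)(0,1;w1); as w1 > 0, for q = oo this is     *)
(* plain essential boundedness                                                *)
Definition GGamma_cond2 (p : R) (q : \bar R) (w1 w2 : R -> R) : Prop :=
  let W2 t := \int[lambda]_(s in `]0%R, t[) (w2 s)%:E in
  match q with
  | r%:E =>
      \int[lambda]_(t in `]0%R, 1%R[) (W2 t `^ (r / p) * (w1 t)%:E) < +oo
  | _ => ess_sup_on `]0%R, 1%R[ W2 < +oo
  end.

(* (u w(u))^(1/q), with the convention (u w(u))^(1/oo) = 1 *)
Definition wroot (q : \bar R) (w : R -> R) (u : R) : R :=
  match q with
  | r%:E => (u * w u) `^ r^-1
  | _ => 1
  end.

(* ||(t w(t))^(1/q)|| in L_q~(u,1); finite for 0 < u < 1 when t w(t) is SV *)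
Definition tailnorm (q : \bar R) (w : R -> R) (u : R) : R :=
  fine (tildeL q `]u, 1%R[%classic (EFin \o wroot q w)).

End FunctionSpaces.
Arguments fspace R : clear implicits.

Section Weights.
Context {R : realType}.
Variables (p0 p1 : R) (q0 q1 : \bar R) (w1 w2 w3 w4 : R -> R).

Definition rho (u : R) : R :=
  u `^ (p0^-1 - p1^-1) *
  ((w2 u `^ p0^-1 * tailnorm q0 w1 u) / (w4 u `^ p1^-1 * tailnorm q1 w3 u)).

Definition Btheta (theta : R) (b : R -> R) (u : R) : R :=
  (w2 u `^ p0^-1 * tailnorm q0 w1 u) `^ (1 - theta) *
  (w4 u `^ p1^-1 * tailnorm q1 w3 u) `^ theta * ext1 b (rho u).

Definition Bzero (b : R -> R) (u : R) : R :=
  tailnorm q0 w1 u * ext1 b (rho u).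

End Weights.

(* Main.v *)
(* All norms are discretized over the dyadic cells (2^-(n+1), 2^-n].  A slowly *)
(* varying weight becomes a sequence changing subexponentially, f^* becomes    *)
(* the sequence f^*(2^-(n+1)), and E~ becomes a rearrangement invariant        *)
(* sequence norm, since all cells have dt/t-measure ln 2.  Cutting f at height *)
(* f^*(2^-(n+1)) gives a Holmstedt formula for the K-functional of the two     *)
(* Gamma spaces at rho(2^-n): it is comparable to T0 A + I + rho J, where A is *)
(* the inner norm on (0,u), T0 the outer weight norm on (u,1), I the part of   *)
(* the first norm with outer variable in (0,u), and J the part of the second   *)
(* norm over (u,1).  As rho_n = rho(2^-n) decays geometrically, the norm of    *)
(* K(t) in t is that of K(rho_n) in n.  Finally Hardy's inequality bounds      *)
(* T0 A + I (for theta > 0) and rho J (for theta < 1) by geometrically         *)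
(* weighted sums of shifts of the diagonal terms phi0_n f^*(2^-n), and shifts  *)
(* are contractions; so theta = 0 leaves T0 A and I, theta = 1 leaves J, and   *)
(* 0 < theta < 1 leaves the diagonal term.                                     *)

Require Import Defs.
From mathcomp Require Import all_boot all_order all_algebra.
From mathcomp Require Import all_classical all_reals all_analysis.
From mathcomp Require Import measurable_realfun ess_sup_inf.
From mathcomp Require Import ring lra zify.
Import Order.TTheory GRing.Theory Num.Theory.
Import numFieldNormedType.Exports.
Set Implicit Arguments.
Unset Strict Implicit.
Unset Printing Implicit Defensive.
Local Open Scope classical_set_scope.
Local Open Scope ring_scope.

(** The K-functional of two Gamma spaces has a Holmstedt type description that survives
    discretization. With x_n = [star f (dyadic n)], a Gamma norm is an l^q norm over k of be_k times
    the l^p norm over m >= k of al_m x_m ([GGamma_norm_equiv]), where be varies slowly and al decays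
    geometrically up to subexponential factors. Every error term is therefore a geometric series.

    Let T_n be the l^q norm of be over k <= n, and phi_n = al_n T_n. As p0 < p1, the ratio rho_n =
    phi0_n / phi1_n decays geometrically. The candidate [Kseq] for the K-functional at rho_n is
    monotone and quasi-additive. It is bounded by the first norm and by rho_n times the second
    ([Kseq_le_gammaY0], [Kseq_le_gammaY1]): a norm controls each phi_m x_m, and the decay of rho
    carries this to the other terms. Hence any decomposition of f costs at least a multiple of
    [Kseq] ([Kseq_lower]). Conversely, cutting f at the height x_n gives a part supported on a small
    set and a bounded part, whose cost is at most a multiple of [Kseq] ([Kseq_upper]).

    The K-functional and its weight change by bounded factors when t does, so the interpolation norm
    may be sampled along any geometric sequence. Passing from the points [dyadic n] to rho_n uses an
    index map that is boundedly many to one, which a rearrangement invariant norm tolerates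
    ([seq_norm_reparam]). This yields [interp_norm_equiv].

    The weight rho^-theta b(rho) grows for theta > 0, and its product with rho decays for theta < 1.
    Hardy's inequality then reduces the head part, respectively the block part, to the diagonal
    terms phi0_n x_n ([head_part_le], [block_part_le]). The diagonal lies below both parts, so a
    reduced part is absorbed by what remains. For 0 < theta < 1 only the diagonal is left, and
    rho^-theta phi0 = phi0^(1-theta) phi1^theta produces the weight B_theta. Finally
    [tilde_seq_norm_equiv] turns the sequence norms back into function norms. *)

Local Notation nneg a := (forall k, (0 <= a k)%E).

(** * Geometric sequences and sequence norms *)

Section SequenceNorm.
Context {R : realType}.
Local Open Scope ereal_scope.
Implicit Types (a b : nat -> \bar R) (q : \bar R).

Definition lq q a : \bar R :=
  match q with
  | r%:E => (\sum_(k <oo) a k `^ r) `^ r^-1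
  | _ => ereal_sup (range a)
  end.

Lemma lq_index_ind (P : \bar R -> Prop) :
  (forall r : R, (1 <= r)%R -> P r%:E) -> P +oo -> forall q, 1 <= q -> P q.
Proof. by move=> Pr Py [r||]//; rewrite lee_fin => /Pr. Qed.

Lemma lee_poweR (r : R) (x y : \bar R) : (0 <= r)%R -> 0 <= x -> x <= y ->
  x `^ r <= y `^ r.
Proof.
move=> r0 x0 xy; apply: gt0_ler_poweR => //.
- by rewrite in_itv/= x0 leey.
- by rewrite in_itv/= (le_trans x0 xy) leey.
Qed.

Lemma poweRK (r : R) (x : \bar R) : (0 < r)%R -> 0 <= x ->
  (x `^ r) `^ r^-1 = x.
Proof. by move=> r0 x0; rewrite -poweRrM divff ?gt_eqF// poweRe1. Qed.

Lemma lq_ge0 q a : nneg a -> 0 <= lq q a.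
Proof.
move=> a0; case: q => [r||] /=; first exact: poweR_ge0.
- by apply: (le_trans (a0 0%N)); apply: ereal_sup_ubound; exists 0%N.
- by apply: (le_trans (a0 0%N)); apply: ereal_sup_ubound; exists 0%N.
Qed.

Lemma lq_mono q a b : 1 <= q -> nneg a ->
  (forall k, a k <= b k) -> lq q a <= lq q b.
Proof.
move=> q1 a0 ab.
have sup_mono : ereal_sup (range a) <= ereal_sup (range b).
  apply: ge_ereal_sup => _ [k _ <-]; apply: (le_trans (ab k)).
  by apply: ereal_sup_ubound; exists k.
move: q q1; apply: lq_index_ind => [r r1|//] /=.
have r0 : (0 < r)%R by exact: lt_le_trans r1.
apply: lee_poweR; first by rewrite invr_ge0 ltW.
- by apply: nneseries_ge0 => *; exact: poweR_ge0.
- apply: lee_nneseries => [*|k _]; first exact: poweR_ge0.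
  by apply: lee_poweR => //; exact: ltW.
Qed.

Lemma lq_scale q (c : R) a : 1 <= q -> (0 <= c)%R -> nneg a ->
  lq q (fun k => c%:E * a k) = c%:E * lq q a.
Proof.
move=> q1 c0 a0.
move: q q1; apply: lq_index_ind => [r r1|] /=.
  have r0 : (0 < r)%R by exact: lt_le_trans r1.
  under eq_eseriesr do rewrite poweRM ?lee_fin// poweR_EFin.
  rewrite nneseriesZl; last by move=> *; exact: poweR_ge0.
  rewrite poweRM ?lee_fin ?powR_ge0//; last first.
    by apply: nneseries_ge0 => *; exact: poweR_ge0.
  by rewrite -poweR_EFin poweRK.
have := c0; rewrite le_eqVlt => /predU1P[<-|cp].
  rewrite mul0e; apply/eqP; rewrite eq_le; apply/andP; split.
    by apply: ge_ereal_sup => _ [k _ <-]; rewrite mul0e.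
  by apply: ereal_sup_ubound; exists 0%N => //; rewrite mul0e.
by rewrite -ereal_sup_pZl// image_comp.
Qed.

Lemma lq_term q a k : 1 <= q -> nneg a -> a k <= lq q a.
Proof.
move=> q1 a0.
move: q q1; apply: lq_index_ind => [r r1|] /=; last first.
  by apply: ereal_sup_ubound; exists k.
have r0 : (0 < r)%R by exact: lt_le_trans r1.
rewrite -[leLHS](poweRK r0)//; apply: lee_poweR.
- by rewrite invr_ge0 ltW.
- exact: poweR_ge0.
- rewrite (@nneseriesD1 _ _ k)//; last by move=> *; exact: poweR_ge0.
  by rewrite leeDl//; apply: nneseries_ge0 => *; exact: poweR_ge0.
Qed.

Lemma lq_shift q a : 1 <= q -> nneg a ->
  lq q (fun k => a k.+1) <= lq q a.
Proof.
move=> q1 a0.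
move: q q1; apply: lq_index_ind => [r r1|] /=; last first.
  by apply: ge_ereal_sup => _ [k _ <-]; apply: ereal_sup_ubound; exists k.+1.
have r0 : (0 < r)%R by exact: lt_le_trans r1.
apply: lee_poweR.
- by rewrite invr_ge0 ltW.
- by apply: nneseries_ge0 => *; exact: poweR_ge0.
- have := @nneseries_addn R (fun k => a k `^ r) 1%N.
  under eq_eseriesr do rewrite addn1.
  move=> ->; last by move=> *; exact: poweR_ge0.
  rewrite [leRHS]nneseries_recl//; last by move=> *; exact: poweR_ge0.
  by rewrite leeDr// poweR_ge0.
Qed.

(** For a real exponent r, the r-th power of a maximum is at most the sum of the r-th powers, and
    2^(1/r) <= 2; the constant is thus uniform in the exponent. *)
Lemma lq_max q a b : 1 <= q -> nneg a -> nneg b ->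
  lq q (fun k => maxe (a k) (b k)) <= 2%:E * maxe (lq q a) (lq q b).
Proof.
move=> q1 a0 b0.
have M0 : 0 <= maxe (lq q a) (lq q b) by rewrite le_max lq_ge0.
move: q q1 M0; apply: lq_index_ind => [r r1|] /= M0; last first.
  have M2 : maxe (ereal_sup (range a)) (ereal_sup (range b)) <=
    2%:E * maxe (ereal_sup (range a)) (ereal_sup (range b)).
    by rewrite lee_pemull// lee_fin ler1n.
  apply: (le_trans _ M2); apply: ge_ereal_sup => _ [k _ <-].
  rewrite le_max !ge_max; case: (leP (a k) (b k)) => [|/ltW] h.
    by apply/orP; right; apply/andP; split => //; [apply: (le_trans h)|];
      apply: ereal_sup_ubound; exists k.
  by apply/orP; left; apply/andP; split => //; [|apply: (le_trans h)];
      apply: ereal_sup_ubound; exists k.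
have r0 : (0 < r)%R by exact: lt_le_trans r1.
set A := \sum_(k <oo) a k `^ r; set B := \sum_(k <oo) b k `^ r.
have A0 : 0 <= A by apply: nneseries_ge0 => *; exact: poweR_ge0.
have B0 : 0 <= B by apply: nneseries_ge0 => *; exact: poweR_ge0.
have ri0 : (0 <= r^-1)%R by rewrite invr_ge0 ltW.
apply: (@le_trans _ _ ((2%:E * maxe A B) `^ r^-1)).
  apply: lee_poweR => //; first by apply: nneseries_ge0 => *; exact: poweR_ge0.
  apply: (@le_trans _ _ (A + B)).
    rewrite /A /B -nneseriesD => [|k _ _|k _ _]; try exact: poweR_ge0.
    apply: lee_nneseries => [*|k _]; first exact: poweR_ge0.
    by rewrite maxEle; case: ifP => _; rewrite ?leeDr ?leeDl// poweR_ge0.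
  rewrite -[2%R]/(1 + 1)%R EFinD ge0_muleDl// mul1e.
  by apply: leeD; rewrite le_max lexx ?orbT.
rewrite poweRM ?lee_fin// ?le_max ?A0//.
apply: lee_pmul; rewrite ?poweR_ge0 ?lee_fin//.
  rewrite -[leRHS]powRr1//; apply: ler_powR; first lra.
  by rewrite invf_le1.
by rewrite maxEle; case: ifP => _; rewrite le_max lexx ?orbT.
Qed.

(** A lossy substitute for Minkowski's inequality, from a + b <= 2 max(a, b); only equivalence of
    norms matters later. *)
Lemma lq_add q a b : 1 <= q -> nneg a -> nneg b ->
  lq q (fun k => a k + b k) <= 4%:E * (lq q a + lq q b).
Proof.
move=> q1 a0 b0.
apply: (@le_trans _ _ (lq q (fun k => 2%:E * maxe (a k) (b k)))).
  apply: lq_mono => // k; first exact: adde_ge0.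
  rewrite -[2%R]/(1 + 1)%R EFinD ge0_muleDl// mul1e.
  by apply: leeD; rewrite le_max lexx ?orbT.
rewrite lq_scale//; last by move=> k; rewrite le_max a0.
have -> : 4%R = (2 * 2)%R :> R by ring.
rewrite EFinM -muleA; apply: lee_wpmul2l => //.
apply: (le_trans (lq_max q1 a0 b0)); apply: lee_wpmul2l => //.
by rewrite ge_max leeDl ?leeDr// lq_ge0.
Qed.

Lemma nneseries_geometric (x : R) : (0 <= x < 1)%R ->
  \sum_(k <oo) (x ^+ k)%:E = ((1 - x)^-1)%:E.
Proof.
move=> /andP[x0 x1]; apply/cvg_lim => //.
under eq_fun do rewrite sumEFin.
apply: cvg_EFin; first exact: nearW.
under eq_fun do rewrite /comp/=.
have := @cvg_geometric_series R 1 x; rewrite ger0_norm// => /(_ x1).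
rewrite mul1r; apply: cvg_trans; apply: near_eq_cvg; apply: nearW => n.
by rewrite /series/=; apply: eq_bigr => i _; rewrite mul1r.
Qed.

(** The distance |m - n|: with truncated subtraction one of the two summands is 0. *)
Definition gap (m n : nat) : nat := ((m - n) + (n - m))%N.

Lemma gap_geq m n : (n <= m)%N -> gap m n = (m - n)%N.
Proof. by rewrite /gap; lia. Qed.

Lemma gap_leq m n : (m <= n)%N -> gap m n = (n - m)%N.
Proof. by rewrite /gap; lia. Qed.

(** Below n, reversing the order gives a partial geometric sum; from n on the sum is a full one.
    Each half contributes at most 1 / (1 - x). *)
Lemma nneseries_gap_geometric (x : R) n : (0 <= x < 1)%R ->
  \sum_(k <oo) (x ^+ gap k n)%:E <= (2 * (1 - x)^-1)%:E.
Proof.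
move=> /[dup] x01 /andP[x0 x1].
have xk0 k : 0 <= (x ^+ k)%:E :> \bar R by rewrite lee_fin exprn_ge0.
rewrite (@nneseries_split _ _ 0%N n)// add0n mulr2n mulrDl mul1r EFinD.
apply: leeD.
  rewrite big_nat_rev/= add0n -(nneseries_geometric x01).
  apply: le_trans (@nneseries_lim_ge _ _ _ 0%N n _); last by [].
  rewrite !big_nat; apply: lee_sum => k /andP[_ kn].
  rewrite lee_fin; apply: ler_wiXn2l => //; first exact: ltW.
  by rewrite /gap; lia.
rewrite -nneseries_addn// -(nneseries_geometric x01).
apply: lee_nneseries => // k _; rewrite lee_fin.
apply: ler_wiXn2l => //; first exact: ltW.
by rewrite /gap; lia.
Qed.

(** The basic tool of the discrete estimates: geometric decay on both sides of an index bounds the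
    norm by the height of the peak, uniformly in the exponent r, because x^(kr) <= x^k and S^(1/r)
    <= S for S = 2 / (1 - x) >= 1. *)
Lemma lq_geometric q (x M : R) n a : 1 <= q -> (0 <= x < 1)%R -> (0 <= M)%R ->
  nneg a -> (forall k, a k <= (M * x ^+ gap k n)%:E) ->
  lq q a <= (2 * (1 - x)^-1 * M)%:E.
Proof.
move=> q1 /[dup] x01 /andP[x0 x1] M0 a0 aM.
have S1 : (1 <= 2 * (1 - x)^-1)%R.
  rewrite -ler_pdivrMl// mulr1; apply: (@le_trans _ _ 1%R); first lra.
  by rewrite invf_ge1; lra.
have xk0 k : (0 <= x ^+ k)%R by rewrite exprn_ge0.
have xk1 k : (x ^+ k <= 1)%R by rewrite exprn_ile1// ltW.
move: q q1; apply: lq_index_ind => [r r1|] /=; last first.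
  apply: ge_ereal_sup => _ [k _ <-]; apply: (le_trans (aM k)).
  by rewrite lee_fin mulrC ler_wpM2r// (le_trans (xk1 _)).
have r0 : (0 < r)%R by exact: lt_le_trans r1.
have ri0 : (0 <= r^-1)%R by rewrite invr_ge0 ltW.
apply: (@le_trans _ _ (((M `^ r)%:E * (2 * (1 - x)^-1)%:E) `^ r^-1)).
  apply: lee_poweR => //; first by apply: nneseries_ge0 => *; exact: poweR_ge0.
  apply: (@le_trans _ _ (\sum_(k <oo) ((M `^ r)%:E * (x ^+ gap k n)%:E))).
    apply: lee_nneseries => [*|k _]; first exact: poweR_ge0.
    apply: (@le_trans _ _ ((M * x ^+ gap k n)%:E `^ r)).
      by apply: lee_poweR => //; exact: ltW.
    rewrite poweR_EFin -EFinM lee_fin powRM// ler_wpM2l ?powR_ge0//.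
    have [->|xn0] := eqVneq (x ^+ gap k n)%R 0%R.
      by rewrite powR0// gt_eqF.
    by apply: ge1r_powR => //; rewrite xk1 lt_neqAle eq_sym xn0 xk0.
  rewrite nneseriesZl; last by move=> *; rewrite lee_fin.
  by apply: lee_wpmul2l; rewrite ?lee_fin ?powR_ge0// nneseries_gap_geometric.
rewrite -EFinM poweR_EFin lee_fin powRM ?powR_ge0 ?(le_trans _ S1)//.
rewrite -powRrM divff ?gt_eqF// powRr1// mulrC ler_wpM2r//.
apply: ler1_powR => //; first by rewrite invf_le1.
Qed.

End SequenceNorm.

(** * Sequences of geometric growth up to subexponential factors *)

Section GeometricGrowth.
Context {R : realType}.
Implicit Types (z y : R) (a w : nat -> R).

(* [a n] behaves like [z ^ n] up to factors that grow and decay slower than    *)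
(* every exponential; for [z = 1] it is slowly varying.                        *)
Definition geomlike z a : Prop :=
  [/\ 0 < z, forall n, 0 < a n,
      forall y, z < y ->
        exists2 C, 0 < C & forall n k, a (n + k)%N <= C * y ^+ k * a n &
      forall y, 0 < y < z ->
        exists2 C, 0 < C & forall n k, y ^+ k * a n <= C * a (n + k)%N].

Lemma geomlike_gt0 z a n : geomlike z a -> 0 < a n.
Proof. by case. Qed.

Lemma geomlike_cst (c : R) : 0 < c -> geomlike 1 (fun=> c).
Proof.
move=> c0; split => // y.
  move=> y1; exists 1 => // n k; rewrite mul1r ler_peMl ?(ltW c0)//.
  by rewrite exprn_ege1// ltW.
move=> /andP[y0 y1]; exists 1 => // n k; rewrite mul1r ler_piMl ?(ltW c0)//.
by rewrite exprn_ile1// ltW.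
Qed.

Lemma geomlike_exp z : 0 < z -> geomlike z (fun n => z ^+ n).
Proof.
move=> z0; have zn0 n : 0 <= z ^+ n by rewrite exprn_ge0// ltW.
split => // [n|y zy|y /andP[y0 yz]]; first exact: exprn_gt0.
  exists 1 => // n k; rewrite mul1r exprD mulrC ler_wpM2r//.
  by rewrite lerXn2r ?nnegrE ?(ltW z0) ?(ltW zy) ?(ltW (lt_trans z0 zy)).
exists 1 => // n k; rewrite mul1r exprD mulrC ler_wpM2l//.
by rewrite lerXn2r ?nnegrE ?(ltW z0) ?(ltW y0) ?(ltW yz).
Qed.

Lemma geomlike_mul z1 z2 a1 a2 : geomlike z1 a1 -> geomlike z2 a2 ->
  geomlike (z1 * z2) (fun n => a1 n * a2 n).
Proof.
move=> [z10 a10 u1 l1] [z20 a20 u2 l2].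
have zz0 : 0 < z1 * z2 by exact: mulr_gt0.
have prod_le (b1 b2 c1 c2 d1 d2 e1 e2 : R) : 0 < b1 -> 0 < b2 ->
    b1 <= c1 * e1 * d1 -> b2 <= c2 * e2 * d2 ->
    b1 * b2 <= (c1 * c2) * (e1 * e2) * (d1 * d2).
  move=> b10 b20 h1 h2; rewrite [in leRHS](mulrACA c1) (mulrACA (c1 * e1)).
  by apply: ler_pM => //; exact: ltW.
split => // [n|y zy|y /andP[y0 yz]]; first exact: mulr_gt0.
  (* Both factors get the same relative slack s, so that [z1 * s] and [z2 * s] multiply to y. *)
  set s := Num.sqrt (y / (z1 * z2)).
  have t1 : 1 < y / (z1 * z2) by rewrite ltr_pdivlMr// mul1r.
  have s1 : 1 < s by rewrite -sqrtr1 ltr_sqrt// (lt_trans _ t1).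
  have ss : (z1 * s) * (z2 * s) = y.
    by rewrite mulrACA -expr2 sqr_sqrtr ?(ltW (lt_trans _ t1))// mulrC divfK ?gt_eqF.
  have [C1 C10 h1] := u1 (z1 * s) ltac:(by rewrite ltr_pMr).
  have [C2 C20 h2] := u2 (z2 * s) ltac:(by rewrite ltr_pMr).
  exists (C1 * C2); first exact: mulr_gt0.
  by move=> n k; rewrite -ss exprMn; apply: prod_le.
set s := Num.sqrt (y / (z1 * z2)).
have t0 : 0 < y / (z1 * z2) by rewrite divr_gt0.
have t1 : y / (z1 * z2) < 1 by rewrite ltr_pdivrMr// mul1r.
have s0 : 0 < s by rewrite sqrtr_gt0.
have s1 : s < 1 by rewrite -sqrtr1 ltr_sqrt// (lt_trans _ t1).
have ss : (z1 * s) * (z2 * s) = y.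
  by rewrite mulrACA -expr2 sqr_sqrtr ?(ltW t0)// mulrC divfK ?gt_eqF.
have [C1 C10 h1] := l1 (z1 * s) ltac:(by rewrite mulr_gt0//= gtr_pMr).
have [C2 C20 h2] := l2 (z2 * s) ltac:(by rewrite mulr_gt0//= gtr_pMr).
exists (C1 * C2); first exact: mulr_gt0.
move=> n k; rewrite -ss exprMn mulrACA [leRHS]mulrACA.
by apply: ler_pM => //; rewrite mulr_ge0 ?exprn_ge0 ?(ltW (a10 _)) ?(ltW (a20 _))//
  mulr_ge0 ?(ltW z10) ?(ltW z20) ?(ltW s0).
Qed.

Lemma geomlike_inv z a : geomlike z a -> geomlike z^-1 (fun n => (a n)^-1).
Proof.
move=> [z0 a0 u l]; have zi0 : 0 < z^-1 by rewrite invr_gt0.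
split => // [n|y zy|y /andP[y0 yz]]; first by rewrite invr_gt0.
  have y0 : 0 < y by exact: lt_trans zy.
  have [C C0 h] := l y^-1 ltac:(by rewrite invr_gt0 y0/= -ltf_pV2 ?posrE ?invr_gt0// invrK).
  exists C => // n k; have := h n k.
  rewrite exprVn mulrC ler_pdivrMr ?exprn_gt0// => h'.
  by rewrite ler_pdivlMr// mulrC ler_pdivrMr// mulrAC.
have [C C0 h] := u y^-1 ltac:(by rewrite -ltf_pV2 ?posrE ?invr_gt0// invrK).
exists C => // n k; have := h n k.
rewrite exprVn mulrAC ler_pdivlMr ?exprn_gt0// => h'.
by rewrite ler_pdivlMr// mulrAC ler_pdivrMr// mulrC.
Qed.

Lemma geomlike_powR z a (r : R) : 0 <= r -> geomlike z a ->
  geomlike (z `^ r) (fun n => a n `^ r).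
Proof.
rewrite le_eqVlt => /predU1P[<- _|r0 [z0 a0 u l]].
  rewrite powRr0 (_ : (fun n => _) = fun=> 1); first exact: geomlike_cst.
  by apply/funext => n; rewrite powRr0.
have mono (s t : R) : 0 <= s -> 0 <= t -> s <= t -> s `^ r <= t `^ r.
  by move=> s0 t0 st; apply: ge0_ler_powR => //; exact: ltW.
have powX y k : 0 < y -> ((y `^ r^-1) ^+ k) `^ r = y ^+ k.
  move=> y0; rewrite -powR_mulrn ?powR_ge0// -!powRrM.
  rewrite (_ : _ * _ = k%:R); last by field; rewrite gt_eqF.
  by rewrite powR_mulrn// ltW.
have rV (s : R) : 0 < s -> s `^ r `^ r^-1 = s.
  by move=> s0; rewrite -powRrM divff ?gt_eqF// powRr1// ltW.
have ri0 : 0 < r^-1 by rewrite invr_gt0.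
split => [|n|y zy|y /andP[y0 yz]]; [exact: powR_gt0|exact: powR_gt0| |].
  have y0 : 0 < y by apply: lt_trans zy; exact: powR_gt0.
  have [|C C0 h] := u (y `^ r^-1).
    by rewrite -[ltLHS]rV//; apply: gt0_ltr_powR; rewrite ?nnegrE ?powR_ge0// ltW.
  exists (C `^ r); first exact: powR_gt0.
  move=> n k; rewrite -powX// -!powRM ?(ltW C0) ?(ltW (a0 _)) ?exprn_ge0 ?powR_ge0//.
    by apply: mono => //; rewrite ?(ltW (a0 _))// !mulr_ge0 ?(ltW C0) ?(ltW (a0 _)) ?exprn_ge0 ?powR_ge0//.
  by rewrite mulr_ge0 ?exprn_ge0 ?powR_ge0// ltW.
have [|C C0 h] := l (y `^ r^-1).
  rewrite powR_gt0//= -[ltRHS]rV//.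
  by apply: gt0_ltr_powR; rewrite ?nnegrE ?powR_ge0// ltW.
exists (C `^ r); first exact: powR_gt0.
move=> n k; rewrite -powX// -!powRM ?(ltW C0) ?(ltW (a0 _)) ?exprn_ge0 ?powR_ge0//.
by apply: mono => //; rewrite mulr_ge0 ?(ltW C0) ?(ltW (a0 _)) ?exprn_ge0 ?powR_ge0.
Qed.

Lemma geomlike_step z a : geomlike z a ->
  exists2 C, 0 < C & forall n, a n <= C * a n.+1 /\ a n.+1 <= C * a n.
Proof.
move=> [z0 a0 u l].
(* The rates 2z and z/2, used for a single step k = 1, suffice. *)
have [C C0 hC] := u (2 * z) ltac:(by rewrite ltr_pMl// ltr1n).
have [D D0 hD] := l (2^-1 * z) ltac:(by rewrite mulr_gt0 ?invr_gt0//= gtr_pMl// invf_lt1// ltr1n).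
exists (C * (2 * z) + D * 2 / z) => [|n].
  by rewrite addr_gt0// ?divr_gt0// !mulr_gt0.
have E0 : 0 <= C * (2 * z) by rewrite !mulr_ge0// ltW.
have F0 : 0 <= D * 2 / z by rewrite divr_ge0 ?mulr_ge0// ltW.
have := hC n 1%N; have := hD n 1%N; rewrite addn1 !expr1 => h1 h2; split.
  apply: (@le_trans _ _ (D * 2 / z * a n.+1)); last first.
    by rewrite mulrDl lerDr mulr_ge0// ltW.
  rewrite -(ler_pM2l (x := 2^-1 * z)) ?mulr_gt0 ?invr_gt0//.
  by rewrite [leRHS](_ : _ = D * a n.+1)//; field; rewrite gt_eqF.
by rewrite mulrDl (le_trans h2)// lerDl mulr_ge0// ltW.
Qed.

End GeometricGrowth.

(** * Discrete Gamma norms and Holmstedt's formula *)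

Section DiscreteGamma.
Context {R : realType}.
Local Open Scope ereal_scope.
Implicit Types (p q : \bar R) (al be : nat -> R) (x : nat -> \bar R).

(* Index n stands for the scale dyadic n; al, be and x discretize the inner    *)
(* weight, the outer weight and f^* there.  gammaY is the GGamma norm of f,    *)
(* gammaI the part with outer variable below scale n, and gammaJ the part      *)
(* with both variables above it.                                               *)
Definition head_norm q be n : R :=
  fine (lq q (fun k => if (k <= n)%N then (be k)%:E else 0)).

Definition tail_norm p al x n : \bar R :=
  lq p (fun m => if (n <= m)%N then (al m)%:E * x m else 0).

Definition block_norm p al x k n : \bar R :=
  lq p (fun m => if (k <= m <= n)%N then (al m)%:E * x m else 0).

Definition gammaY p q al be x : \bar R :=
  lq q (fun k => (be k)%:E * tail_norm p al x k).

Definition gammaI p q al be x n : \bar R :=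
  lq q (fun k => if (n <= k)%N then (be k)%:E * tail_norm p al x k else 0).

Definition gammaJ p q al be x n : \bar R :=
  lq q (fun k => if (k <= n)%N then (be k)%:E * block_norm p al x k n else 0).

Lemma lq_finite_support q (c : nat -> R) n : 1 <= q -> (forall k, 0 <= c k)%R ->
  lq q (fun k => if (k <= n)%N then (c k)%:E else 0) < +oo.
Proof.
(* M is large enough that c k <= M 2^-k for k <= n, so the geometric bound centred at 0 applies. *)
move=> q1 c0; set M := (\sum_(i < n.+1) c i * 2 ^+ i)%R.
have M0 : (0 <= M)%R by apply: sumr_ge0 => i _; rewrite mulr_ge0// exprn_ge0.
apply: (@le_lt_trans _ _ (2 * (1 - 2^-1)^-1 * M)%:E); last exact: ltry.
apply: (@lq_geometric _ _ _ _ 0%N) => //.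
- by rewrite invr_ge0 ler0n/= invf_lt1// ltr1n.
- by move=> k; case: ifPn => _ //; rewrite lee_fin.
move=> k; have g0 : gap k 0 = k by rewrite /gap; lia.
have h0 : (0 <= M * 2^-1 ^+ gap k 0)%R.
  by rewrite mulr_ge0// exprn_ge0// invr_ge0.
case: ifPn => [kn|_]; last by rewrite lee_fin.
rewrite lee_fin g0 exprVn ler_pdivlMr ?exprn_gt0//.
have kn1 : (k < n.+1)%N by [].
rewrite /M (bigD1 (Ordinal kn1))//= lerDl.
by apply: sumr_ge0 => i _; rewrite mulr_ge0// exprn_ge0.
Qed.

Section HeadNorm.
Variables (q : \bar R) (be : nat -> R).
Hypotheses (q1 : 1 <= q) (hbe : geomlike 1 be).

Let be0 k : (0 <= be k)%R. Proof. exact/ltW/(geomlike_gt0 _ hbe). Qed.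

Let arg_ge0 n k : 0 <= (if (k <= n)%N then (be k)%:E else 0).
Proof. by case: ifP => _ //; rewrite lee_fin. Qed.

Lemma head_normEfin n : (head_norm q be n)%:E =
  lq q (fun k => if (k <= n)%N then (be k)%:E else 0).
Proof.
by rewrite /head_norm fineK// ge0_fin_numE ?lq_ge0// lq_finite_support.
Qed.

Lemma head_norm_ge n k : (k <= n)%N -> (be k <= head_norm q be n)%R.
Proof.
move=> kn; rewrite -lee_fin head_normEfin.
apply: (@le_trans _ _ (if (k <= n)%N then (be k)%:E else 0)); first by rewrite kn.
exact: (@lq_term _ _ (fun k => if (k <= n)%N then (be k)%:E else 0)).
Qed.

Lemma head_norm_gt0 n : (0 < head_norm q be n)%R.
Proof. exact: (lt_le_trans (geomlike_gt0 n hbe) (head_norm_ge (leqnn n))). Qed.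

Lemma head_norm_mono m n : (m <= n)%N -> (head_norm q be m <= head_norm q be n)%R.
Proof.
move=> mn; rewrite -lee_fin !head_normEfin; apply: lq_mono => // k.
case: ifPn => [km|_]; first by rewrite (leq_trans km mn).
by case: ifP => // _; rewrite lee_fin.
Qed.

(** The factor c may be infinite, as tail norms can be; then the term of index 0 is already +oo
    because [be 0] is positive. *)
Lemma head_norm_mulr n (c : \bar R) : 0 <= c ->
  lq q (fun k => if (k <= n)%N then (be k)%:E * c else 0) =
  (head_norm q be n)%:E * c.
Proof.
have arg0 (e : \bar R) k : 0 <= e ->
    0 <= (if (k <= n)%N then (be k)%:E * e else 0).
  by move=> e0; case: ifP => _ //; rewrite mule_ge0// lee_fin.
case: c => [c c0|_|//].
  rewrite head_normEfin muleC -lq_scale ?lee_fin//.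
  by congr lq; apply/funext => k; case: ifP => _; rewrite ?mule0// muleC.
rewrite gt0_muley; last by rewrite lte_fin head_norm_gt0.
apply/eqP; rewrite -leye_eq.
apply: (le_trans _ (lq_term 0%N q1 (fun k => arg0 +oo k (ltry 0)))) => /=.
by rewrite gt0_muley// lte_fin; exact: geomlike_gt0 hbe.
Qed.

(** Monotonicity settles the lower bounds. For the upper ones, passing from n to n + k adds only
    terms with index in (n, n + k], and these are at most a multiple of y^k [head_norm q be n] times
    a sequence decaying geometrically away from n + k. *)
Lemma head_norm_geomlike : geomlike 1%R (head_norm q be).
Proof.
split => // [n|y y1|y /andP[y0 y1]]; first exact: head_norm_gt0; last first.
  exists 1%R => // n k; rewrite mul1r.
  apply: (le_trans _ (head_norm_mono (leq_addr k n))).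
  by rewrite ler_piMl// ?exprn_ile1 ?ltW ?head_norm_gt0.
have y0 : (0 < y)%R by exact: lt_trans y1.
have [_ _ /(_ y y1)[C C0 hC] _] := hbe.
have yV1 : (y^-1 < 1)%R by rewrite invf_lt1.
set S := (2 * (1 - y^-1)^-1)%R.
have S0 : (0 <= S)%R by rewrite mulr_ge0// invr_ge0 subr_ge0 ltW.
exists (4 * (1 + S * C))%R; first by rewrite mulr_gt0// ltr_pwDl// mulr_ge0// ltW.
move=> n k; rewrite -lee_fin head_normEfin.
have Tn0 := head_norm_gt0 n; have yk1 : (1 <= y ^+ k)%R by rewrite exprn_ege1// ltW.
have yk0 : (0 <= y ^+ k)%R by exact: le_trans yk1.
pose a1 j := if (j <= n)%N then (be j)%:E else 0.
pose a2 j := if (n < j <= n + k)%N then (be j)%:E else 0.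
have a20 j : 0 <= a2 j by rewrite /a2; case: ifP => _ //; rewrite lee_fin.
have -> : (fun j => if (j <= n + k)%N then (be j)%:E else 0) =
    (fun j => a1 j + a2 j).
  apply/funext => j; rewrite /a1 /a2; case: (leqP j n) => jn/=.
    by rewrite (leq_trans jn (leq_addr _ _)) adde0.
  by rewrite add0e.
apply: (le_trans (lq_add q1 (arg_ge0 n) a20)).
rewrite -mulrA -mulrA EFinM; apply: lee_wpmul2l => //.
rewrite mulrDl mul1r EFinD; apply: leeD.
  by rewrite -head_normEfin lee_fin ler_peMl// ltW.
apply: (@le_trans _ _ (S * (C * y ^+ k * head_norm q be n))%:E); last first.
  by rewrite !mulrA.
apply: (@lq_geometric _ _ y^-1%R _ (n + k)%N) => //.
- by rewrite invr_ge0 (ltW y0).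
- by rewrite !mulr_ge0 ?(ltW C0) ?(ltW Tn0).
move=> j; rewrite /a2; case: ifPn => [/andP[nj jnk]|_]; rewrite lee_fin; last first.
  by rewrite !mulr_ge0 ?(ltW C0) ?(ltW Tn0) ?exprn_ge0 ?invr_ge0 ?(ltW y0).
have := hC n (j - n)%N; rewrite subnKC ?(ltnW nj)// => /le_trans; apply.
rewrite gap_leq// (_ : n + k - j = k - (j - n))%N; last first.
  by clear -nj jnk; lia.
have -> : (y ^+ k = y ^+ (j - n) * y ^+ (k - (j - n)))%R.
  by rewrite -exprD subnKC// leq_subLR.
have ykj : (y ^+ (k - (j - n)) * y^-1 ^+ (k - (j - n)) = 1)%R.
  by rewrite exprVn divff// expf_neq0// gt_eqF.
rewrite [leRHS](_ : _ = C * y ^+ (j - n) * head_norm q be n *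
   (y ^+ (k - (j - n)) * y^-1 ^+ (k - (j - n))))%R; last by ring.
rewrite ykj mulr1 ler_wpM2l ?head_norm_ge// mulr_ge0 ?exprn_ge0 ?(ltW C0)//.
exact: ltW.
Qed.

End HeadNorm.
End DiscreteGamma.

(** * Estimates for a single discrete Gamma norm *)

Section DiscreteEstimates.
Context {R : realType}.
Local Open Scope ereal_scope.
Variables (p q : \bar R) (z : R) (al be : nat -> R).
Hypotheses (p1 : 1 <= p) (q1 : 1 <= q) (z1 : (z < 1)%R).
Hypotheses (hal : geomlike z al) (hbe : geomlike 1%R be).
Implicit Types (x : nat -> \bar R).

Let al_gt0 k : (0 < al k)%R. Proof. exact: geomlike_gt0 hal. Qed.
Let be_gt0 k : (0 < be k)%R. Proof. exact: geomlike_gt0 hbe. Qed.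
Let T := head_norm q be.
Let T_gt0 k : (0 < T k)%R. Proof. exact: head_norm_gt0. Qed.

Let al_ge0 k : (0 <= al k)%R. Proof. exact: ltW. Qed.
Let be_ge0 k : (0 <= be k)%R. Proof. exact: ltW. Qed.
Let T_ge0 k : (0 <= T k)%R. Proof. exact: ltW. Qed.

Lemma if_mule_ge0 (P : bool) (a : R) (c : \bar R) : (0 < a)%R -> 0 <= c ->
  0 <= (if P then a%:E * c else 0).
Proof. by move=> a0 c0; case: P => //; rewrite mule_ge0// lee_fin ltW. Qed.

Let al_x_ge0 x (P : pred nat) : nneg x ->
  forall m, 0 <= (if P m then (al m)%:E * x m else 0).
Proof. by move=> x0 m; apply: if_mule_ge0. Qed.

Lemma tail_norm_ge0 x n : nneg x -> 0 <= tail_norm p al x n.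
Proof. by move=> x0; apply: lq_ge0; apply: al_x_ge0. Qed.

Lemma block_norm_ge0 x k n : nneg x -> 0 <= block_norm p al x k n.
Proof. by move=> x0; apply: lq_ge0 => m; exact: if_mule_ge0. Qed.

Lemma gammaY_ge0 x : nneg x -> 0 <= gammaY p q al be x.
Proof.
move=> x0; apply: lq_ge0 => k; rewrite mule_ge0 ?tail_norm_ge0//.
by rewrite lee_fin ltW.
Qed.

Lemma gammaI_ge0 x n : nneg x -> 0 <= gammaI p q al be x n.
Proof.
by move=> x0; apply: lq_ge0 => k; apply: if_mule_ge0 => //; exact: tail_norm_ge0.
Qed.

Lemma gammaJ_ge0 x n : nneg x -> 0 <= gammaJ p q al be x n.
Proof.
by move=> x0; apply: lq_ge0 => k; apply: if_mule_ge0 => //; exact: block_norm_ge0.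
Qed.

Lemma tail_norm_anti x m n : nneg x -> (m <= n)%N ->
  tail_norm p al x n <= tail_norm p al x m.
Proof.
move=> x0 mn; apply: lq_mono => // k; first exact: (al_x_ge0 (leq n)).
case: ifPn => [nk|_]; first by rewrite (leq_trans mn nk).
exact: (al_x_ge0 (leq m)).
Qed.

Lemma head_tail_le_gammaY x n : nneg x ->
  (T n)%:E * tail_norm p al x n <= gammaY p q al be x.
Proof.
move=> x0; have t0 k := tail_norm_ge0 k x0.
rewrite -head_norm_mulr//; apply: lq_mono => // k; first exact: if_mule_ge0.
case: ifPn => kn; last by rewrite mule_ge0// lee_fin ltW.
by apply: lee_wpmul2l; rewrite ?lee_fin ?be_ge0// tail_norm_anti.
Qed.

Lemma gammaI_le_gammaY x n : nneg x ->
  gammaI p q al be x n <= gammaY p q al be x.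
Proof.
move=> x0; have t0 k := tail_norm_ge0 k x0.
apply: lq_mono => // k; first exact: if_mule_ge0.
by case: ifPn => _ //; rewrite mule_ge0// lee_fin ltW.
Qed.

Lemma gammaJ_le_gammaY x n : nneg x ->
  gammaJ p q al be x n <= gammaY p q al be x.
Proof.
move=> x0; have t0 k := tail_norm_ge0 k x0.
apply: lq_mono => // k; first by apply: if_mule_ge0; rewrite ?block_norm_ge0.
case: ifPn => [kn|_]; last by rewrite mule_ge0// lee_fin ltW.
apply: lee_wpmul2l; first by rewrite lee_fin ltW.
apply: lq_mono => // m; first exact: if_mule_ge0.
by case: ifPn => [/andP[-> _]//|_]; exact: if_mule_ge0.
Qed.

Lemma phi_le_head_tail x n : nneg x ->
  (al n * T n)%:E * x n <= (T n)%:E * tail_norm p al x n.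
Proof.
move=> x0; rewrite mulrC EFinM -muleA; apply: lee_wpmul2l.
  by rewrite lee_fin ltW.
by have := lq_term n p1 (al_x_ge0 (leq n) x0); rewrite leqnn.
Qed.

(** Every block ending at n contains the index n; keeping only that entry lets the head norm of be
    factor out. *)
Lemma phi_le_gammaJ x n : nneg x ->
  (al n * T n)%:E * x n <= gammaJ p q al be x n.
Proof.
move=> x0; rewrite mulrC EFinM -muleA -head_norm_mulr//; last first.
  by rewrite mule_ge0// lee_fin ltW.
apply: lq_mono => // k.
  by apply: if_mule_ge0 => //; rewrite mule_ge0// lee_fin ltW.
case: ifPn => // kn; apply: lee_wpmul2l; first by rewrite lee_fin ltW.
have := lq_term n p1 (al_x_ge0 (fun m => k <= m <= n)%N x0).
by rewrite kn leqnn.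
Qed.

Lemma lee_divr (a t c : R) (e : \bar R) : (0 < t)%R ->
  (a * t)%:E * e <= c%:E -> a%:E * e <= (c / t)%:E.
Proof.
move=> t0 h; have -> : a%:E * e = t^-1%:E * ((a * t)%:E * e).
  by rewrite muleA -EFinM mulrCA mulVf ?mulr1// gt_eqF.
rewrite (mulrC c) [in leRHS]EFinM; apply: lee_wpmul2l => //.
by rewrite lee_fin invr_ge0 ltW.
Qed.

(** Dividing the hypothesis by T, which is nondecreasing, leaves entries al_m x_m with geometric
    decay, so a tail norm is controlled by the bound on its first entry. As [be k <= T k], the terms
    of [gammaI] then decay geometrically away from n as well. *)
Lemma tail_gammaI_bound (y : R) : (0 < y < 1)%R ->
  exists2 C : R, (0 < C)%R & forall x n (M : R), nneg x ->
    (0 <= M)%R ->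
    (forall j, (al (n + j) * T (n + j))%:E * x (n + j)%N <= (M * y ^+ j)%:E) ->
    (T n)%:E * tail_norm p al x n <= (C * M)%:E /\
    gammaI p q al be x n <= (C * M)%:E.
Proof.
move=> /andP[y0 y1].
set S := (2 * (1 - y)^-1)%R.
have yj0 j : (0 <= y ^+ j)%R by rewrite exprn_ge0// ltW.
have S1 : (1 <= S)%R.
  rewrite -ler_pdivrMl// mulr1; apply: (@le_trans _ _ 1%R); first lra.
  by rewrite invf_ge1; lra.
have S0 : (0 < S)%R by exact: lt_le_trans S1.
exists (S * S)%R => [|x n M x0 M0 hx]; first exact: mulr_gt0.
have tail_le k : tail_norm p al x (n + k) <= (S * (M * y ^+ k / T (n + k)))%:E.
  have c0 : (0 <= M * y ^+ k / T (n + k))%R by rewrite !mulr_ge0 ?invr_ge0 ?T_ge0 ?(ltW D0).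
  apply: (@lq_geometric _ _ y _ (n + k)%N) => //; first by rewrite ltW.
    exact: al_x_ge0.
  move=> m; case: ifPn => [nkm|_]; last by rewrite lee_fin mulr_ge0.
  have nm : (n <= m)%N by exact: leq_trans (leq_addr k n) nkm.
  have kmn : (k <= m - n)%N by clear -nkm; lia.
  rewrite -{1 2}(subnKC nm).
  apply: (le_trans (lee_divr (T_gt0 _) (hx _))).
  rewrite lee_fin.
  rewrite gap_geq// subnDA.
  rewrite [leRHS](_ : _ = M * (y ^+ k * y ^+ (m - n - k)) / T (n + k))%R; last by ring.
  rewrite -exprD subnKC// subnKC//.
  apply: ler_wpM2l; first by rewrite mulr_ge0.
  by rewrite lef_pV2 ?posrE//; exact: head_norm_mono.
have SM : (S * M <= S * S * M)%R by rewrite -mulrA ler_wpM2l ?(ltW S0)// ler_peMl.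
split.
  apply: (@le_trans _ _ ((T n)%:E * (S * (M * y ^+ 0 / T (n + 0)))%:E)).
    by apply: lee_wpmul2l; rewrite ?lee_fin ?(ltW (T_gt0 _))// -{1}(addn0 n).
  rewrite -EFinM lee_fin (le_trans _ SM)// addn0 expr0.
  rewrite (_ : T n * (S * (M * 1 / T n)) = S * M)%R//.
  by field; rewrite gt_eqF.
rewrite -mulrA; apply: (@lq_geometric _ _ y _ n) => //; first by rewrite ltW.
- by rewrite mulr_ge0// ltW.
- by move=> k; apply: if_mule_ge0 => //; exact: tail_norm_ge0.
move=> k; case: ifPn => [nk|_]; last first.
  by rewrite lee_fin mulr_ge0// mulr_ge0// ltW.
rewrite -{1 2}(subnKC nk).
apply: (@le_trans _ _ ((T (n + (k - n)))%:E * tail_norm p al x (n + (k - n)))).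
  by apply: lee_wpmul2r; rewrite ?tail_norm_ge0// lee_fin head_norm_ge.
apply: (@le_trans _ _ ((T (n + (k - n)))%:E * (S * (M * y ^+ (k - n) / T (n + (k - n))))%:E)).
  by apply: lee_wpmul2l; rewrite ?lee_fin ?(ltW (T_gt0 _)).
rewrite -EFinM lee_fin.
rewrite gap_geq//.
set t := T _; rewrite (_ : t * (S * (M * y ^+ (k - n) / t)) = S * M * y ^+ (k - n))%R//.
by field; rewrite gt_eqF//; exact: T_gt0.
Qed.

(** Towards coarser scales T decreases, but only subexponentially. With y = s * s, one factor
    s^(n-m) pays for replacing T_m by T_n and the other bounds the block norms uniformly in k;
    summing be_k over k <= n cancels the resulting 1 / T_n. *)
Lemma gammaJ_bound (y : R) : (0 < y < 1)%R ->
  exists2 C : R, (0 < C)%R & forall x n (M : R), nneg x ->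
    (0 <= M)%R ->
    (forall m, (m <= n)%N -> (al m * T m)%:E * x m <= (M * y ^+ (n - m))%:E) ->
    gammaJ p q al be x n <= (C * M)%:E.
Proof.
move=> /andP[y0 y1]; set s := Num.sqrt y.
have s0 : (0 < s)%R by rewrite sqrtr_gt0.
have s1 : (s < 1)%R by rewrite -sqrtr1 ltr_sqrt.
have ss : (y = s * s)%R by rewrite -expr2 sqr_sqrtr// ltW.
set S := (2 * (1 - s)^-1)%R.
have S0 : (0 < S)%R by rewrite mulr_gt0// invr_gt0 subr_gt0.
have sV1 : (1 < s^-1)%R by rewrite invf_gt1.
have [_ _ /(_ _ sV1)[D D0 hD] _] := head_norm_geomlike q1 hbe.
exists (S * D)%R => [|x n M x0 M0 hx]; first exact: mulr_gt0.
have sj0 j : (0 <= s ^+ j)%R by rewrite exprn_ge0// ltW.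
have DMT : (0 <= D * M / T n)%R by rewrite !mulr_ge0 ?invr_ge0 ?T_ge0 ?(ltW D0).
have block_le k : block_norm p al x k n <= (S * (D * M / T n))%:E.
  apply: (@lq_geometric _ _ s _ n) => //; first by rewrite ltW.
    by move=> m; exact: if_mule_ge0.
  move=> m; case: ifPn => [/andP[km mn]|_]; last by rewrite lee_fin mulr_ge0.
  apply: (le_trans (lee_divr (T_gt0 _) (hx _ mn))); rewrite lee_fin.
  rewrite gap_leq//.
  have := hD m (n - m)%N; rewrite subnKC// -/T => hDm.
  rewrite ler_pdivrMr// ss exprMn.
  have sn0 : (s ^+ (n - m) != 0)%R by rewrite expf_neq0// gt_eqF.
  rewrite [leLHS](_ : _ = M * s ^+ (n - m) / T n * s ^+ (n - m) * T n)%R; last first.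
    by field; rewrite gt_eqF.
  rewrite [leRHS](_ : _ = M * s ^+ (n - m) / T n * s ^+ (n - m) *
     (D * s^-1 ^+ (n - m) * T m))%R; last first.
    by rewrite exprVn; field; rewrite sn0 gt_eqF.
  by apply: ler_wpM2l => //; rewrite !mulr_ge0// invr_ge0 ltW.
apply: (@le_trans _ _ ((T n)%:E * (S * (D * M / T n))%:E)).
  have c0 : 0 <= (S * (D * M / T n))%:E by rewrite lee_fin mulr_ge0// ltW.
  rewrite -head_norm_mulr//.
  apply: lq_mono => // k; first by apply: if_mule_ge0; rewrite ?block_norm_ge0.
  by case: ifPn => // _; apply: lee_wpmul2l => //; rewrite lee_fin ltW.
rewrite -EFinM lee_fin (_ : T n * (S * (D * M / T n)) = S * D * M)%R//.
by field; rewrite gt_eqF.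
Qed.

(** The bound for the large part of f: u vanishes before n, so for k <= n its tail at k is at most
    the tail of x at n, and the remaining indices k belong to [gammaI]. *)
Lemma gammaY_le_tail_gammaI x u n : nneg x -> nneg u ->
  (forall k, u k <= x k) -> (forall k, (k < n)%N -> u k = 0) ->
  gammaY p q al be u <=
    4%:E * ((T n)%:E * tail_norm p al x n + gammaI p q al be x n).
Proof.
move=> x0 u0 ux un; have t0 k := tail_norm_ge0 k x0.
have tle k : tail_norm p al u k <= tail_norm p al x k.
  apply: lq_mono => // m; first exact: (al_x_ge0 (leq k)).
  by case: ifPn => // _; apply: lee_wpmul2l => //; rewrite lee_fin ltW.
have tlen k : tail_norm p al u k <= tail_norm p al x n.
  apply: lq_mono => // m; first exact: (al_x_ge0 (leq k)).
  case: (leqP n m) => nm; last by rewrite un// mule0; case: ifP.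
  case: ifPn => // _; last by rewrite mule_ge0// lee_fin ltW.
  by apply: lee_wpmul2l => //; rewrite lee_fin ltW.
rewrite -head_norm_mulr//; apply: le_trans (lq_add q1 _ _).
- apply: lq_mono => // k.
    by rewrite mule_ge0 ?tail_norm_ge0// lee_fin ltW.
  case: (leqP k n) => kn.
    apply: (@le_trans _ _ ((be k)%:E * tail_norm p al x n)).
      by apply: lee_wpmul2l => //; rewrite lee_fin ltW.
    by rewrite leeDl//; exact: if_mule_ge0.
  rewrite (ltnW kn) add0e.
  by apply: lee_wpmul2l => //; rewrite lee_fin ltW.
- by move=> k; exact: if_mule_ge0.
- by move=> k; exact: if_mule_ge0.
Qed.

(** Since z < 1, al decays geometrically and its tail norm is controlled by its first entry. *)
Lemma tail_norm_cst_le : exists2 C : R, (0 < C)%R & forall n,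
  lq p (fun m => if (n <= m)%N then (al m)%:E else 0) <= (C * al n)%:E.
Proof.
have [z0 _ ual _] := hal.
have zz : (z < (1 + z) / 2 < 1)%R.
  move: z1 => z1'; apply/andP; split; lra.
move: zz; set y := ((1 + z) / 2)%R => /andP[zy y1].
have [C C0 hC] := ual y zy; have y0 : (0 < y)%R by exact: lt_trans zy.
exists (2 * (1 - y)^-1 * C)%R => [|n].
  by rewrite !mulr_gt0// invr_gt0 subr_gt0.
have cal : (0 <= C * al n)%R by rewrite mulr_ge0// ltW.
rewrite -(mulrA _ C); apply: (@lq_geometric _ _ y _ n) => //; first by rewrite ltW.
- by move=> k; case: ifP => // _; rewrite lee_fin ltW.
move=> k; case: ifPn => [nk|_]; rewrite lee_fin; last first.
  by rewrite mulr_ge0// exprn_ge0// ltW.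
rewrite gap_geq//.
by have := hC n (k - n)%N; rewrite subnKC// mulrAC.
Qed.

(** The bound for the small part of f, where u never exceeds x_n. Beyond n the tail of u is at most
    C al_n x_n, and al_n x_n is the last entry of every block ending at n. The outer indices k >= n
    contribute at most a multiple of be_n al_n x_n, since the product of be and al decays
    geometrically too, and the term k = n of [gammaJ] dominates this. *)
Lemma gammaY_le_gammaJ : exists2 C : R, (0 < C)%R & forall x u n,
  nneg x -> nneg u ->
  (forall k, u k <= x k) -> (forall k, u k <= x n) ->
  gammaY p q al be u <= C%:E * gammaJ p q al be x n.
Proof.
have [C C0 hC] := tail_norm_cst_le.
have habe : geomlike z (fun n => be n * al n)%R.
  by rewrite -[z]mul1r; exact: geomlike_mul.
have [z0 _ uab _] := habe.
have zz : (z < (1 + z) / 2 < 1)%R.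
  move: z1 => z1'; apply/andP; split; lra.
move: zz; set y := ((1 + z) / 2)%R => /andP[zy y1].
have [D D0 hD] := uab y zy; have y0 : (0 < y)%R by exact: lt_trans zy.
have yj0 j : (0 <= y ^+ j)%R by rewrite exprn_ge0// ltW.
set S := (2 * (1 - y)^-1)%R.
have S0 : (0 < S)%R by rewrite mulr_gt0// invr_gt0 subr_gt0.
have [y01] : ((0 <= y < 1)%R : Prop) by rewrite ltW.
have CSD0 : (0 < C * (S * D))%R by rewrite mulr_gt0// mulr_gt0.
exists (4 * (4 * (1 + C) + C * (S * D)))%R => [|x u n x0 u0 ux uxn].
  by rewrite mulr_gt0// addr_gt0// mulr_gt0// addr_gt0.
have b0 k : 0 <= block_norm p al x k n by exact: block_norm_ge0.
have tail_cst k : (k >= n)%N ->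
    tail_norm p al u k <= C%:E * ((al k)%:E * x n).
  (* If x n is infinite, so is the right-hand side, because al_k > 0; hence x n may be treated as a
     real number. *)
  move=> nk; have [xn|xn] := eqVneq (x n) +oo.
    rewrite xn gt0_muley ?gt0_muley ?leey ?lte_fin//.
  have xnf : x n \is a fin_num by rewrite ge0_fin_numE// ltey.
  rewrite muleA -EFinM muleC -{1}(fineK xnf).
  apply: (@le_trans _ _ ((fine (x n))%:E *
      lq p (fun m => if (k <= m)%N then (al m)%:E else 0))); last first.
    by apply: lee_wpmul2l => //; rewrite ?lee_fin ?fine_ge0.
  rewrite -lq_scale ?fine_ge0//; last first.
    by move=> m; case: ifP => // _; rewrite lee_fin ltW.
  apply: lq_mono => // m; first exact: (al_x_ge0 (leq k)).
  rewrite fineK//; case: ifP => // _; last by rewrite mule0.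
  by rewrite muleC; apply: lee_wpmul2r; rewrite ?lee_fin ?(ltW (al_gt0 _)).
have alxn k : (k <= n)%N -> (al n)%:E * x n <= block_norm p al x k n.
  move=> kn; have := lq_term n p1 (al_x_ge0 (fun m => k <= m <= n)%N x0).
  by rewrite kn leqnn.
have tail_le k : (k <= n)%N ->
    tail_norm p al u k <= (4 * (1 + C))%:E * block_norm p al x k n.
  move=> kn.
  apply: (@le_trans _ _ (4%:E * (block_norm p al x k n + tail_norm p al u n))).
    apply: le_trans (lq_add p1 _ _); [|by move=> m; exact: if_mule_ge0..].
    apply: lq_mono => // m; first exact: (al_x_ge0 (leq k)).
    case: (leqP k m) => km /=; last first.
      by rewrite add0e; exact: if_mule_ge0.
    case: (leqP m n) => mn /=.
      apply: (@le_trans _ _ ((al m)%:E * x m)).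
        by apply: lee_wpmul2l => //; rewrite lee_fin ltW.
      by rewrite leeDl//; exact: if_mule_ge0.
    by rewrite add0e (ltnW mn).
  rewrite EFinM -muleA; apply: lee_wpmul2l => //.
  rewrite EFinD ge0_muleDl ?lee_fin ?(ltW C0)// mul1e; apply: leeD => //.
  apply: (le_trans (tail_cst n (leqnn n))).
  by apply: lee_wpmul2l; rewrite ?lee_fin ?(ltW C0)// alxn.
apply: (@le_trans _ _ (4%:E * ((4 * (1 + C))%:E * gammaJ p q al be x n +
    lq q (fun k => if (n <= k)%N then (be k)%:E * tail_norm p al u k else 0)))).
  rewrite -lq_scale//; last first.
  - by move=> k; apply: if_mule_ge0.
  - by rewrite mulr_ge0// addr_ge0// ltW.
  apply: le_trans (lq_add q1 _ _); last 2 first.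
  - move=> k; rewrite mule_ge0 ?lee_fin ?mulr_ge0 ?addr_ge0 ?(ltW C0)//.
    exact: if_mule_ge0.
  - by move=> k; apply: if_mule_ge0; rewrite ?tail_norm_ge0.
  apply: lq_mono => // k; first by rewrite mule_ge0 ?tail_norm_ge0// lee_fin ltW.
  case: (leqP k n) => kn.
    rewrite muleCA; apply: (@le_trans _ _ ((be k)%:E *
       ((4 * (1 + C))%:E * block_norm p al x k n))).
      by apply: lee_wpmul2l; rewrite ?lee_fin ?be_ge0// tail_le.
    by rewrite leeDl//; apply: if_mule_ge0 => //; exact: tail_norm_ge0.
  by rewrite (ltnW kn) mule0 add0e.
rewrite [in leRHS]EFinM -[in leRHS]muleA.
apply: lee_wpmul2l => //.
rewrite EFinD ge0_muleDl ?lee_fin; last 2 first.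
- by rewrite mulr_ge0// addr_ge0// ltW.
- exact: ltW.
apply: leeD => //.
apply: (@le_trans _ _ ((C * (S * D))%:E * ((be n)%:E * ((al n)%:E * x n)))); last first.
  apply: lee_wpmul2l; first by rewrite lee_fin ltW.
  apply: le_trans (lq_term n q1 (fun k => if_mule_ge0 (k <= n)%N (be_gt0 k) (b0 k))).
  by rewrite leqnn; apply: lee_wpmul2l; rewrite ?lee_fin ?(ltW (be_gt0 _))// alxn.
have [xn|xn] := eqVneq (x n) +oo.
  rewrite xn [in leRHS]gt0_muley ?lte_fin//.
  by rewrite [in leRHS]gt0_muley ?lte_fin// gt0_muley ?leey ?lte_fin.
have xnf : x n \is a fin_num by rewrite ge0_fin_numE// ltey.
have fx0 : (0 <= fine (x n))%R by rewrite fine_ge0.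
rewrite -(fineK xnf) -!EFinM.
rewrite (_ : C * (S * D) * (be n * (al n * fine (x n))) =
  S * (C * D * (be n * al n) * fine (x n)))%R; last by ring.
apply: (@lq_geometric _ _ y _ n) => //.
- by rewrite !mulr_ge0 ?(ltW C0) ?(ltW D0) ?(ltW (be_gt0 _)) ?(ltW (al_gt0 _)).
- by move=> k; apply: if_mule_ge0 => //; exact: tail_norm_ge0.
move=> k; case: ifPn => [nk|_]; last first.
  by rewrite lee_fin !mulr_ge0 ?(ltW C0) ?(ltW D0) ?(ltW (be_gt0 _)) ?(ltW (al_gt0 _)).
apply: (@le_trans _ _ ((be k)%:E * (C%:E * ((al k)%:E * x n)))).
  by apply: lee_wpmul2l; rewrite ?lee_fin ?(ltW (be_gt0 _))// tail_cst.
rewrite -(fineK xnf) -!EFinM lee_fin/=.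
rewrite gap_geq//.
have := hD n (k - n)%N; rewrite subnKC// => hDk.
rewrite [leLHS](_ : _ = (C * fine (x n)) * (be k * al k))%R; last by ring.
rewrite [leRHS](_ : _ = (C * fine (x n)) * (D * y ^+ (k - n) * (be n * al n)))%R; last by ring.
by apply: ler_wpM2l => //; rewrite mulr_ge0// ltW.
Qed.

End DiscreteEstimates.

(** * Monotonicity, quasi-additivity, index shifts and Hardy's inequality *)

Section DiscreteStability.
Context {R : realType}.
Local Open Scope ereal_scope.
Variables (p q : \bar R) (z : R) (al be : nat -> R).
Hypotheses (p1 : 1 <= p) (q1 : 1 <= q) (z1 : (z < 1)%R).
Hypotheses (hal : geomlike z al) (hbe : geomlike 1%R be).
Implicit Types (x u : nat -> \bar R).

Let al_gt0 k : (0 < al k)%R. Proof. exact: geomlike_gt0 hal. Qed.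
Let be_gt0 k : (0 < be k)%R. Proof. exact: geomlike_gt0 hbe. Qed.
Let al_ge0 k : (0 <= al k)%R. Proof. exact: ltW. Qed.
Let be_ge0 k : (0 <= be k)%R. Proof. exact: ltW. Qed.

Lemma tail_norm_mono x u n : nneg x -> (forall k, x k <= u k) ->
  tail_norm p al x n <= tail_norm p al u n.
Proof.
move=> x0 xu; apply: lq_mono => // m; first exact: if_mule_ge0.
by case: ifP => // _; apply: lee_wpmul2l; rewrite ?lee_fin.
Qed.

Lemma block_norm_mono x u k n : nneg x -> (forall k, x k <= u k) ->
  block_norm p al x k n <= block_norm p al u k n.
Proof.
move=> x0 xu; apply: lq_mono => // m; first exact: if_mule_ge0.
by case: ifP => // _; apply: lee_wpmul2l; rewrite ?lee_fin.
Qed.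

Lemma gammaI_mono x u n : nneg x -> (forall k, x k <= u k) ->
  gammaI p q al be x n <= gammaI p q al be u n.
Proof.
move=> x0 xu; apply: lq_mono => // m.
  by apply: if_mule_ge0 => //; apply: tail_norm_ge0 hal _ _ _ => //.
case: ifP => // _; apply: lee_wpmul2l; rewrite ?lee_fin//.
exact: tail_norm_mono.
Qed.

Lemma gammaJ_mono x u n : nneg x -> (forall k, x k <= u k) ->
  gammaJ p q al be x n <= gammaJ p q al be u n.
Proof.
move=> x0 xu; apply: lq_mono => // m.
  by apply: if_mule_ge0 => //; apply: block_norm_ge0 hal _ _ _ _ => //.
case: ifP => // _; apply: lee_wpmul2l; rewrite ?lee_fin//.
exact: block_norm_mono.
Qed.

Lemma tail_norm_add x u n : nneg x -> nneg u ->
  tail_norm p al (fun k => x k + u k) n <=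
    4%:E * (tail_norm p al x n + tail_norm p al u n).
Proof.
move=> x0 u0; apply: le_trans (lq_add p1 _ _); [|by move=> k; exact: if_mule_ge0..].
apply: lq_mono => // k; first by apply: if_mule_ge0; rewrite ?adde_ge0.
by case: ifP => // _; rewrite ?adde0// ge0_muleDr.
Qed.

Lemma block_norm_add x u k n : nneg x -> nneg u ->
  block_norm p al (fun k => x k + u k) k n <=
    4%:E * (block_norm p al x k n + block_norm p al u k n).
Proof.
move=> x0 u0; apply: le_trans (lq_add p1 _ _); [|by move=> m; exact: if_mule_ge0..].
apply: lq_mono => // m; first by apply: if_mule_ge0; rewrite ?adde_ge0.
by case: ifP => // _; rewrite ?adde0// ge0_muleDr.
Qed.

(** The factor 4 of the inner norm and the factor 4 of the outer one multiply to 16. *)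
Let lq_if_add (P : pred nat) (f g h : nat -> \bar R) :
  nneg f -> nneg g -> nneg h ->
  (forall k, h k <= 4%:E * (f k + g k)) ->
  lq q (fun k => if P k then (be k)%:E * h k else 0) <=
  16%:E * (lq q (fun k => if P k then (be k)%:E * f k else 0) +
           lq q (fun k => if P k then (be k)%:E * g k else 0)).
Proof.
move=> f0 g0 h0 hfg.
have -> : 16%R = (4 * 4)%R :> R by ring.
rewrite EFinM -muleA.
apply: (@le_trans _ _ (4%:E * lq q (fun k =>
    (if P k then (be k)%:E * f k else 0) + (if P k then (be k)%:E * g k else 0)))).
  rewrite -lq_scale//; last by move=> k; rewrite adde_ge0// if_mule_ge0.
  apply: lq_mono => // k; first exact: if_mule_ge0.
  case: ifP => _; last by rewrite adde0 mule0.
  by rewrite -ge0_muleDr// muleCA; apply: lee_wpmul2l; rewrite ?lee_fin.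
apply: lee_wpmul2l => //; apply: lq_add => // k; exact: if_mule_ge0.
Qed.

Lemma gammaI_add x u n : nneg x -> nneg u ->
  gammaI p q al be (fun k => x k + u k) n <=
    16%:E * (gammaI p q al be x n + gammaI p q al be u n).
Proof.
move=> x0 u0; have xu0 k : 0 <= x k + u k by exact: adde_ge0.
apply: (@lq_if_add (leq n)) => k; last exact: tail_norm_add.
all: by apply: tail_norm_ge0 hal _ _ _.
Qed.

Lemma gammaJ_add x u n : nneg x -> nneg u ->
  gammaJ p q al be (fun k => x k + u k) n <=
    16%:E * (gammaJ p q al be x n + gammaJ p q al be u n).
Proof.
move=> x0 u0; have xu0 k : 0 <= x k + u k by exact: adde_ge0.
apply: (@lq_if_add (fun k => k <= n)%N) => k; last exact: block_norm_add.
all: by apply: block_norm_ge0 hal _ _ _ _.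
Qed.

Lemma tail_norm_shift : exists2 C : R, (0 < C)%R &
  forall x n, nneg x ->
  tail_norm p al (fun k => x k.+1) n <= C%:E * tail_norm p al x n.+1.
Proof.
have [C C0 hC] := geomlike_step hal; exists C => // x n x0.
pose f m := if (n.+1 <= m)%N then (al m)%:E * x m else 0.
have f0 k : 0 <= f k by exact: if_mule_ge0.
apply: (@le_trans _ _ (C%:E * lq p (fun k => f k.+1))); last first.
  by apply: lee_wpmul2l; [rewrite lee_fin ltW|exact: lq_shift].
rewrite -lq_scale ?(ltW C0)//; apply: lq_mono => // m; first exact: if_mule_ge0.
rewrite /f ltnS; case: ifP => _; last by rewrite mule0.
by rewrite muleA -EFinM; apply: lee_wpmul2r; rewrite ?lee_fin; have [] := hC m.
Qed.

(** The rearrangement of a sum at t is controlled by those of the summands at t / 2, one dyadic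
    index later; this bounds the price of that index shift. *)
Lemma gammaY_shift : exists2 C : R, (0 < C)%R &
  forall x, nneg x ->
  gammaY p q al be (fun k => x k.+1) <= C%:E * gammaY p q al be x.
Proof.
have [C C0 hC] := tail_norm_shift; have [D D0 hD] := geomlike_step hbe.
exists (D * C)%R => [|x x0]; first exact: mulr_gt0.
have t0 u k : nneg u -> 0 <= tail_norm p al u k.
  by move=> u0; apply: tail_norm_ge0 hal _ _ _.
pose f k := (be k)%:E * tail_norm p al x k.
have f0 k : 0 <= f k by rewrite mule_ge0 ?lee_fin ?t0.
apply: (@le_trans _ _ ((D * C)%:E * lq q (fun k => f k.+1))); last first.
  by apply: lee_wpmul2l; [rewrite lee_fin mulr_ge0// ltW|exact: lq_shift].
rewrite -lq_scale ?mulr_ge0 ?(ltW C0) ?(ltW D0)//; apply: lq_mono => // m.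
  by rewrite mule_ge0 ?lee_fin ?t0.
apply: (@le_trans _ _ ((D * be m.+1)%:E * (C%:E * tail_norm p al x m.+1))).
  apply: lee_pmul; rewrite ?lee_fin ?t0//; last exact: hC.
  by have [] := hD m.
by rewrite /f !EFinM muleACA.
Qed.

Lemma tail_norm_step : exists2 C : R, (0 < C)%R &
  forall x n, nneg x -> (forall k, x k <= x k.+1) ->
  tail_norm p al x n <= C%:E * tail_norm p al x n.+1.
Proof.
have [C C0 hC] := tail_norm_shift; exists C => // x n x0 xS.
exact: le_trans (tail_norm_mono _ x0 xS) (hC _ _ x0).
Qed.

(** An integral over (0, u) sees in full only the cells strictly to the left of that of u; for
    nondecreasing x the missing first index costs a constant. *)
Lemma gammaI_step : exists2 C : R, (0 < C)%R &
  forall x n, nneg x -> (forall k, x k <= x k.+1) ->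
  gammaI p q al be x n <= C%:E * gammaI p q al be x n.+1.
Proof.
have [C C0 hC] := tail_norm_step; have [D D0 hD] := geomlike_step hbe.
exists (D * C)%R => [|x n x0 xS]; first exact: mulr_gt0.
have t0 k : 0 <= tail_norm p al x k by apply: tail_norm_ge0 hal _ _ _.
pose f k := if (n.+1 <= k)%N then (be k)%:E * tail_norm p al x k else 0.
have f0 k : 0 <= f k by exact: if_mule_ge0.
apply: (@le_trans _ _ ((D * C)%:E * lq q (fun k => f k.+1))); last first.
  by apply: lee_wpmul2l; [rewrite lee_fin mulr_ge0// ltW|exact: lq_shift].
rewrite -lq_scale ?mulr_ge0 ?(ltW C0) ?(ltW D0)//; apply: lq_mono => // m.
  exact: if_mule_ge0.
rewrite /f ltnS; case: ifP => _; last by rewrite mule0.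
apply: (@le_trans _ _ ((D * be m.+1)%:E * (C%:E * tail_norm p al x m.+1))).
  apply: lee_pmul; rewrite ?lee_fin ?t0//; last exact: hC.
  by have [] := hD m.
by rewrite !EFinM muleACA.
Qed.

Let T := head_norm q be.

Lemma nneseries_term (f : nat -> \bar R) j : nneg f ->
  f j <= \sum_(k <oo) f k.
Proof.
move=> f0; rewrite (@nneseriesD1 _ _ j)// leeDl//.
by apply: nneseries_ge0 => *.
Qed.

Lemma mule_lee_divl (a c : R) (e f : \bar R) : (0 < a)%R -> (0 < c)%R ->
  e <= (c / a)%:E * f -> a%:E * e <= c%:E * f.
Proof.
move=> a0 c0 h.
apply: (@le_trans _ _ (a%:E * ((c / a)%:E * f))).
  by apply: lee_wpmul2l => //; rewrite lee_fin ltW.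
by rewrite muleA -EFinM mulrC divfK// gt_eqF.
Qed.

(* Hardy's inequality in pointwise form: the head part at level n is a         *)
(* geometrically weighted sum of its diagonal terms at finer scales.           *)
Lemma head_tail_gammaI_le_series (w : R) (chi : nat -> R) :
  (1 < w)%R -> geomlike w chi ->
  exists y : R, (0 < y < 1)%R /\ exists2 C : R, (0 < C)%R &
    forall x n, nneg x ->
    (chi n)%:E * ((T n)%:E * tail_norm p al x n + gammaI p q al be x n) <=
    C%:E * \sum_(j <oo) (y ^+ j)%:E *
      ((chi (n + j) * (al (n + j) * T (n + j)))%:E * x (n + j)%N).
Proof.
move=> w1 [w0 chi0 _ lchi].
have [y2 /andP[y21 y2w]] : exists y2, (1 < y2 < w)%R.
  by exists ((1 + w) / 2)%R; apply/andP; split; lra.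
have y20 : (0 < y2)%R by exact: lt_trans y21.
(* The growth y2^j = y^(-2j) of chi pays for the weight y^j of the series and leaves the decay y^j
   that [tail_gammaI_bound] requires. *)
set y := Num.sqrt y2^-1.
have y2V1 : (y2^-1 < 1)%R by rewrite invf_lt1.
have y0 : (0 < y)%R by rewrite sqrtr_gt0 invr_gt0.
have y1 : (y < 1)%R by rewrite -sqrtr1 ltr_sqrt.
have yy : (y * y * y2 = 1)%R.
  by rewrite -expr2 sqr_sqrtr ?invr_ge0 ?ltW// mulVf// gt_eqF.
exists y; split; first by rewrite y0.
have [C C0 hC] := lchi y2 ltac:(by rewrite y20).
have [D D0 hD] := tail_gammaI_bound p1 q1 hal hbe (y := y) ltac:(by rewrite y0).
exists (2 * (D * C))%R => [|x n x0]; first by rewrite !mulr_gt0.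
have T0 k : (0 < T k)%R by exact: head_norm_gt0.
have t0 k : (0 <= y ^+ k)%R by rewrite exprn_ge0// ltW.
pose f j := (y ^+ j)%:E *
  ((chi (n + j) * (al (n + j) * T (n + j)))%:E * x (n + j)%N).
have f0 j : 0 <= f j.
  rewrite /f mule_ge0 ?lee_fin// mule_ge0 ?lee_fin// ltW//.
  by rewrite mulr_gt0// mulr_gt0.
apply: mule_lee_divl => //; first by rewrite !mulr_gt0.
pose S := \sum_(j <oo) f j; rewrite -/S.
have S0 : 0 <= S by apply: nneseries_ge0 => *.
(* An infinite series makes the claim trivial; a finite sum bounds each of its diagonal terms. *)
have [->|Soo] := eqVneq S +oo.
  by rewrite gt0_muley ?leey// lte_fin divr_gt0// !mulr_gt0.
have Sf : S \is a fin_num by rewrite ge0_fin_numE// ltey.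
rewrite -(fineK Sf).
have [] := hD x n (C * fine S / chi n)%R x0.
- by rewrite !mulr_ge0 ?fine_ge0 ?invr_ge0 ?(ltW C0) ?(ltW (chi0 n)).
- move=> j; have := nneseries_term j f0; rewrite -/S -(fineK Sf).
  have -> : f j = ((al (n + j) * T (n + j)) * (y ^+ j * chi (n + j)%N))%:E * x (n + j)%N.
    by rewrite /f muleA -EFinM; congr (_%:E * _); ring.
  move=> /(lee_divr (mulr_gt0 (exprn_gt0 j y0) (chi0 _)))/le_trans.
  apply; rewrite lee_fin.
  rewrite ler_pdivrMr; last by rewrite mulr_gt0// exprn_gt0.
  have := hC n j => hCj.
  rewrite [leRHS](_ : _ = fine S / chi n * (y * y) ^+ j * (C * chi (n + j)%N))%R; last first.
    by rewrite exprMn; field; rewrite gt_eqF.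
  apply: (@le_trans _ _ (fine S / chi n * (y * y) ^+ j * (y2 ^+ j * chi n))%R).
    rewrite [leRHS](_ : _ = fine S * ((y * y) ^+ j * y2 ^+ j))%R; last first.
      by field; rewrite gt_eqF.
    by rewrite -exprMn yy expr1n mulr1.
  apply: ler_wpM2l => //.
  by rewrite !mulr_ge0 ?fine_ge0 ?invr_ge0 ?exprn_ge0 ?mulr_ge0 ?(ltW y0) ?(ltW (chi0 n)).
move=> h1 h2; apply: (le_trans (leeD h1 h2)).
rewrite -EFinD -EFinM lee_fin.
rewrite [leRHS](_ : _ = D * (C * fine S / chi n) + D * (C * fine S / chi n))%R//.
by field; rewrite gt_eqF.
Qed.

(** Mirror image of the head estimate: chi decays, so the block part is controlled by diagonal terms
    at coarser scales. The decay y2 = y * y is shared between the weights of the series and the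
    hypothesis of [gammaJ_bound]. *)
Lemma gammaJ_le_series (w : R) (chi : nat -> R) :
  (w < 1)%R -> geomlike w chi ->
  exists y : R, (0 < y < 1)%R /\ exists2 C : R, (0 < C)%R &
    forall x n, nneg x ->
    (chi n)%:E * gammaJ p q al be x n <=
    C%:E * \sum_(j <oo) (y ^+ j)%:E * (if (j <= n)%N then
      (chi (n - j)%N * (al (n - j)%N * T (n - j)))%:E * x (n - j)%N else 0).
Proof.
move=> w1 [w0 chi0 uchi _].
have [y2 /andP[y2w y21]] : exists y2, (w < y2 < 1)%R.
  by exists ((1 + w) / 2)%R; apply/andP; split; lra.
have y20 : (0 < y2)%R by exact: lt_trans y2w.
set y := Num.sqrt y2.
have y0 : (0 < y)%R by rewrite sqrtr_gt0.
have y1 : (y < 1)%R by rewrite -sqrtr1 ltr_sqrt.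
have yy : (y2 = y * y)%R.
  by rewrite -expr2 sqr_sqrtr// ltW.
exists y; split; first by rewrite y0.
have [C C0 hC] := uchi y2 y2w.
have [D D0 hD] := gammaJ_bound p1 q1 hal hbe (y := y) ltac:(by rewrite y0).
exists (D * C)%R => [|x n x0]; first by rewrite !mulr_gt0.
have T0 k : (0 < T k)%R by exact: head_norm_gt0.
have t0 k : (0 <= y ^+ k)%R by rewrite exprn_ge0// ltW.
pose f j := (y ^+ j)%:E * (if (j <= n)%N then
  (chi (n - j)%N * (al (n - j)%N * T (n - j)))%:E * x (n - j)%N else 0).
have f0 j : 0 <= f j.
  rewrite /f mule_ge0 ?lee_fin//; apply: if_mule_ge0 => //.
  by rewrite !mulr_gt0.
apply: mule_lee_divl => //; first by rewrite !mulr_gt0.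
pose S := \sum_(j <oo) f j; rewrite -/S.
have S0 : 0 <= S by apply: nneseries_ge0 => *.
have [->|Soo] := eqVneq S +oo.
  by rewrite gt0_muley ?leey// lte_fin divr_gt0// !mulr_gt0.
have Sf : S \is a fin_num by rewrite ge0_fin_numE// ltey.
rewrite -(fineK Sf).
apply: le_trans (hD x n (C * fine S / chi n)%R x0 _ _) _.
- by rewrite !mulr_ge0 ?fine_ge0 ?invr_ge0 ?(ltW C0) ?(ltW (chi0 n)).
- move=> m mn; have := nneseries_term (n - m)%N f0; rewrite -/S -(fineK Sf).
  have -> : f (n - m)%N = ((al m * T m) * (y ^+ (n - m) * chi m))%:E * x m.
    by rewrite /f leq_subr subKn// muleA -EFinM; congr (_%:E * _); ring.
  move=> /(lee_divr (mulr_gt0 (exprn_gt0 (n - m)%N y0) (chi0 _)))/le_trans.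
  apply; rewrite lee_fin.
  rewrite ler_pdivrMr; last by rewrite mulr_gt0// exprn_gt0.
  have := hC m (n - m)%N; rewrite subnKC// => hCj.
  rewrite [leRHS](_ : _ = fine S / chi n * (C * y2 ^+ (n - m) * chi m))%R; last first.
    by rewrite yy exprMn; field; rewrite gt_eqF.
  apply: (@le_trans _ _ (fine S / chi n * chi n)%R).
    by rewrite divfK// gt_eqF.
  by apply: ler_wpM2l => //; rewrite mulr_ge0 ?fine_ge0 ?invr_ge0 ?(ltW (chi0 n)).
rewrite -EFinM lee_fin.
by rewrite [leRHS](_ : _ = D * (C * fine S / chi n))%R//; field; rewrite gt_eqF.
Qed.

End DiscreteStability.

(** * The discrete K-functional of a couple *)

Section TwoGammas.
Context {R : realType}.
Local Open Scope ereal_scope.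
Variables (pa qa pb qb : \bar R) (za zb : R) (ala bea alb beb : nat -> R).
Hypotheses (pa1 : 1 <= pa) (qa1 : 1 <= qa) (pb1 : 1 <= pb) (qb1 : 1 <= qb).
Hypotheses (zab : (za < zb)%R) (zb1 : (zb < 1)%R).
Hypotheses (hala : geomlike za ala) (hbea : geomlike 1%R bea).
Hypotheses (halb : geomlike zb alb) (hbeb : geomlike 1%R beb).
Implicit Types (x u w : nat -> \bar R).

(** When al decays geometrically, this is comparable to the Gamma norm of the indicator of an
    interval of length 2^-n. *)
Definition fundamental (q : \bar R) (al be : nat -> R) (n : nat) : R :=
  (al n * head_norm q be n)%R.

Definition phi_ratio n : R := (fundamental qa ala bea n / fundamental qb alb beb n)%R.

(* Holmstedt's formula for the K-functional at phi_ratio n *)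
Definition Kseq x n : \bar R :=
  (head_norm qa bea n)%:E * tail_norm pa ala x n + gammaI pa qa ala bea x n +
  (phi_ratio n)%:E * gammaJ pb qb alb beb x n.

Lemma fundamental_geomlike (q : \bar R) (z : R) (al be : nat -> R) : 1 <= q ->
  geomlike z al -> geomlike 1%R be -> geomlike z (fundamental q al be).
Proof.
by move=> q1 h1 h2; rewrite -[z]mulr1; apply: geomlike_mul => //; exact: head_norm_geomlike.
Qed.

Lemma phi_ratio_geomlike : geomlike (za / zb)%R phi_ratio.
Proof.
apply: geomlike_mul; first exact: fundamental_geomlike.
by apply: geomlike_inv; exact: fundamental_geomlike.
Qed.

Let za0 : (0 < za)%R. Proof. by case: hala. Qed.
Let zb0 : (0 < zb)%R. Proof. by case: halb. Qed.
Let ratio_gt0 n : (0 < phi_ratio n)%R.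
Proof. exact: geomlike_gt0 phi_ratio_geomlike. Qed.
Let Ta0 n : (0 < head_norm qa bea n)%R. Proof. exact: head_norm_gt0. Qed.
Let phi0_gt0 n : (0 < fundamental qa ala bea n)%R.
Proof. exact: geomlike_gt0 (fundamental_geomlike qa1 hala hbea). Qed.
Let phi1_gt0 n : (0 < fundamental qb alb beb n)%R.
Proof. exact: geomlike_gt0 (fundamental_geomlike qb1 halb hbeb). Qed.

Let tail0 x n : nneg x -> 0 <= tail_norm pa ala x n.
Proof. by move=> x0; apply: tail_norm_ge0 hala _ _ _. Qed.

Let headtail0 x n : nneg x ->
  0 <= (head_norm qa bea n)%:E * tail_norm pa ala x n.
Proof. by move=> x0; rewrite mule_ge0 ?tail0// lee_fin ltW. Qed.

Let ratioJ0 x n : nneg x ->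
  0 <= (phi_ratio n)%:E * gammaJ pb qb alb beb x n.
Proof.
by move=> x0; rewrite mule_ge0 ?lee_fin ?(ltW (ratio_gt0 _))//; apply: gammaJ_ge0 halb hbeb _ _ _.
Qed.

Let I0 x n : nneg x -> 0 <= gammaI pa qa ala bea x n.
Proof. by move=> x0; apply: gammaI_ge0 hala hbea _ _ _. Qed.

Lemma Kseq_ge0 x n : nneg x -> 0 <= Kseq x n.
Proof. by move=> x0; rewrite /Kseq !adde_ge0 ?headtail0 ?I0 ?ratioJ0. Qed.

Let ratio_lt1 : (za / zb < 1)%R. Proof. by rewrite ltr_pdivrMr// mul1r. Qed.

Let rate : exists y, (za / zb < y)%R /\ (0 < y < 1)%R.
Proof.
move: ratio_lt1 => h; have h0 : (0 < za / zb)%R by exact: divr_gt0.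
exists ((za / zb + 1) / 2)%R; split; [lra|apply/andP; split; lra].
Qed.

Let phi_x_le_gammaY (q p : \bar R) (z : R) (al be : nat -> R) x m :
  1 <= p -> 1 <= q -> geomlike z al -> geomlike 1%R be -> nneg x ->
  (fundamental q al be m)%:E * x m <= gammaY p q al be x.
Proof.
move=> p1 q1 hal hbe x0.
exact: le_trans (phi_le_head_tail p1 q1 hal hbe m x0)
                (head_tail_le_gammaY p1 q1 hal hbe m x0).
Qed.

(** Only the block part needs an argument. The norm Y bounds every phi0_m x_m, so phi1_m x_m <= Y /
    ratio_m; as the ratio decays geometrically, this is at most C y^(n-m) Y / ratio_n for m <= n,
    the input of [gammaJ_bound]. *)
Lemma Kseq_le_gammaY0 : exists2 C : R, (0 < C)%R &
  forall x n, nneg x -> Kseq x n <= C%:E * gammaY pa qa ala bea x.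
Proof.
have [y [zy /andP[y0 y1]]] := rate.
have [_ _ /(_ _ zy)[C C0 hC] _] := phi_ratio_geomlike.
have [D D0 hD] := gammaJ_bound pb1 qb1 halb hbeb (y := y) ltac:(by rewrite y0).
exists (1 + 1 + D * C)%R => [|x n x0]; first by rewrite addr_gt0// mulr_gt0.
have Y0 : 0 <= gammaY pa qa ala bea x by apply: gammaY_ge0 hala hbea _ _.
rewrite EFinD ge0_muleDl ?lee_fin ?mulr_ge0 ?(ltW C0) ?(ltW D0)//.
rewrite EFinD ge0_muleDl ?lee_fin// mul1e.
apply: leeD; first apply: leeD.
- exact: (head_tail_le_gammaY pa1 qa1 hala hbea n x0).
- exact: (gammaI_le_gammaY _ qa1 hala hbea n x0).
set Y := gammaY pa qa ala bea x in Y0 *.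
have [->|Yoo] := eqVneq Y +oo.
  by rewrite gt0_muley ?leey// lte_fin mulr_gt0.
have Yf : Y \is a fin_num by rewrite ge0_fin_numE// ltey.
apply: mule_lee_divl => //; first exact: mulr_gt0.
rewrite -(fineK Yf); set M := fine Y; have M0 : (0 <= M)%R by exact: fine_ge0.
apply: le_trans (hD x n (C * M / phi_ratio n)%R x0 _ _) _.
- by rewrite !mulr_ge0 ?invr_ge0 ?(ltW C0) ?(ltW (ratio_gt0 n)).
- move=> m mn.
  have := phi_x_le_gammaY m pa1 qa1 hala hbea x0; rewrite -/Y -(fineK Yf) -/M.
  have -> : (fundamental qa ala bea m = fundamental qb alb beb m * phi_ratio m)%R.
    by rewrite /phi_ratio mulrC divfK// gt_eqF.
  move=> /(lee_divr (ratio_gt0 _))/le_trans; apply; rewrite lee_fin.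
  rewrite ler_pdivrMr//.
  have := hC m (n - m)%N; rewrite subnKC// => hCj.
  rewrite [leRHS](_ : _ = M / phi_ratio n * (C * y ^+ (n - m) * phi_ratio m))%R; last first.
    by field; rewrite gt_eqF.
  apply: (@le_trans _ _ (M / phi_ratio n * phi_ratio n)%R).
    by rewrite divfK// gt_eqF.
  by apply: ler_wpM2l => //; rewrite mulr_ge0 ?invr_ge0 ?(ltW (ratio_gt0 n)).
rewrite -EFinM lee_fin.
by rewrite [leRHS](_ : _ = D * (C * M / phi_ratio n))%R//; field; rewrite gt_eqF.
Qed.

(** Here the head part needs the argument: phi0_m x_m <= ratio_m Y has geometric decay for m >= n,
    the input of [tail_gammaI_bound]. *)
Lemma Kseq_le_gammaY1 : exists2 C : R, (0 < C)%R &
  forall x n, nneg x ->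
  Kseq x n <= C%:E * ((phi_ratio n)%:E * gammaY pb qb alb beb x).
Proof.
have [y [zy /andP[y0 y1]]] := rate.
have [_ _ /(_ _ zy)[C C0 hC] _] := phi_ratio_geomlike.
have [D D0 hD] := tail_gammaI_bound pa1 qa1 hala hbea (y := y) ltac:(by rewrite y0).
exists (D * C + D * C + 1)%R => [|x n x0]; first by rewrite !(addr_gt0, mulr_gt0).
set Y := gammaY pb qb alb beb x.
have Y0 : 0 <= Y by apply: gammaY_ge0 halb hbeb _ _.
have DC0 : (0 <= D * C)%R by rewrite mulr_ge0 ?(ltW C0) ?(ltW D0).
have rY0 : 0 <= (phi_ratio n)%:E * Y by rewrite mule_ge0// lee_fin ltW.
rewrite EFinD ge0_muleDl ?lee_fin ?addr_ge0//.
rewrite EFinD ge0_muleDl ?lee_fin// mul1e.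
apply: leeD; last first.
  apply: lee_wpmul2l; first by rewrite lee_fin ltW.
  exact: (gammaJ_le_gammaY pb1 qb1 halb hbeb n x0).
have [Yoo|Yoo] := eqVneq Y +oo.
  rewrite Yoo (@gt0_muley _ (phi_ratio n)%:E) ?lte_fin//.
  by rewrite gt0_muley ?leey ?lte_fin ?mulr_gt0// addye ?leey.
have Yf : Y \is a fin_num by rewrite ge0_fin_numE// ltey.
rewrite -(fineK Yf); set M := fine Y; have M0 : (0 <= M)%R by exact: fine_ge0.
have [||h1 h2] := hD x n (C * M * phi_ratio n)%R x0.
- exact: mulr_ge0 (mulr_ge0 (ltW C0) M0) (ltW (ratio_gt0 n)).
- move=> j.
  have := phi_x_le_gammaY (n + j)%N pb1 qb1 halb hbeb x0; rewrite -/Y -(fineK Yf) -/M.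
  have -> : (fundamental qb alb beb (n + j) =
      fundamental qa ala bea (n + j) * (phi_ratio (n + j))^-1)%R.
    by rewrite /phi_ratio invf_div mulrC divfK// gt_eqF.
  have r0 : (0 < (phi_ratio (n + j))^-1)%R by rewrite invr_gt0.
  move=> /(lee_divr r0)/le_trans; apply; rewrite lee_fin invrK.
  rewrite [leRHS](_ : _ = M * (C * y ^+ j * phi_ratio n))%R; last by ring.
  by apply: ler_wpM2l => //; exact: hC.
have -> : (D * C)%:E * ((phi_ratio n)%:E * M%:E) = (D * (C * M * phi_ratio n))%:E.
  by rewrite -!EFinM; congr (_%:E); ring.
exact: leeD.
Qed.

Lemma Kseq_add x u n : nneg x -> nneg u ->
  Kseq (fun k => x k + u k) n <= 16%:E * (Kseq x n + Kseq u n).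
Proof.
move=> x0 u0.
have r0 : 0 <= (phi_ratio n)%:E by rewrite lee_fin ltW.
have t0 : 0 <= (head_norm qa bea n)%:E by rewrite lee_fin ltW.
have key (a a1 a2 c c1 c2 d d1 d2 : \bar R) : 0 <= a1 -> 0 <= a2 ->
    0 <= c1 -> 0 <= c2 -> 0 <= d1 -> 0 <= d2 -> a <= 16%:E * (a1 + a2) ->
    c <= 16%:E * (c1 + c2) -> d <= 16%:E * (d1 + d2) ->
    a + c + d <= 16%:E * ((a1 + c1 + d1) + (a2 + c2 + d2)).
  move=> ? ? ? ? ? ? h1 h2 h3; rewrite (addeACA (a1 + c1)) (addeACA a1).
  rewrite ge0_muleDr ?adde_ge0// ge0_muleDr ?adde_ge0//.
  by apply: leeD => //; exact: leeD.
apply: key; rewrite ?headtail0 ?I0 ?ratioJ0//.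
- rewrite -(ge0_muleDr _ (tail0 n x0) (tail0 n u0)) muleCA; apply: lee_wpmul2l => //.
  apply: (le_trans (tail_norm_add pa1 hala n x0 u0)).
  by apply: lee_wpmul2r; [rewrite adde_ge0 ?tail0|rewrite lee_fin ler_nat].
- exact: (gammaI_add pa1 qa1 hala hbea n x0 u0).
- have Jx0 : 0 <= gammaJ pb qb alb beb x n by apply: gammaJ_ge0 halb hbeb _ _ _.
  have Ju0 : 0 <= gammaJ pb qb alb beb u n by apply: gammaJ_ge0 halb hbeb _ _ _.
  rewrite -(ge0_muleDr _ Jx0 Ju0) muleCA; apply: lee_wpmul2l => //.
  exact: (gammaJ_add pb1 qb1 halb hbeb n x0 u0).
Qed.

Lemma Kseq_mono x u n : nneg x -> (forall k, x k <= u k) ->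
  Kseq x n <= Kseq u n.
Proof.
move=> x0 xu; have u0 k : 0 <= u k by exact: le_trans (xu k).
apply: leeD; first apply: leeD.
- by apply: lee_wpmul2l; [rewrite lee_fin ltW|exact: (tail_norm_mono pa1 hala)].
- exact: (gammaI_mono pa1 qa1 hala hbea).
- by apply: lee_wpmul2l; [rewrite lee_fin ltW|exact: (gammaJ_mono pb1 qb1 halb hbeb)].
Qed.

(** [Kseq] is monotone and quasi-additive, and each summand is estimated by its own norm; for an
    arbitrary decomposition this is the lower estimate of the K-functional. The successors reflect
    the halved argument in the subadditivity of rearrangements. *)
Lemma Kseq_lower : exists2 C : R, (0 < C)%R &
  forall x u w n, nneg x -> nneg u ->
  nneg w -> (forall k, x k <= u k.+1 + w k.+1) ->
  Kseq x n <= C%:E *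
    (gammaY pa qa ala bea u + (phi_ratio n)%:E * gammaY pb qb alb beb w).
Proof.
have [C C0 hC] := Kseq_le_gammaY0; have [D D0 hD] := Kseq_le_gammaY1.
have [C' C'0 hC'] := gammaY_shift pa1 qa1 hala hbea.
have [D' D'0 hD'] := gammaY_shift pb1 qb1 halb hbeb.
exists (16 * (C * C' + D * D'))%R => [|x u w n x0 u0 w0 xuw].
  by rewrite mulr_gt0// addr_gt0// mulr_gt0.
have Yu : 0 <= gammaY pa qa ala bea u by apply: gammaY_ge0 hala hbea _ _.
have Yw : 0 <= gammaY pb qb alb beb w by apply: gammaY_ge0 halb hbeb _ _.
have rYw : 0 <= (phi_ratio n)%:E * gammaY pb qb alb beb w.
  by rewrite mule_ge0// lee_fin ltW.
apply: (le_trans (Kseq_mono n x0 xuw)).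
apply: (le_trans (Kseq_add n (fun k => u0 k.+1) (fun k => w0 k.+1))).
rewrite EFinM -muleA; apply: lee_wpmul2l => //.
have CC0 : (0 <= C * C')%R by rewrite mulr_ge0 ?(ltW C0) ?(ltW C'0).
have DD0 : (0 <= D * D')%R by rewrite mulr_ge0 ?(ltW D0) ?(ltW D'0).
rewrite (ge0_muleDr _ Yu rYw); apply: leeD.
- apply: (le_trans (hC _ n (fun k => u0 k.+1))).
  apply: (@le_trans _ _ ((C * C')%:E * gammaY pa qa ala bea u)).
    by rewrite EFinM -muleA; apply: lee_wpmul2l; rewrite ?lee_fin ?(ltW C0) ?hC'.
  by apply: lee_wpmul2r => //; rewrite lee_fin lerDl.
- apply: (le_trans (hD _ n (fun k => w0 k.+1))).
  apply: (@le_trans _ _ ((D * D')%:E * ((phi_ratio n)%:E * gammaY pb qb alb beb w))).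
    rewrite (EFinM D D') -(muleA D%:E); apply: lee_wpmul2l; rewrite ?lee_fin ?(ltW D0)//.
    by rewrite muleCA; apply: lee_wpmul2l; rewrite ?lee_fin ?(ltW (ratio_gt0 n)) ?hD'.
  by apply: lee_wpmul2r => //; rewrite lee_fin lerDr.
Qed.

(** The upper estimate of the K-functional: u and w stand for the rearrangements of the parts of f
    above and below the height x_n. *)
Lemma Kseq_upper : exists2 C : R, (0 < C)%R &
  forall x u w n, nneg x -> nneg u ->
  nneg w -> (forall k, u k <= x k) -> (forall k, w k <= x k) ->
  (forall k, (k < n)%N -> u k = 0) -> (forall k, w k <= x n) ->
  gammaY pa qa ala bea u + (phi_ratio n)%:E * gammaY pb qb alb beb w <=
  C%:E * Kseq x n.
Proof.
have [D D0 hD] := gammaY_le_gammaJ pb1 qb1 zb1 halb hbeb.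
exists (4 + D)%R => [|x u w n x0 u0 w0 ux wx un wn]; first by rewrite addr_gt0.
rewrite /Kseq ge0_muleDr ?adde_ge0 ?headtail0 ?I0 ?ratioJ0//; apply: leeD.
- apply: (le_trans (gammaY_le_tail_gammaI pa1 qa1 hala hbea x0 u0 ux un)).
  apply: lee_wpmul2r; first by rewrite adde_ge0 ?headtail0 ?I0.
  by rewrite lee_fin lerDl ltW.
- rewrite muleCA; apply: lee_wpmul2l; first by rewrite lee_fin ltW.
  apply: (le_trans (hD x w n x0 w0 wx wn)).
  apply: lee_wpmul2r; first by apply: gammaJ_ge0 halb hbeb _ _ _.
  by rewrite lee_fin lerDr.
Qed.

End TwoGammas.

(** * Dyadic discretization *)

Section DyadicCells.
Context {R : realType}.
Local Open Scope ereal_scope.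
Local Notation lambda := (@lebesgue_measure R).
Implicit Types (a : nat -> \bar R) (t : R) (j : nat).

(** The left endpoint of the cell (2^-(j+1), 2^-j]; the offset in the exponent keeps all these
    points inside (0, 1). *)
Definition dyadic j : R := (2^-1 ^+ j.+1)%R.

Lemma dyadic_gt0 j : (0 < dyadic j)%R.
Proof. by rewrite exprn_gt0// invr_gt0. Qed.

Lemma dyadicS j : dyadic j = (2 * dyadic j.+1)%R.
Proof. by rewrite /dyadic (exprS _ j.+1) mulrA divff ?mul1r// pnatr_eq0. Qed.

Lemma dyadic_anti i j : (i <= j)%N -> (dyadic j <= dyadic i)%R.
Proof.
move=> ij; apply: ler_wiXn2l; rewrite ?invr_ge0 ?ler0n ?invf_le1 ?ler1n//.
Qed.

Lemma dyadic_lt1 j : (dyadic j < 1)%R.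
Proof.
apply: (le_lt_trans (dyadic_anti (leq0n j))).
by rewrite /dyadic expr1 invf_lt1 ?ltr1n.
Qed.

Lemma dyadic_lt_ex t : (0 < t)%R -> exists j, (dyadic j < t)%R.
Proof.
move=> t0; have := @cvg_expr R 2^-1; rewrite ger0_norm ?invr_ge0//.
rewrite invf_lt1 ?ltr1n// => /(_ isT) /cvgrPdist_lt /(_ _ t0) [N _ /(_ N (leqnn _))].
rewrite /= sub0r normrN ger0_norm ?exprn_ge0 ?invr_ge0// => h.
exists N; apply: le_lt_trans h; rewrite /dyadic exprS ler_piMl ?exprn_ge0 ?invr_ge0//.
by rewrite invf_le1 ?ler1n.
Qed.

(* the unique j with 2^-(j+1) < t <= 2^-j, for 0 < t <= 1 *)
Definition cell t : nat :=
  match pselect (exists j, (dyadic j < t)%R) with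
  | left e => ex_minn e
  | right _ => 0%N
  end.

Lemma cellP t : (0 < t <= 1)%R -> (dyadic (cell t) < t <= 2 * dyadic (cell t))%R.
Proof.
move=> /andP[t0 t1]; rewrite /cell; case: pselect => [e|]; last first.
  by move/(_ (dyadic_lt_ex t0)).
case: ex_minnP => -[|j] -> hj /=.
  by rewrite /dyadic expr1 divff.
rewrite -dyadicS leNgt; apply/negP => /hj.
by rewrite ltnn.
Qed.

Lemma cell_eq t j : (0 < t <= 1)%R -> (dyadic j < t <= 2 * dyadic j)%R -> cell t = j.
Proof.
move=> t01 /andP[jt tj]; have /andP[ct tc] := cellP t01.
apply/eqP; rewrite eqn_leq; apply/andP; split; rewrite leqNgt; apply/negP => h.
  have := dyadic_anti h; rewrite -(ler_pM2l (ltr0Sn R 1)) -dyadicS => h'.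
  by have := lt_le_trans jt (le_trans tc h'); rewrite ltxx.
have := dyadic_anti h; rewrite -(ler_pM2l (ltr0Sn R 1)) -dyadicS => h'.
by have := lt_le_trans ct (le_trans tj h'); rewrite ltxx.
Qed.

Lemma leq_cell s t : (0 < s)%R -> (s <= t)%R -> (t <= 1)%R -> (cell t <= cell s)%N.
Proof.
move=> s0 st t1; rewrite leqNgt; apply/negP => h.
have /andP[_ sc] : (dyadic (cell s) < s <= 2 * dyadic (cell s))%R.
  by apply: cellP; rewrite s0 (le_trans st).
have /andP[ct tc] : (dyadic (cell t) < t <= 2 * dyadic (cell t))%R.
  by apply: cellP; rewrite (lt_le_trans s0).
have /andP[cs _] : (dyadic (cell s) < s <= 2 * dyadic (cell s))%R.
  by apply: cellP; rewrite s0 (le_trans st).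
have := dyadic_anti h; rewrite -(ler_pM2l (ltr0Sn R 1)) -dyadicS => h'.
by have := lt_le_trans cs (le_trans st (le_trans tc h')); rewrite ltxx.
Qed.

Definition cellset j : set R := `]0%R, 1%R[ `&` [set t | cell t = j].

Lemma cellsetE j : cellset j = `]0%R, 1%R[ `&` `]dyadic j, (2 * dyadic j)%R].
Proof.
apply/seteqP; split => t [] /=; rewrite in_itv/= => t01.
  have t01' : (0 < t <= 1)%R by case/andP: t01 => -> /ltW.
  by move=> <-; split => //=; rewrite ?in_itv//=; exact: cellP.
have t01' : (0 < t <= 1)%R by case/andP: t01 => -> /ltW.
by rewrite in_itv/= => h; split => //=; rewrite ?in_itv//=; exact: cell_eq.
Qed.

Lemma measurable_cellset j : measurable (cellset j).
Proof. by rewrite cellsetE; apply: measurableI; exact: measurable_itv. Qed.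

(** Holds for arbitrary nonnegative f and g: the integral is a supremum over simple functions lying
    below, and the larger function on the larger set admits more of them. *)
Lemma ge0_integral_monotone (D D' : set R) (f g : R -> \bar R) :
  (forall x, D x -> 0 <= f x) -> (forall x, D' x -> 0 <= g x) ->
  (forall x, D x -> D' x /\ f x <= g x) ->
  \int[lambda]_(x in D) f x <= \int[lambda]_(x in D') g x.
Proof.
move=> f0 g0 fg; rewrite !ge0_integralE//; apply: ereal_sup_le => _ [h /= hf <-].
exists h => // x; apply: (le_trans (hf x)).
rewrite /patch; case: ifPn => xD.
  by have [xD' fgx] := fg x (set_mem xD); rewrite mem_set.
by case: ifPn => // xD'; apply: g0; exact: set_mem.
Qed.

Lemma dt_over_t_mono (A B : set R) : A `<=` B -> B `<=` `]0%R, +oo[ ->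
  dt_over_t A <= dt_over_t B.
Proof.
move=> AB B0; have iv0 x : B x -> 0 <= (x^-1)%:E.
  by move=> /B0; rewrite /= in_itv/= andbT lee_fin invr_ge0 => /ltW.
by apply: ge0_integral_monotone => x Ax; [apply: iv0; exact: AB|exact: iv0|split; [exact: AB|]].
Qed.

Lemma measurable_inv_pos (D : set R) : measurable D -> D `<=` `]0%R, +oo[ ->
  measurable_fun D (fun x => (x^-1)%:E : \bar R).
Proof.
move=> mD D0; apply/measurable_EFinP.
apply: (measurable_funS _ D0); first exact: measurable_itv.
apply: open_continuous_measurable_fun; first by rewrite set_itvoy; exact: open_gt.
move=> x; rewrite inE/= in_itv/= andbT => x0.
by apply: inv_continuous; rewrite gt_eqF.
Qed.

Lemma integral_inv_interval (c : R) : (0 < c)%R ->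
  \int[lambda]_(x in `[c, (2 * c)%R]) (x^-1)%:E = (ln 2)%:E.
Proof.
move=> c0; have cc : (c < 2 * c)%R by rewrite ltr_pMl// ltr1n.
have c20 : (0 < 2 * c)%R by exact: lt_trans cc.
have pos x : x \in `]c, (2 * c)%R[ -> (0 < x)%R.
  by rewrite in_itv/= => /andP[cx _]; exact: lt_trans cx.
rewrite (@continuous_FTC2 _ (fun x => x^-1)%R (@ln R))//.
- rewrite -EFinB; congr (_%:E); rewrite lnM ?posrE//.
  by rewrite -addrA subrr addr0.
- apply: continuous_in_subspaceT => x; rewrite inE/= in_itv/= => /andP[cx _].
  by apply: inv_continuous; rewrite gt_eqF// (lt_le_trans c0).
- split.
  + by move=> x /pos x0; have [] := is_derive1_ln x0.
  + by apply: cvg_at_right_filter; apply: continuous_ln.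
  + by apply: cvg_at_left_filter; apply: continuous_ln.
- move=> x /pos x0; rewrite derive1E; exact: (@derive_val _ _ _ _ _ _ _ (is_derive1_ln x0)).
Qed.

Lemma dt_over_t_cellset j : dt_over_t (cellset j) = (ln 2)%:E.
Proof.
rewrite -(integral_inv_interval (dyadic_gt0 j)) /dt_over_t cellsetE.
have sub0 (b : bool) (e : itv_bound R) : [set` Interval (BSide b (dyadic j)) e] `<=` `]0%R, +oo[.
  move=> x /=; rewrite itv_boundlr => /andP[h _]; rewrite in_itv/= andbT.
  by apply: (lt_le_trans (dyadic_gt0 j)); case: b h => //= h; rewrite bnd_simp in h; rewrite // ltW.
(* Only the cell of index 0 is affected by the intersection with (0, 1): it loses its right endpoint
   1, a null set. *)
case: j sub0 => [|j] sub0.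
  have e2 : (2 * dyadic 0 = 1)%R by rewrite /dyadic expr1 divff.
  rewrite e2 (_ : _ `&` _ = `]dyadic 0, 1%R[%classic); last first.
    apply/seteqP; split => [t /=|t /=]; rewrite !in_itv/=.
      by move=> [/andP[_ ->] /andP[-> _]].
    move=> /andP[h t1]; rewrite (lt_trans (dyadic_gt0 0) h) t1 h.
    by split => //; rewrite ltW.
  rewrite integral_itv_obnd_cbnd; last by apply: measurable_inv_pos; rewrite ?measurable_itv.
  rewrite integral_itv_bndo_bndc//.
  by apply: measurable_inv_pos; rewrite ?measurable_itv.
rewrite (_ : _ `&` _ = `]dyadic j.+1, (2 * dyadic j.+1)%R]%classic); last first.
  apply/seteqP; split => [t /=|t /=]; rewrite !in_itv/=; first by move=> [].
  move=> /[dup] ? /andP[h t1]; rewrite (lt_trans (dyadic_gt0 _) h).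
  by split => //=; rewrite (le_lt_trans t1)// -dyadicS dyadic_lt1.
by rewrite integral_itv_obnd_cbnd//; apply: measurable_inv_pos; rewrite ?measurable_itv.
Qed.

Lemma trivIset_cellset (P : pred nat) :
  trivIset setT (fun j => if P j then cellset j else set0).
Proof.
apply/trivIsetP => i j _ _ ij; apply/seteqP; split => // t [].
by case: (P i) => //; case: (P j) => // -[_ /= ci] [_ /= cj]; move: ij; rewrite -ci -cj eqxx.
Qed.

Lemma bigcup_cellset (P : pred nat) :
  [set t | (0 < t < 1)%R /\ P (cell t)] =
  \bigcup_j (if P j then cellset j else set0).
Proof.
apply/seteqP; split => t /=.
  by move=> [t01 Pt]; exists (cell t) => //; rewrite Pt; split => //=; rewrite in_itv.
move=> [j _]; case: ifPn => // Pj [] /=; rewrite in_itv/= => t01 ct.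
by rewrite ct.
Qed.

Lemma dt_over_t_cells (P : pred nat) :
  dt_over_t [set t | (0 < t < 1)%R /\ P (cell t)] =
  (ln 2)%:E * \sum_(k <oo) (if P k then 1 else 0).
Proof.
rewrite bigcup_cellset /dt_over_t.
have mF k : measurable (if P k then cellset k else set0).
  by case: ifP => // _; exact: measurable_cellset.
have D0 : \bigcup_j (if P j then cellset j else set0) `<=` `]0%R, +oo[.
  by rewrite -bigcup_cellset => t /= [/andP[t0 _] _]; rewrite in_itv/= t0.
rewrite ge0_integral_bigcup//; last 3 first.
- by apply: measurable_inv_pos => //; exact: bigcupT_measurable.
- by move=> x /D0; rewrite /= in_itv/= andbT lee_fin invr_ge0 => /ltW.
- exact: trivIset_cellset.
rewrite -nneseriesZl; last by move=> i _; case: ifP.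
apply: eq_eseriesr => i _; case: ifPn => _; rewrite ?mule1 ?mule0 ?integral_set0//.
exact: dt_over_t_cellset.
Qed.

End DyadicCells.

(** * The rearrangement invariant sequence norm attached to E *)

Section SequenceSpace.
Context {R : realType}.
Local Open Scope ereal_scope.
Local Notation lambda := (@lebesgue_measure R).
Implicit Types (a b : nat -> \bar R) (E : ri_space R).

Let ln2_gt0 : (0 < ln (2 : R))%R. Proof. by rewrite ln_gt0// ltr1n. Qed.

(* A dyadic cell has dt/t-measure ln 2, so a function constant on cells is     *)
(* equimeasurable to the step function with steps of length ln 2.              *)
Definition log_step a (x : R) : \bar R := a (Num.truncn (x / ln 2)).

Definition seq_norm E a : \bar R := ri_norm E (log_step a).

Definition log_cell j : set R := `](0 : R)%R, +oo[ `&` [set x | Num.truncn (x / ln 2) = j].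

Lemma log_cellE j :
  log_cell j = `](0 : R)%R, +oo[ `&` `[(j%:R * ln 2)%R, (j.+1%:R * ln 2)%R[.
Proof.
apply/seteqP; split => x [] /= x0; have := x0; rewrite in_itv/= andbT => x0'.
  move=> <-; split => //=; rewrite in_itv/= -ler_pdivlMr// -ltr_pdivrMr//.
  by rewrite truncn_itv// divr_ge0// ltW.
rewrite in_itv/= => h; split => //=.
by apply: truncn_def; rewrite ler_pdivlMr// ltr_pdivrMr.
Qed.

Lemma measurable_log_cell j : measurable (log_cell j).
Proof. by rewrite log_cellE; apply: measurableI; exact: measurable_itv. Qed.

Lemma lebesgue_log_cell j : lambda (log_cell j) = (ln 2)%:E.
Proof.
rewrite log_cellE; case: j => [|j].
  rewrite mul0r mul1r (_ : _ `&` _ = `]0%R, (ln 2)%R[%classic).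
    by rewrite lebesgue_measure_itv/= lte_fin ln2_gt0 oppr0 adde0.
  apply/seteqP; split => x /=; rewrite !in_itv/= ?andbT.
    by move=> [-> /andP[_ ->]].
  by move=> /andP[x0 ->]; rewrite x0 ltW.
rewrite (_ : _ `&` _ = `[(j.+1%:R * ln 2)%R, (j.+2%:R * ln 2)%R[%classic).
  rewrite lebesgue_measure_itv/= lte_fin ltr_pM2r// ltr_nat ltnSn -EFinB.
  by rewrite -mulrBl -natrB// subSnn mul1r.
apply/seteqP; split => x /=; rewrite !in_itv/= ?andbT; first by case.
move=> /[dup] h /andP[h1 _]; split => //; apply: lt_le_trans h1.
by rewrite mulr_gt0.
Qed.

Lemma trivIset_log_cell (P : pred nat) :
  trivIset setT (fun j => if P j then log_cell j else set0).
Proof.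
apply/trivIsetP => i j _ _ ij; apply/seteqP; split => // t [].
by case: (P i) => //; case: (P j) => // -[_ /= ci] [_ /= cj]; move: ij; rewrite -ci -cj eqxx.
Qed.

Lemma bigcup_log_cell (P : pred nat) :
  `](0 : R)%R, +oo[ `&` [set x | P (Num.truncn (x / ln 2))] =
  \bigcup_j (if P j then log_cell j else set0).
Proof.
apply/seteqP; split => x /=.
  by move=> [x0 Px]; exists (Num.truncn (x / ln 2)) => //; rewrite Px; split.
by move=> [j _]; case: ifPn => // Pj [x0 /= xj]; split => //=; rewrite xj.
Qed.

Lemma measurable_log_cells (P : pred nat) :
  measurable (`](0 : R)%R, +oo[ `&` [set x | P (Num.truncn (x / ln (2 : R)))]).
Proof.
rewrite bigcup_log_cell; apply: bigcupT_measurable => k.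
by case: ifP => // _; exact: measurable_log_cell.
Qed.

Lemma lebesgue_log_cells (P : pred nat) :
  lambda (`](0 : R)%R, +oo[ `&` [set x | P (Num.truncn (x / ln 2))]) =
  (ln 2)%:E * \sum_(k <oo) (if P k then 1 else 0).
Proof.
rewrite bigcup_log_cell measure_semi_bigcup//; last 3 first.
- by move=> k; case: ifP => // _; exact: measurable_log_cell.
- exact: trivIset_log_cell.
- apply: bigcupT_measurable => k.
  by case: ifP => // _; exact: measurable_log_cell.
rewrite -nneseriesZl; last by move=> i _; case: ifP.
apply: eq_eseriesr => i _; case: ifPn => _; rewrite ?mule1 ?mule0 ?measure0//.
exact: lebesgue_log_cell.
Qed.

Lemma measurable_superlevel (f : R -> \bar R) :
  (forall l : R, measurable (`](0 : R)%R, +oo[ `&` [set x | l%:E < f x])) ->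
  measurable_fun `](0 : R)%R, +oo[ f.
Proof.
move=> h mD; apply: (measurability _ (ErealGenOInfty.measurableE R)) => // _ [_ [l ->] <-].
rewrite (_ : _ `&` _ = `](0 : R)%R, +oo[ `&` [set x | l%:E < f x])//.
apply/seteqP; split => x [x0] /=.
  by rewrite in_itv/= andbT => lfx; split.
by move=> lfx; split => //=; rewrite in_itv/= andbT.
Qed.

Lemma log_step_nonneg_measurable a : nneg a ->
  nonneg_measurable (log_step a).
Proof.
move=> a0; split => [|x _]; last exact: a0.
apply: measurable_superlevel => l.
exact: (measurable_log_cells (fun k => l%:E < a k)).
Qed.

Lemma distr_fun_log_step a (l : \bar R) : nneg a ->
  distr_fun lambda `](0 : R)%R, +oo[ (log_step a) l =
  (ln 2)%:E * \sum_(k <oo) (if l < a k then 1 else 0).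
Proof.
move=> a0; rewrite -lebesgue_log_cells /distr_fun; congr (lambda (_ `&` _)).
by apply/seteqP; split => x /=; rewrite /log_step gee0_abs.
Qed.

Definition cell_step a (t : R) : \bar R := a (cell t).

Lemma distr_fun_cell_step a (l : \bar R) : nneg a -> 0 <= l ->
  distr_fun dt_over_t `](0 : R)%R, +oo[ (cell_step a \_ `]0%R, 1%R[) l =
  (ln 2)%:E * \sum_(k <oo) (if l < a k then 1 else 0).
Proof.
move=> a0 l0; rewrite -(dt_over_t_cells (fun k => l < a k)) /distr_fun.
congr dt_over_t; apply/seteqP; split => x /=; rewrite in_itv/= /patch.
  move=> [x0]; case: ifPn => [|_]; last by rewrite abse0 ltNge l0.
  by rewrite inE/= in_itv/= /cell_step gee0_abs.
move=> [/[dup] x01 /andP[x0 _] la]; rewrite x0; split => //.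
by rewrite mem_set/= ?in_itv//= /cell_step gee0_abs.
Qed.

Lemma rearrangement_ge0 (mu : set R -> \bar R) (D : set R) g t :
  0 <= rearrangement mu D g t.
Proof. by apply: le_ereal_inf_tmp => l [l0 _]. Qed.

Lemma rearrangement_anti (mu : set R -> \bar R) (D : set R) g s t :
  (s <= t)%R -> rearrangement mu D g t <= rearrangement mu D g s.
Proof.
move=> st; apply: le_ereal_inf => l [l0 hl]; split => //.
by apply: (le_trans hl); rewrite lee_fin.
Qed.

(** Superlevel sets of a nonincreasing function on (0, oo) are intervals, whatever mu and g are. *)
Lemma rearrangement_nonneg_measurable (mu : set R -> \bar R) (D : set R) g :
  nonneg_measurable (rearrangement mu D g).
Proof.
split => [|x _]; last exact: rearrangement_ge0.
apply: measurable_superlevel => l; apply: is_interval_measurable.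
move=> x y [] /=; rewrite !in_itv/= !andbT => x0 lx [y0 ly] z /andP[xz zy].
rewrite in_itv/= andbT (lt_le_trans x0)//; split => //.
by apply: (lt_le_trans ly); exact: rearrangement_anti.
Qed.

(** Finitely many strict inequalities l < a_k leave room for a slightly larger level; this supplies
    the right continuity of the distribution function used next. *)
Lemma superlevel_gap a N (l : R) : exists2 l' : R, (l < l')%R &
  forall k, (k < N)%N -> l%:E < a k -> l'%:E < a k.
Proof.
elim: N => [|N [l' ll' hl']]; first by exists (l + 1)%R => //; rewrite ltrDl.
have [laN|laN] := ltP l%:E (a N); last first.
  exists l' => // k; rewrite ltnS leq_eqVlt => /predU1P[->|/hl']//.
  by rewrite ltNge laN.
have [m lm hm] : exists2 m : R, (l < m)%R & m%:E < a N.
  move: laN; case: (a N) => [r||//]; last by exists (l + 1)%R; rewrite ?ltrDl ?ltry.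
  by rewrite lte_fin => lr; exists ((l + r) / 2)%R; [rewrite midf_lt|rewrite lte_fin midf_lt].
exists (Num.min l' m); first by rewrite lt_min ll'.
move=> k; rewrite ltnS leq_eqVlt => /predU1P[-> _|/hl' h /h].
  by apply: le_lt_trans hm; rewrite lee_fin ge_min lexx orbT.
by apply: le_lt_trans; rewrite lee_fin ge_min lexx.
Qed.

Let count a (l : \bar R) : \bar R := \sum_(k <oo) (if l < a k then 1 else 0).

Let count_anti a (l l' : \bar R) : l <= l' -> count a l' <= count a l.
Proof.
move=> ll'; apply: lee_nneseries => [k _ _|k _]; first by case: ifP.
by case: ifPn => [/(le_lt_trans ll') ->//|_]; case: ifP.
Qed.

(** The usual duality between a rearrangement and its distribution function. The delicate direction
    needs a level l' > l at which the count is still large: a finite partial count already exceeds x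
    / ln 2, and [superlevel_gap] raises l without losing any of its indices. *)
Lemma rearrangement_cell_step_gt a (l x : R) : nneg a -> (0 <= l)%R ->
  (l%:E < rearrangement dt_over_t `](0 : R)%R, +oo[ (cell_step a \_ `]0%R, 1%R[) x) =
  (x%:E < (ln 2)%:E * count a l%:E).
Proof.
move=> a0 l0; apply/idP/idP.
  apply: contraLR; rewrite -!leNgt => h; apply: ereal_inf_lbound; split.
    by rewrite lee_fin.
  by rewrite distr_fun_cell_step ?lee_fin.
move=> h.
have [l' ll' hl'] : exists2 l' : R, (l < l')%R & x%:E < (ln 2)%:E * count a l'%:E.
  have {}h : (x / ln 2)%:E < count a l%:E by rewrite EFinM muleC lte_pdivrMl.
  have nd : nondecreasing_seq (fun n => \sum_(0 <= k < n) (if l%:E < a k then 1 else 0) : \bar R).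
    by apply: ereal_nondecreasing_series => k _; case: ifP.
  move: h; rewrite /count (cvg_lim _ (ereal_nondecreasing_cvgn nd))//.
  move=> /ereal_sup_gt[_ [N _ <-] hN].
  have [l' ll' hl'] := superlevel_gap a N l; exists l' => //.
  rewrite -lte_pdivrMl// muleC -EFinM; apply: (lt_le_trans hN).
  apply: (@le_trans _ _ (\sum_(0 <= k < N) (if l'%:E < a k then 1 else 0))); last first.
    by apply: nneseries_lim_ge => k _; case: ifP.
  rewrite !big_nat; apply: lee_sum => k /andP[_ kN].
  by case: ifPn => [/(hl' k kN) -> //|_]; case: ifP.
apply: (@lt_le_trans _ _ l'%:E); first by rewrite lte_fin.
apply: le_ereal_inf_tmp => m [m0]; rewrite distr_fun_cell_step// => hm.
rewrite leNgt; apply/negP => ml'.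
have := lt_le_trans hl' (lee_wpmul2l _ (count_anti a (ltW ml'))).
by rewrite lee_fin (ltW ln2_gt0) => /(_ isT) /lt_le_trans /(_ hm); rewrite ltxx.
Qed.

Lemma lebesgue_initial (c : \bar R) : 0 <= c ->
  lambda (`](0 : R)%R, +oo[ `&` [set x : R | x%:E < c]) = c.
Proof.
case: c => [c c0|_|//].
  rewrite (_ : _ `&` _ = `]0%R, c[%classic); last first.
    apply/seteqP; split => x /=; rewrite !in_itv/= lte_fin andbT.
      by move=> [-> ->].
    by move=> /andP[].
  rewrite lebesgue_measure_itv/= lte_fin; case: ifPn => [_|].
    by rewrite oppr0 adde0.
  by rewrite -leNgt => c0'; congr (_%:E); apply/eqP; rewrite eq_le -lee_fin c0.
rewrite (_ : _ `&` _ = `](0 : R)%R, +oo[%classic); last first.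
  apply/seteqP; split => x /=; first by case.
  by move=> h; split => //; rewrite ltry.
by rewrite lebesgue_measure_itv/= ltry.
Qed.

(** The rearrangement of [cell_step a] for dt/t has the same distribution function as [log_step a],
    both kinds of cells having measure ln 2; rearrangement invariance does the rest. *)
Lemma tilde_cell_step E a : nneg a ->
  tilde E `]0%R, 1%R[%classic (cell_step a) = seq_norm E a.
Proof.
move=> a0; apply: ri_rearr.
- exact: rearrangement_nonneg_measurable.
- exact: log_step_nonneg_measurable.
move=> l l0; rewrite distr_fun_log_step// -/(count a l%:E).
rewrite -[RHS]lebesgue_initial; last first.
  rewrite mule_ge0 ?lee_fin ?(ltW ln2_gt0)//.
  by apply: nneseries_ge0 => k _ _; case: ifP.
rewrite /distr_fun; congr (lambda (_ `&` _)).
apply/seteqP; split => x /=; rewrite gee0_abs ?rearrangement_ge0//.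
  by rewrite rearrangement_cell_step_gt.
by rewrite rearrangement_cell_step_gt.
Qed.

Lemma rearrangement_mono (f g : R -> \bar R) t :
  (forall x, (0 < x)%R -> `|f x| <= `|g x|) ->
  rearrangement dt_over_t `](0 : R)%R, +oo[ f t <= rearrangement dt_over_t `](0 : R)%R, +oo[ g t.
Proof.
move=> fg; apply: le_ereal_inf => l [l0 hl]; split => //; apply: le_trans hl.
apply: dt_over_t_mono => [x [/= x0 lf]|x [//]]; split => //=.
by apply: (lt_le_trans lf); apply: fg; move: x0; rewrite in_itv/= andbT.
Qed.

(** Valid for arbitrary functions: rearrangements are monotone, hence measurable, and they are
    ordered pointwise because [dt_over_t] is monotone on all subsets of (0, oo). *)
Lemma tilde_mono E (f g : R -> \bar R) :
  (forall x, (0 < x < 1)%R -> `|f x| <= `|g x|) ->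
  tilde E `]0%R, 1%R[%classic f <= tilde E `]0%R, 1%R[%classic g.
Proof.
move=> fg; apply: ri_monotone; try exact: rearrangement_nonneg_measurable.
apply: aeW => t _; apply: rearrangement_mono => x x0; rewrite /patch.
case: ifPn => [|//]; rewrite inE/= in_itv/= => x01; exact: fg.
Qed.

Lemma tilde_le_seq_norm E (g : R -> \bar R) a : nneg a ->
  (forall t, (0 < t < 1)%R -> `|g t| <= a (cell t)) ->
  tilde E `]0%R, 1%R[%classic g <= seq_norm E a.
Proof.
move=> a0 ga; rewrite -(tilde_cell_step E a0); apply: tilde_mono => t t01.
by rewrite (gee0_abs (a0 (cell t))) ga.
Qed.

Lemma seq_norm_le_tilde E (g : R -> \bar R) a : nneg a ->
  (forall t, (0 < t < 1)%R -> a (cell t) <= `|g t|) ->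
  seq_norm E a <= tilde E `]0%R, 1%R[%classic g.
Proof.
move=> a0 ga; rewrite -(tilde_cell_step E a0); apply: tilde_mono => t t01.
by rewrite (gee0_abs (a0 (cell t))) ga.
Qed.

Lemma seq_norm_ge0 E a : nneg a -> 0 <= seq_norm E a.
Proof. by move=> a0; apply: ri_ge0; exact: log_step_nonneg_measurable. Qed.

Lemma seq_norm_mono E a b : nneg a -> (forall k, a k <= b k) ->
  seq_norm E a <= seq_norm E b.
Proof.
move=> a0 ab; have b0 k : 0 <= b k by exact: le_trans (ab k).
apply: ri_monotone; try exact: log_step_nonneg_measurable.
by apply: aeW => x _; exact: ab.
Qed.

Lemma seq_norm_scale E (c : R) a : (0 <= c)%R -> nneg a ->
  seq_norm E (fun k => c%:E * a k) = c%:E * seq_norm E a.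
Proof.
move=> c0 a0; rewrite /seq_norm -ri_scale//; exact: log_step_nonneg_measurable.
Qed.

Lemma seq_norm_add E a b : nneg a -> nneg b ->
  seq_norm E (fun k => a k + b k) <= seq_norm E a + seq_norm E b.
Proof.
by move=> a0 b0; apply: ri_triangle; exact: log_step_nonneg_measurable.
Qed.

Lemma seq_norm_lim E (a_ : nat -> nat -> \bar R) a :
  (forall n k, 0 <= a_ n k) -> nneg a ->
  (forall n k, a_ n k <= a_ n.+1 k) ->
  (forall k, a_ n k @[n --> \oo] --> a k) ->
  seq_norm E (a_ n) @[n --> \oo] --> seq_norm E a.
Proof.
move=> an0 a0 amon acvg; apply: ri_fatou.
- by move=> n; exact: log_step_nonneg_measurable.
- exact: log_step_nonneg_measurable.
- by move=> n; apply: aeW => x _; exact: amon.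
- by apply: aeW => x _; exact: acvg.
Qed.

Lemma seq_norm_sum E (f : nat -> nat -> \bar R) n : (forall j k, 0 <= f j k) ->
  seq_norm E (fun k => \sum_(0 <= j < n) f j k) <=
  \sum_(0 <= j < n) seq_norm E (f j).
Proof.
move=> f0; elim: n => [|n ih].
  rewrite big_geq// (_ : (fun=> _) = fun=> (0%:E * 1 : \bar R)).
    by rewrite seq_norm_scale// mul0e.
  by apply/funext => k; rewrite big_geq// mul0e.
rewrite big_nat_recr//= (_ : (fun k => _) =
    fun k => \sum_(0 <= j < n) f j k + f n k).
  apply: le_trans (seq_norm_add _ _ _) _ => //; last exact: leeD.
  by move=> k; apply: sume_ge0.
by apply/funext => k; rewrite big_nat_recr.
Qed.

(** Countable subadditivity follows from the finite triangle inequality by the Fatou property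
    applied to partial sums. *)
Lemma seq_norm_series E (f : nat -> nat -> \bar R) : (forall j k, 0 <= f j k) ->
  seq_norm E (fun k => \sum_(j <oo) f j k) <= \sum_(j <oo) seq_norm E (f j).
Proof.
move=> f0.
have N0 j : 0 <= seq_norm E (f j) by exact: seq_norm_ge0.
have cv : seq_norm E (fun k => \sum_(0 <= j < n) f j k) @[n --> \oo] -->
    seq_norm E (fun k => \sum_(j <oo) f j k).
  apply: seq_norm_lim.
  - by move=> n k; apply: sume_ge0.
  - by move=> k; apply: nneseries_ge0.
  - by move=> n k; rewrite big_nat_recr//= leeDl.
  - by move=> k; apply: is_cvg_nneseries.
rewrite -(cvg_lim _ cv)//; apply: lime_le; first by apply/cvg_ex; eexists; exact: cv.
apply: nearW => n; apply: (le_trans (seq_norm_sum _ n f0)).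
exact: nneseries_lim_ge.
Qed.

Lemma count_inj (P Q : pred nat) (mu : nat -> nat) :
  {in P &, injective mu} -> (forall n, P n -> Q (mu n)) ->
  \sum_(k <oo) (if P k then 1 else 0) <= \sum_(k <oo) (if Q k then 1 else 0) :> \bar R.
Proof.
move=> mui PQ.
rewrite -[leLHS]eseries_mkcond -[leRHS]eseries_mkcond.
rewrite !nneseries_esum//.
have -> : \esum_(i in [set x | P x]) (1 : \bar R) =
    \esum_(i in mu @` [set x | P x]) 1.
  apply/esym; apply: (@reindex_esum _ _ _ [set x | P x] _ mu).
  split => [x Px|x y Px Py|y [x Px <-]]; [by exists x| |by exists x].
  by apply: mui; [exact: set_mem Px|exact: set_mem Py].
rewrite esum_mkcond [leRHS]esum_mkcond; apply: le_esum => i _.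
case: ifPn => [|_]; last by case: ifP.
by rewrite inE/= => -[n Pn <-]; rewrite ifT// inE; exact: PQ.
Qed.

(** The left sequence rearranges the entries of a on the image of mu, so it is equimeasurable with a
    set to 0 off that image, and this truncation only decreases the norm. Shifts in both directions
    are special cases. *)
Lemma seq_norm_inj E a (P : pred nat) (mu : nat -> nat) : nneg a ->
  {in P &, injective mu} ->
  seq_norm E (fun n => if P n then a (mu n) else 0) <= seq_norm E a.
Proof.
move=> a0 mui; pose c k := if `[< exists2 n, P n & mu n = k >] then a k else 0.
have c0 k : 0 <= c k by rewrite /c; case: ifP.
have P0 n : 0 <= if P n then a (mu n) else 0 by case: ifP.
have -> : seq_norm E (fun n => if P n then a (mu n) else 0) = seq_norm E c.
  apply: ri_rearr; try exact: log_step_nonneg_measurable.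
  move=> l l0; have lneg : (l%:E < 0) = false by rewrite lte_fin ltNge l0.
  rewrite !distr_fun_log_step//; congr (_ * _).
  apply/eqP; rewrite eq_le; apply/andP; split.
    apply: (@count_inj (fun n => l%:E < if P n then a (mu n) else 0) (fun k => l%:E < c k) mu).
      move=> m n; rewrite !unfold_in; case: ifPn => Pm; last by rewrite lneg.
      by case: ifPn => Pn; [move=> _ _; exact: mui|rewrite lneg].
    move=> n; case: ifPn => Pn; last by rewrite lneg.
    by rewrite /c; case: asboolP => // -[]; exists n.
  (* nu inverts mu on its image; the default 0 is never reached where c exceeds l. *)
  pose nu k := if pselect (exists2 n, P n & mu n = k) is left e
               then projT1 (cid2 e) else 0%N.
  have nuP k : l%:E < c k -> P (nu k) /\ mu (nu k) = k.
    rewrite /c; case: asboolP => [e _|_]; last by rewrite lneg.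
    by rewrite /nu; case: pselect => // e'; case: cid2.
  apply: (@count_inj (fun k => l%:E < c k) _ nu) => [m n|k lk].
    rewrite !unfold_in => /nuP[_ mum] /nuP[_ mun] h.
    by rewrite -mum -mun h.
  have [-> muk] := nuP k lk; rewrite muk; apply: (lt_le_trans lk).
  by rewrite /c; case: ifP.
by apply: seq_norm_mono => // k; rewrite /c; case: ifP.
Qed.

(** With an infinite entry at n, a would dominate every multiple of the unit vector at n, whose norm
    is positive because a cell has positive measure. *)
Lemma seq_norm_fin E a n : nneg a -> seq_norm E a < +oo -> a n < +oo.
Proof.
move=> a0 fa; rewrite ltey; apply/eqP => an.
pose d k : \bar R := if k == n then 1 else 0.
have d0 k : 0 <= d k by rewrite /d; case: ifP.
have dn0 : 0 < seq_norm E d.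
  rewrite lt_neqAle seq_norm_ge0// andbT; apply/eqP => /esym.
  move=> /(ri_eq0 E (log_step_nonneg_measurable d0)).
  move=> [N [mN N0 hN]].
  have : lambda (log_cell n) <= lambda N.
    apply: le_measure; rewrite ?inE//; first exact: measurable_log_cell.
    move=> x [/= x0 xn]; apply: hN => /= h; move: x0; rewrite in_itv/= andbT => x0.
    by have /eqP := h x0; rewrite /log_step /d xn eqxx onee_eq0.
  by rewrite lebesgue_log_cell N0 lee_fin leNgt ln2_gt0.
have le_a (k : R) : (0 <= k)%R -> k%:E * seq_norm E d <= seq_norm E a.
  move=> k0; rewrite -seq_norm_scale//; apply: seq_norm_mono => [j|j].
    by rewrite mule_ge0.
  by rewrite /d; case: eqP => [->|_]; rewrite ?mule0// an leey.
have fan : seq_norm E a \is a fin_num by rewrite ge0_fin_numE// seq_norm_ge0.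
have fdn : seq_norm E d \is a fin_num.
  rewrite ge0_fin_numE ?seq_norm_ge0//; apply: le_lt_trans fa.
  by rewrite -[leLHS]mul1e le_a.
have d1 : (0 < fine (seq_norm E d))%R by rewrite fine_gt0// dn0 ltey_eq fdn.
have := le_a ((fine (seq_norm E a) + 1) / fine (seq_norm E d))%R.
rewrite divr_ge0 ?addr_ge0 ?fine_ge0 ?seq_norm_ge0// => /(_ isT).
rewrite -(fineK fdn) -EFinM /= divfK ?gt_eqF// -{2}(fineK fan) lee_fin.
by rewrite gerDl ler10.
Qed.

End SequenceSpace.

Section SequenceSpaceShifts.
Context {R : realType}.
Local Open Scope ereal_scope.
Implicit Types (a b : nat -> \bar R) (E : ri_space R).

(** mu is injective on each residue class modulo L + 1, so the sequence splits into L + 1 pieces,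
    each controlled by [seq_norm_inj]. *)
Lemma seq_norm_spread E a (mu : nat -> nat) (L : nat) : nneg a ->
  (forall m n, mu m = mu n -> m = n %[mod L.+1] -> m = n) ->
  seq_norm E (fun n => a (mu n)) <= L.+1%:R%:E * seq_norm E a.
Proof.
move=> a0 hmu.
have -> : (fun n => a (mu n)) = fun n => \sum_(0 <= r < L.+1)
    (if (n %% L.+1 == r)%N then a (mu n) else 0).
  apply/funext => n; rewrite big_mkord (bigD1 (Ordinal (ltn_pmod n (ltn0Sn L))))//=.
  rewrite eqxx big1 ?adde0// => i /eqP; case: ifPn => // /eqP h []; exact/val_inj.
apply: (le_trans (seq_norm_sum _ _ _)) => [j k|]; first by case: ifP.
apply: (@le_trans _ _ (\sum_(0 <= r < L.+1) seq_norm E a)).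
  apply: lee_sum => r _.
  apply: (@seq_norm_inj _ _ _ (fun n => n %% L.+1 == r)%N) => // m n.
  by rewrite !unfold_in => /eqP mr /eqP nr h; apply: hmu; rewrite // mr nr.
have N0 : 0 <= seq_norm E a by exact: seq_norm_ge0.
suff h n : \sum_(0 <= r < n) seq_norm E a = n%:R%:E * seq_norm E a by rewrite h.
elim: n => [|n ih]; first by rewrite big_geq// mul0e.
by rewrite big_nat_recr//= ih -natr1 EFinD ge0_muleDl ?mul1e// lee_fin.
Qed.

Lemma seq_norm_series_geometric E (N : \bar R) (f : nat -> nat -> \bar R) (y : R) :
  (0 < y < 1)%R -> (forall j, nneg (f j)) -> 0 <= N -> (forall j, seq_norm E (f j) <= N) ->
  seq_norm E (fun n => \sum_(j <oo) (y ^+ j)%:E * f j n) <= ((1 - y)^-1)%:E * N.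
Proof.
move=> /andP[y0 y1] f0 N0 hf; have yj0 j : (0 <= y ^+ j)%R by rewrite exprn_ge0// ltW.
apply: (le_trans (seq_norm_series _ _)) => [j k|]; first by rewrite mule_ge0 ?lee_fin.
apply: (@le_trans _ _ (\sum_(j <oo) (y ^+ j)%:E * N)).
  apply: lee_nneseries => [j _ _|j _].
    by apply: seq_norm_ge0 => k; rewrite mule_ge0 ?lee_fin.
  by rewrite seq_norm_scale//; apply: lee_wpmul2l; first by rewrite lee_fin.
have [->|Noo] := eqVneq N +oo.
  by rewrite [leRHS]gt0_muley ?leey// lte_fin invr_gt0 subr_gt0.
have Nf : N \is a fin_num by rewrite ge0_fin_numE ?ltey.
rewrite -(fineK Nf) muleC.
under eq_eseriesr do rewrite muleC.
rewrite nneseriesZl; last by move=> i _; rewrite lee_fin.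
by rewrite nneseries_geometric// ltW.
Qed.

(** Each shift of a is an injective copy, of norm at most that of a, and the weights y^j sum to 1 /
    (1 - y). *)
Lemma seq_norm_series_forward E a (y : R) : (0 < y < 1)%R -> nneg a ->
  seq_norm E (fun n => \sum_(j <oo) (y ^+ j)%:E * a (n + j)%N) <=
  ((1 - y)^-1)%:E * seq_norm E a.
Proof.
move=> y01 a0; apply: (seq_norm_series_geometric (f := fun j n => a (n + j)%N)) => // [|j].
  exact: seq_norm_ge0.
apply: (@le_trans _ _ (seq_norm E (fun n => if xpredT n then a (n + j)%N else 0))) => //.
by apply: (@seq_norm_inj _ _ _ xpredT (addn^~ j)) => // m n _ _ /addIn.
Qed.

Lemma seq_norm_series_backward E a (y : R) : (0 < y < 1)%R -> nneg a ->
  seq_norm E (fun n => \sum_(j <oo) (y ^+ j)%:E *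
    (if (j <= n)%N then a (n - j)%N else 0)) <=
  ((1 - y)^-1)%:E * seq_norm E a.
Proof.
move=> y01 a0; apply: (seq_norm_series_geometric
    (f := fun j n => if (j <= n)%N then a (n - j)%N else 0)) => // [j n||j].
- by case: ifP.
- exact: seq_norm_ge0.
apply: (@seq_norm_inj _ _ _ (leq j) (subn^~ j)) => // m n.
by rewrite !unfold_in /= => jm jn h; rewrite -(subnK jm) h subnK.
Qed.

End SequenceSpaceShifts.

(** * Comparison of L_q norms for dt/t with sequence norms *)

Section TildeLq.
Context {R : realType}.
Local Open Scope ereal_scope.
Local Notation lambda := (@lebesgue_measure R).
Implicit Types (a c : nat -> \bar R) (q : \bar R) (g : R -> \bar R) (I : set R).

(** This bound and the next come from ln (1 + x) <= x at x = -1/2 and at x = 1; they keep the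
    constants below independent of q. *)
Let ln2_ge12 : (2^-1 <= ln (2 : R))%R.
Proof.
have := @le_ln1Dx R (- 2^-1)%R; rewrite (_ : 1 + - 2^-1 = 2^-1)%R; last by field.
by rewrite lnV ?posrE// lerN2; apply; rewrite ltrN2 invf_lt1// ltr1n.
Qed.

Let ln2_le1 : (ln (2 : R) <= 1)%R.
Proof. by have := @le_ln1Dx R 1%R; rewrite -(natrD _ 1 1); apply; rewrite (@lt_trans _ _ 0%R). Qed.

Lemma measurable_cell_step c (D : set R) : measurable D -> D `<=` `](0 : R)%R, 1%R[ ->
  measurable_fun D (cell_step c).
Proof.
move=> mD D01 mD'; apply: (measurability _ (ErealGenOInfty.measurableE R)) => // _ [_ [l ->] <-].
rewrite (_ : _ `&` _ = D `&` \bigcup_j (if l%:E < c j then cellset j else set0)).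
  apply: measurableI => //; apply: bigcupT_measurable => k.
  by case: ifP => // _; exact: measurable_cellset.
rewrite -(bigcup_cellset (fun j => l%:E < c j)); apply/seteqP; split => x [Dx] /=.
  by rewrite in_itv/= andbT => h; split => //; split => //; have := D01 _ Dx; rewrite /= in_itv.
by move=> [_ h]; split => //; rewrite /= in_itv/= andbT.
Qed.

Lemma integral_cell_step (P : pred nat) c : nneg c ->
  \int[lambda]_(t in [set t | (0 < t < 1)%R /\ P (cell t)]) (c (cell t) * (t^-1)%:E) =
  (ln 2)%:E * \sum_(k <oo) (if P k then c k else 0).
Proof.
move=> c0.
have D01 : \bigcup_j (if P j then cellset j else set0) `<=` `](0 : R)%R, 1%R[.
  by rewrite -bigcup_cellset => t /= [t01 _]; rewrite in_itv.
have D0y : \bigcup_j (if P j then cellset j else set0) `<=` `](0 : R)%R, +oo[.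
  by move=> t /D01; rewrite /= !in_itv/= andbT => /andP[].
have mF k : measurable (if P k then @cellset R k else set0).
  by case: ifP => // _; exact: measurable_cellset.
have mD : measurable (\bigcup_j (if P j then @cellset R j else set0)).
  exact: bigcupT_measurable.
rewrite bigcup_cellset ge0_integral_bigcup//; last 3 first.
- apply: emeasurable_funM; first exact: measurable_cell_step.
  exact: measurable_inv_pos.
- move=> x /D0y; rewrite /= in_itv/= andbT => x0.
  by rewrite mule_ge0// lee_fin invr_ge0 ltW.
- exact: trivIset_cellset.
rewrite -nneseriesZl; last by move=> i _; case: ifP.
apply: eq_eseriesr => i _; case: ifPn => _; rewrite ?mule0 ?integral_set0//.
rewrite muleC -(dt_over_t_cellset i) /dt_over_t -ge0_integralZl//.
- by apply: eq_integral => t; rewrite inE => -[_ /= ->].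
- exact: measurable_cellset.
- apply: measurable_inv_pos; first exact: measurable_cellset.
  by move=> t [/=]; rewrite !in_itv/= andbT => /andP[].
- move=> t [/=]; rewrite in_itv/= => /andP[t0 _] _.
  by rewrite lee_fin invr_ge0 ltW.
Qed.

Lemma tildeL_le_lq q I g a : 1 <= q -> nneg a ->
  (forall t, I t -> (0 < t < 1)%R /\ `|g t| <= a (cell t)) ->
  tildeL q I g <= lq q a.
Proof.
move=> + a0 hg; move: q; apply: lq_index_ind => [r r1|] /=; last first.
  rewrite /ess_sup_on; apply/ess_supP; apply: aeW => x; rewrite /patch.
  have a_sup k : a k <= ereal_sup (range a) by apply: ereal_sup_ubound; exists k.
  case: ifPn => [|_]; last exact: le_trans (a_sup 0%N).
  by rewrite inE => /hg[_ /= h]; exact: le_trans h (a_sup _).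
have r0 : (0 < r)%R by exact: lt_le_trans r1.
have ri0 : (0 <= r^-1)%R by rewrite invr_ge0 ltW.
apply: lee_poweR => //.
  apply: integral_ge0 => t /hg[/andP[t0 _] _].
  by rewrite mule_ge0 ?poweR_ge0// lee_fin invr_ge0 ltW.
have S0 : 0 <= \sum_(k <oo) a k `^ r by apply: nneseries_ge0 => *; exact: poweR_ge0.
apply: (@le_trans _ _ ((ln 2)%:E * \sum_(k <oo) a k `^ r)); last first.
  by rewrite -[leRHS]mul1e; apply: lee_wpmul2r.
have := @integral_cell_step xpredT (fun k => a k `^ r) (fun k => poweR_ge0 _ _).
move=> /= <-; apply: ge0_integral_monotone => t.
- move=> /hg[/andP[t0 _] _].
  by rewrite mule_ge0 ?poweR_ge0// lee_fin invr_ge0 ltW.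
- move=> [/andP[t0 _] _].
  by rewrite mule_ge0 ?poweR_ge0// lee_fin invr_ge0 ltW.
- move=> /hg[t01 h]; split => //; have /andP[t0 _] := t01.
  by apply: lee_wpmul2r; [rewrite lee_fin invr_ge0 ltW|exact: lee_poweR (ltW r0) _ h].
Qed.

Lemma lebesgue_cellset_gt0 j : 0 < lambda (cellset j).
Proof.
apply: (@lt_le_trans _ _ (lambda (`]dyadic j, (2 * dyadic j)%R[ : set R))).
  rewrite lebesgue_measure_itv/= lte_fin ltr_pMl ?dyadic_gt0// ltr1n.
  by rewrite -EFinB lte_fin mulr2n mulrDl mul1r addrK dyadic_gt0.
apply: le_measure; rewrite ?inE.
- exact: measurable_itv.
- exact: measurable_cellset.
rewrite cellsetE => t /=; rewrite in_itv/= => /andP[t0 t1]; split; rewrite /= in_itv/=.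
  rewrite (lt_trans (dyadic_gt0 j) t0)/= (lt_le_trans t1)//.
  case: j {t0 t1} => [|j]; first by rewrite /dyadic expr1 divff.
  by rewrite -dyadicS ltW// dyadic_lt1.
by rewrite t0 ltW.
Qed.

(** A lower bound needs whole cells: wherever a is nonzero, the cell must lie in I and g must
    dominate on it. The factor 2 absorbs (1 / ln 2)^(1/q). *)
Lemma lq_le_tildeL q I g a : 1 <= q -> nneg a ->
  (forall t, I t -> (0 < t < 1)%R) ->
  (forall t, (0 < t < 1)%R -> a (cell t) != 0 -> I t /\ a (cell t) <= `|g t|) ->
  lq q a <= 2%:E * tildeL q I g.
Proof.
move=> + a0 I01 hg; move: q; apply: lq_index_ind => [r r1|] /=; last first.
  set S := ess_sup_on _ _.
  have S0 : 0 <= S.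
    apply: ess_sup_gee.
      apply: (lt_le_trans (lebesgue_cellset_gt0 0)).
      by apply: le_measure; rewrite ?inE//; exact: measurable_cellset.
    by apply: aeW => x; rewrite /patch; case: ifP => // _; exact: abse_ge0.
  apply: (@le_trans _ _ S); last by rewrite lee_pemull// lee_fin ler1n.
  apply: ge_ereal_sup => _ [k _ <-].
  have [->//|ak0] := eqVneq (a k) 0.
  rewrite leNgt; apply/negP => Sak.
  (* A value above the essential supremum would force the whole cell k, of positive measure, into a
     null set. *)
  have [N [mN N0 hN]] := ess_sup_ge lambda ((abse \o g) \_ I).
  have : lambda (cellset k) <= lambda N.
    apply: le_measure; rewrite ?inE//; first exact: measurable_cellset.
    move=> t [/=]; rewrite in_itv/= => t01 ct; apply: hN => /=.
    have := hg t t01; rewrite ct => /(_ ak0)[It h].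
    rewrite /patch mem_set//= => h'; move: (le_trans h h').
    by rewrite leNgt Sak.
  by rewrite N0 leNgt lebesgue_cellset_gt0.
have r0 : (0 < r)%R by exact: lt_le_trans r1.
have ri0 : (0 <= r^-1)%R by rewrite invr_ge0 ltW.
have S0 : 0 <= \sum_(k <oo) a k `^ r by apply: nneseries_ge0 => *; exact: poweR_ge0.
set J := \int[_]_(_ in _) _.
have J0 : 0 <= J.
  apply: integral_ge0 => t /I01/andP[t0 _].
  by rewrite mule_ge0 ?poweR_ge0// lee_fin invr_ge0 ltW.
have SJ : (ln 2)%:E * (\sum_(k <oo) a k `^ r) <= J.
  have := @integral_cell_step (fun k => a k != 0) (fun k => a k `^ r) (fun k => poweR_ge0 _ _).
  under eq_eseriesr => k _.
    rewrite (_ : (if _ then _ else _) = a k `^ r); last first.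
      by case: eqP => //= ->; rewrite poweR0r// gt_eqF.
    over.
  move=> <-; apply: ge0_integral_monotone => t.
  - move=> [/andP[t0 _] _].
    by rewrite mule_ge0 ?poweR_ge0// lee_fin invr_ge0 ltW.
  - move=> /I01/andP[t0 _].
    by rewrite mule_ge0 ?poweR_ge0// lee_fin invr_ge0 ltW.
  - move=> [t01 at0]; have [It h] := hg t t01 at0; have /andP[t0 _] := t01.
    split => //; apply: lee_wpmul2r; first by rewrite lee_fin invr_ge0 ltW.
    exact: lee_poweR (ltW r0) _ h.
apply: (@le_trans _ _ ((2%:E * J) `^ r^-1)).
  apply: lee_poweR => //; apply: (@le_trans _ _ (2%:E * ((ln 2)%:E * \sum_(k <oo) a k `^ r))).
    rewrite muleA -EFinM -[leLHS]mul1e; apply: lee_wpmul2r => //.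
    by rewrite lee_fin -ler_pdivrMl// mulr1.
  exact: lee_wpmul2l.
rewrite poweRM//; apply: lee_wpmul2r; first exact: poweR_ge0.
rewrite poweR_EFin lee_fin -[leRHS]powRr1//; apply: ler_powR; first by rewrite ler1n.
by rewrite invf_le1.
Qed.

End TildeLq.

(** * Rearrangements on (0, 1) and the splitting of f at a height *)

Section StarRearrangement.
Context {R : realType}.
Local Open Scope ereal_scope.
Local Notation lambda := (@lebesgue_measure R).
Local Notation I01 := (`](0 : R)%R, 1%R[%classic).
Implicit Types (f : R -> R) (s t : R) (l : \bar R).

Lemma star_ge0 f t : 0 <= star f t.
Proof. exact: rearrangement_ge0. Qed.

Lemma star_anti f s t : (s <= t)%R -> star f t <= star f s.
Proof. exact: rearrangement_anti. Qed.

Lemma measurable_superlevel_norm f l : measurable_fun I01 f ->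
  measurable (I01 `&` [set x | l < `|(f x)%:E|]).
Proof.
move=> mf; apply: emeasurable_fun_o_infty; first exact: measurable_itv.
by apply: measurableT_comp => //; exact/measurable_EFinP.
Qed.

Lemma star_mono f (g : R -> R) t : measurable_fun I01 f -> measurable_fun I01 g ->
  (forall x, (0 < x < 1)%R -> (`|f x| <= `|g x|)%R) -> star f t <= star g t.
Proof.
move=> mf mg fg; apply: le_ereal_inf => l [l0 hl]; split => //; apply: le_trans hl.
apply: le_measure; rewrite ?inE; try exact: measurable_superlevel_norm.
move=> x [x01 /= lf]; split => //=; apply: (lt_le_trans lf).
by rewrite lee_fin fg//; move: x01; rewrite /= in_itv.
Qed.

(** If |f0| <= l0 and |f1| <= l1 outside sets of measure at most s and t, then |f| <= l0 + l1
    outside their union and a null set; levels close to the two infima give the claim. *)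
Lemma star_add_ae f (f0 f1 : R -> R) s t : measurable_fun I01 f -> measurable_fun I01 f0 ->
  measurable_fun I01 f1 ->
  {ae lambda, forall x : R, (0 < x < 1)%R -> f x = (f0 x + f1 x)%R} ->
  star f (s + t)%R <= star f0 s + star f1 t.
Proof.
move=> mf mf0 mf1 [N [mN N0 hN]].
have key l0 l1 : 0 <= l0 -> 0 <= l1 ->
    distr_fun lambda I01 (EFin \o f0) l0 <= s%:E ->
    distr_fun lambda I01 (EFin \o f1) l1 <= t%:E ->
    star f (s + t)%R <= l0 + l1.
  move=> l00 l10 h0 h1; apply: ereal_inf_lbound; split; first exact: adde_ge0.
  pose A0 := I01 `&` [set x | l0 < `|(f0 x)%:E|].
  pose A1 := I01 `&` [set x | l1 < `|(f1 x)%:E|].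
  have mA0 : measurable A0 by exact: measurable_superlevel_norm.
  have mA1 : measurable A1 by exact: measurable_superlevel_norm.
  apply: (@le_trans _ _ (lambda ((A0 `|` A1) `|` N))).
    apply: le_measure; rewrite ?inE.
    - exact: measurable_superlevel_norm.
    - by apply: measurableU => //; exact: measurableU.
    move=> x [x01 /= lf].
    have [Nx|Nx] := pselect (N x); first by right.
    left; apply: contrapT => /not_orP[nA0 nA1].
    have le0 : `|(f0 x)%:E| <= l0 by rewrite leNgt; apply/negP => h; apply: nA0.
    have le1 : `|(f1 x)%:E| <= l1 by rewrite leNgt; apply/negP => h; apply: nA1.
    have fx : f x = (f0 x + f1 x)%R.
      apply: contrapT => nfx; apply: Nx; apply: hN => /= h; apply: nfx; apply: h.
      by move: x01; rewrite /= in_itv.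
    move: lf; rewrite ltNge => /negP; apply.
    apply: le_trans (leeD le0 le1); rewrite /= -EFinD lee_fin fx.
    exact: ler_normD.
  have U2 : lambda ((A0 `|` A1) `|` N) <= lambda (A0 `|` A1) + lambda N.
    by apply: measureU2 => //; exact: measurableU.
  have U1 : lambda (A0 `|` A1) <= lambda A0 + lambda A1 by exact: measureU2.
  apply: (le_trans U2); rewrite N0 adde0; apply: (le_trans U1).
  by rewrite EFinD; exact: leeD.
have [i0|i0] := eqVneq (star f0 s) +oo.
  by rewrite i0 addye ?leey// gt_eqF// (lt_le_trans ltNy0) ?star_ge0.
have [i1|i1] := eqVneq (star f1 t) +oo.
  by rewrite i1 addey ?leey// gt_eqF// (lt_le_trans ltNy0) ?star_ge0.
have fin0 : star f0 s \is a fin_num by rewrite ge0_fin_numE ?star_ge0// ltey.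
have fin1 : star f1 t \is a fin_num by rewrite ge0_fin_numE ?star_ge0// ltey.
apply/lee_addgt0Pr => e e0.
have e20 : (0 < e / 2)%R by rewrite divr_gt0.
have [l0 [l00 h0] hl0] := lb_ereal_inf_adherent e20 fin0.
have [l1 [l10 h1] hl1] := lb_ereal_inf_adherent e20 fin1.
apply: (le_trans (key _ _ l00 l10 h0 h1)).
rewrite [e in X in _ <= X](splitr e) EFinD addeACA.
by apply: leeD; exact: ltW.
Qed.

(** The infimum defining the rearrangement is attained: the level set at c = [star f t] is the
    increasing union of those at c + 1 / (n + 1), each of measure at most t. *)
Lemma distr_fun_star_le f t : measurable_fun I01 f -> (0 <= t)%R ->
  distr_fun lambda I01 (EFin \o f) (star f t) <= t%:E.
Proof.
move=> mf t0; case E : (star f t) (star_ge0 f t) => [c||]// c0; last first.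
  rewrite /distr_fun (_ : _ `&` _ = set0) ?measure0 ?lee_fin//.
  by apply/seteqP; split => // x [_ /=]; rewrite ltNge leey.
pose A n := I01 `&` [set x | (c + n.+1%:R^-1)%:E < `|(f x)%:E|].
have mA n : measurable (A n) by exact: measurable_superlevel_norm.
have UA : I01 `&` [set x | c%:E < `|(EFin \o f) x|] = \bigcup_n A n.
  apply/seteqP; split => [x [x01 /=]|x [n _ [x01 /=]]]; last first.
    move=> h; split => //=; apply: le_lt_trans h.
    by rewrite lee_fin lerDl invr_ge0.
  rewrite lte_fin -subr_gt0 => h.
  have [n hn] : exists n : nat, (n.+1%:R^-1 < `|f x| - c)%R.
    exists (Num.truncn (`|f x| - c)^-1)%R.
    rewrite invf_plt ?posrE//.
    have : (0 <= (`|f x| - c)^-1)%R by rewrite invr_ge0 ltW.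
    by move=> /truncn_itv/andP[].
  by exists n => //; split => //=; rewrite lte_fin -ltrBrDl.
rewrite /distr_fun UA.
have cv : lambda (A n) @[n --> \oo] --> lambda (\bigcup_n A n).
  apply: nondecreasing_cvg_mu => //; first exact: bigcupT_measurable.
  move=> m n mn; apply/subsetPset => x [x01 /= h]; split => //=.
  apply: le_lt_trans h; rewrite lee_fin lerD2l lef_pV2 ?posrE//.
  by rewrite ler_nat ltnS.
rewrite -(cvg_lim _ cv)//; apply: lime_le; first by apply/cvg_ex; eexists; exact: cv.
apply: nearW => n.
have cf : star f t \is a fin_num by rewrite E.
have n0 : (0 < n.+1%:R^-1 :> R)%R by rewrite invr_gt0.
have [l [l0 hl] hlc] := lb_ereal_inf_adherent n0 cf.
apply: le_trans hl; apply: le_measure; rewrite ?inE; try exact: measurable_superlevel_norm.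
move=> x [x01 /= h]; split => //=; apply: lt_trans h.
by rewrite EFinD -E.
Qed.

Definition level_set (c : \bar R) f : set R := I01 `&` [set x | c < `|(f x)%:E|].
(** f is restricted to a level set and to its complement, so both parts are dominated by |f|. At the
    height [star f u] the first is supported on a set of measure at most u, and the second is
    bounded by that height. *)
Definition large_part (c : \bar R) f (x : R) : R := (f x * \1_(level_set c f) x)%R.
Definition small_part (c : \bar R) f (x : R) : R := (f x * \1_(~` level_set c f) x)%R.

Lemma large_small_part c f x : f x = (large_part c f x + small_part c f x)%R.
Proof.
rewrite /large_part /small_part -mulrDr !indicE in_setC.
by case: (_ \in _); rewrite /= ?addr0 ?add0r mulr1.
Qed.

Lemma measurable_large_part c f : measurable_fun I01 f ->
  measurable_fun I01 (large_part c f).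
Proof.
move=> mf; apply: measurable_funM => //; apply: measurable_indic.
exact: measurable_superlevel_norm.
Qed.

Lemma measurable_small_part c f : measurable_fun I01 f ->
  measurable_fun I01 (small_part c f).
Proof.
move=> mf; apply: measurable_funM => //; apply: measurable_indic.
by apply: measurableC; exact: measurable_superlevel_norm.
Qed.

Let norm_indic_le (a : R) (A : set R) x : (`|a * \1_A x| <= `|a|)%R.
Proof.
by rewrite indicE; case: (_ \in _); rewrite /= ?mulr1 ?mulr0 ?normr0.
Qed.

Lemma star_large_part_le c f t : measurable_fun I01 f ->
  star (large_part c f) t <= star f t.
Proof.
move=> mf; apply: star_mono => // [|x _]; last exact: norm_indic_le.
exact: measurable_large_part.
Qed.

Lemma star_small_part_le c f t : measurable_fun I01 f ->
  star (small_part c f) t <= star f t.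
Proof.
move=> mf; apply: star_mono => // [|x _]; last exact: norm_indic_le.
exact: measurable_small_part.
Qed.

Lemma star_large_part0 f u t : measurable_fun I01 f -> (0 <= u <= t)%R ->
  star (large_part (star f u) f) t = 0.
Proof.
move=> mf /andP[u0 ut]; apply/eqP; rewrite eq_le star_ge0 andbT.
apply: ereal_inf_lbound; split => //.
apply: (@le_trans _ _ u%:E); last by rewrite lee_fin.
apply: le_trans (distr_fun_star_le mf u0).
apply: le_measure; rewrite ?inE.
- by apply: measurable_superlevel_norm; exact: measurable_large_part.
- exact: measurable_superlevel_norm.
move=> x [x01 /=]; rewrite /large_part indicE; case: (boolP (_ \in _)).
  by rewrite inE => -[_].
by rewrite mulr0 normr0 ltxx.
Qed.

Lemma star_small_part_bounded c f t : (0 <= t)%R -> 0 <= c ->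
  star (small_part c f) t <= c.
Proof.
move=> t0 c0; apply: ereal_inf_lbound; split => //.
rewrite /distr_fun (_ : _ `&` _ = set0) ?measure0 ?lee_fin//.
apply/seteqP; split => // x [x01 /=]; rewrite /small_part indicE in_setC.
case: (boolP (_ \in _)) => /=; first by rewrite mulr0 normr0 ltNge c0.
rewrite mulr1 notin_setE/= => h h'; apply: h; split => //.
Qed.

End StarRearrangement.

(** * Slowly varying functions and their samples on geometric sequences *)

Section Tempered.
Context {R : realType}.
Implicit Types (D : set R) (h w : R -> R) (om : nat -> R) (s t : R).

(* h changes subpolynomially between points at multiplicative distance K *)
Definition tempered D h : Prop :=
  (forall s, D s -> 0 < h s) /\
  forall e, 0 < e -> exists2 C, 0 < C & forall s t K, D s -> D t -> 1 <= K ->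
    s <= K * t -> t <= K * s -> h s <= C * K `^ e * h t.

Definition D01 : set R := [set t | 0 < t < 1].
Definition Dhalf : set R := [set t | 0 < t < 2^-1].
Definition Dpos : set R := [set t | 0 < t].

Let ratio_le (e s t K C x y : R) : 0 < e -> 0 < s -> 0 < t -> t <= K * s ->
  0 < C -> 0 < x -> 0 < y ->
  s `^ e * x <= C * (t `^ e * y) -> x <= C * K `^ e * y.
Proof.
move=> e0 s0 t0 tK C0 x0 y0 h; have se0 : 0 < s `^ e by exact: powR_gt0.
rewrite -(ler_pM2l se0); apply: (le_trans h).
have K0 : 0 < K by rewrite -(pmulr_lgt0 _ s0) (lt_le_trans t0).
rewrite [leRHS](_ : _ = C * ((K `^ e * s `^ e) * y)); last by ring.
rewrite ler_pM2l// ler_pM2r// -powRM ?(ltW K0) ?(ltW s0)//.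
by apply: ge0_ler_powR; rewrite ?nnegrE ?(ltW e0) ?(ltW t0)// mulr_ge0// ltW.
Qed.

(** For s <= t the equivalence of t^e b(t) with a nondecreasing function bounds b(s); for s > t that
    of t^-e b(t) with a nonincreasing one does. In both cases the quotient of powers is at most
    K^e. *)
Lemma SV_tempered b : SV b -> tempered D01 b.
Proof.
move=> [_ b0 hb]; split => // e e0.
have [[g gmon [Cg Cg0 hg]] [k kmon [Ck Ck0 hk]]] := hb e e0.
exists (Cg * Cg + Ck * Ck) => [|s t K]; first by rewrite addr_gt0// mulr_gt0.
move=> s01 t01 K1 sKt tKs.
have [s0 s1] := andP s01; have [t0 t1] := andP t01.
have bs0 := b0 s s01; have bt0 := b0 t t01.
have sI : s \in `]0, 1[ by rewrite in_itv.
have tI : t \in `]0, 1[ by rewrite in_itv.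
have CC (C : R) : 0 < C -> 0 < C * C by move=> C0; exact: mulr_gt0.
have final (C C' : R) : 0 <= C' -> b s <= C * K `^ e * b t ->
    b s <= (C + C') * K `^ e * b t.
  move=> C'0 h; apply: (le_trans h); rewrite ler_pM2r// ler_pM2r ?lerDl//.
  by rewrite powR_gt0// (lt_le_trans ltr01).
have [st|ts] := leP s t.
  apply: final; first by rewrite ltW// CC.
  apply: (@ratio_le e s t K _ _ _ e0 s0 t0 tKs (CC _ Cg0)) => //.
  have /andP[_ h1] := hg s s01; have /andP[h2 _] := hg t t01.
  apply: (le_trans h1); rewrite -mulrA ler_pM2l//.
  apply: (le_trans (gmon _ _ sI tI st)).
  by rewrite ler_pdivrMl in h2.
rewrite addrC; apply: final; first by rewrite ltW// CC.
have /andP[_ h1] := hk s s01; have /andP[h2 _] := hk t t01.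
apply: (@ratio_le e t s K _ _ _ e0 t0 s0 sKt (CC _ Ck0)) => //.
have te0 : 0 < t `^ e by exact: powR_gt0.
have se0 : 0 < s `^ e by exact: powR_gt0.
have h3 : s `^ (- e) * b s <= Ck * Ck * (t `^ (- e) * b t).
  apply: (le_trans h1); rewrite -mulrA ler_pM2l//.
  apply: (le_trans (kmon _ _ tI sI (ltW ts))).
  by rewrite ler_pdivrMl in h2.
rewrite !powRN in h3.
rewrite -(ler_pM2l se0) -(ler_pM2l te0) in h3.
rewrite [leLHS](_ : _ = t `^ e * (s `^ e * ((s `^ e)^-1 * b s))); last first.
  by field; rewrite gt_eqF.
rewrite [leRHS](_ : _ = t `^ e * (s `^ e * (Ck * Ck * ((t `^ e)^-1 * b t))))//.
by field; rewrite gt_eqF.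
Qed.

(** The new case is a pair of points on opposite sides of 1. The one below 1 is compared with 1/2,
    where b has a fixed positive value, at the price of doubling K. *)
Lemma ext1_tempered b : SV b -> tempered Dpos (ext1 b).
Proof.
move=> hb; have [b0 htb] := SV_tempered hb.
have h12 : D01 2^-1 by rewrite /D01/= invr_gt0 ltr0n/= invf_lt1 ?ltr1n.
have bh0 := b0 _ h12.
have lt1D s : 0 < s -> s < 1 -> D01 s by move=> s0 s1; rewrite /D01/= s0.
split => [s s0|e e0]; first by rewrite /ext1; case: ifP => // s1; exact/b0/lt1D.
have [C C0 hC] := htb e e0.
set A := 2 `^ e.
have A0 : 0 < A by exact: powR_gt0.
exists (1 + C + C * A * b 2^-1 + C * A / b 2^-1) => [|s t K s0 t0 K1 sKt tKs].
  by rewrite !addr_gt0 ?divr_gt0 ?mulr_gt0.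
have K0 : 0 < K by exact: lt_le_trans K1.
have Ke1 : 1 <= K `^ e by rewrite -(powRr0 K); apply: ler_powR => //; exact: ltW.
have Ke0 : 0 < K `^ e by exact: lt_le_trans Ke1.
have [x1 x2 x3] : [/\ 0 <= C, 0 <= C * A * b 2^-1 & 0 <= C * A / b 2^-1].
  by split; rewrite ltW// ?divr_gt0 ?mulr_gt0.
(* a point r < 1 within distance K of [1, +oo) is within distance 2K of 1/2 *)
have near (r : R) : 0 < r -> r < 1 -> 1 <= K * r ->
    b r <= C * A * K `^ e * b 2^-1 /\ b 2^-1 <= C * A * K `^ e * b r.
  move=> r0 r1 Kr.
  have AK : C * A * K `^ e = C * (2 * K) `^ e by rewrite powRM ?(ltW K0)// mulrA.
  have K2 : 2 * K * 2^-1 = K by field.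
  have K21 : 1 <= 2 * K by lra.
  have Kr2 : 2^-1 <= 2 * K * r by rewrite -mulrA; lra.
  have rK : r <= K by lra.
  rewrite AK; split.
    by apply: hC => //; rewrite ?K2//; exact: lt1D.
  by apply: hC => //; rewrite ?K2//; exact: lt1D.
have [s1|s1] := ltP s 1; have [t1|t1] := ltP t 1; rewrite /ext1.
- rewrite s1 t1; apply: (le_trans (hC s t K _ _ K1 sKt tKs)); try exact: lt1D.
  rewrite ler_pM2r ?ler_pM2r//; last exact/b0/lt1D.
  by rewrite -!addrA; lra.
- rewrite s1 ltNge t1 /= mulr1.
  have [h _] := near s s0 s1 (le_trans t1 tKs); apply: (le_trans h).
  by rewrite mulrAC ler_pM2r//; lra.
- rewrite t1 ltNge s1 /=.
  have [_ h] := near t t0 t1 (le_trans s1 sKt).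
  have bt0 : 0 < b t by exact/b0/lt1D.
  rewrite -(ler_pM2l bh0) mulr1; apply: (le_trans h).
  rewrite [leLHS](_ : _ = b 2^-1 * (C * A / b 2^-1 * K `^ e * b t)); last first.
    by field; rewrite gt_eqF.
  by rewrite ler_pM2l// ler_pM2r// ler_pM2r//; lra.
- rewrite !ltNge s1 t1 /= mulr1; apply: (le_trans Ke1).
  by rewrite ler_peMl ?(ltW Ke0)//; lra.
Qed.

(** Points at index distance k lie within a factor K = C Y^k of each other, and h changes by at most
    a constant times K^e. Any rate y > 1 is reached by choosing e with Y^e = y. *)
Lemma tempered_geomlike D h z (r : nat -> R) : tempered D h -> geomlike z r ->
  (forall n, D (r n)) -> geomlike 1 (fun n => h (r n)).
Proof.
move=> [h0 hh] [z0 r0 ur lr] Dr.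
have [C1 C10 hC1] := ur (2 * z) ltac:(by rewrite ltr_pMl// ltr1n).
have [C2 C20 hC2] := lr (z / 2) ltac:(by rewrite divr_gt0//= ltr_pdivrMr// ltr_pMr// ltr1n).
pose Y := 1 + 2 * z + 2 / z.
have z20 : 0 < 2 / z by rewrite divr_gt0.
have Y1 : 1 < Y by rewrite /Y; lra.
have Y0 : 0 < Y by exact: lt_trans Y1.
pose C := 1 + C1 + C2.
have C0 : 1 <= C by rewrite /C; lra.
have Yk k : 1 <= Y ^+ k by rewrite exprn_ege1// ltW.
have up n k : r (n + k)%N <= C * Y ^+ k * r n.
  apply: (le_trans (hC1 n k)); rewrite ler_pM2r//; apply: ler_pM.
  - exact: ltW.
  - by rewrite exprn_ge0// mulr_ge0// ltW.
  - by rewrite /C; lra.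
  - by apply: lerXn2r; rewrite ?nnegrE ?(ltW Y0) ?mulr_ge0 ?(ltW z0)//; rewrite /Y; lra.
have lo n k : r n <= C * Y ^+ k * r (n + k)%N.
  have zk0 : 0 < (z / 2) ^+ k by rewrite exprn_gt0// divr_gt0.
  have := hC2 n k; rewrite -ler_pdivlMl// => hle; apply: (le_trans hle).
  rewrite mulrA ler_pM2r// mulrC -exprVn; apply: ler_pM.
  - exact: ltW.
  - by rewrite exprn_ge0// invr_ge0 divr_ge0// ltW.
  - by rewrite /C; lra.
  - rewrite invf_div; apply: lerXn2r; rewrite ?nnegrE ?(ltW Y0) ?(ltW z20)//.
    by rewrite /Y; lra.
have CYk k : 1 <= C * Y ^+ k by rewrite mulr_ege1.
have powE y k : 1 < y -> (C * Y ^+ k) `^ (ln y / ln Y) = C `^ (ln y / ln Y) * y ^+ k.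
  move=> y1; rewrite powRM ?(le_trans ler01 C0) ?(le_trans ler01 (Yk k))//.
  have y0 : 0 < y by exact: lt_trans y1.
  have lnY : ln Y != 0 by rewrite gt_eqF// ln_gt0.
  congr (_ * _); rewrite -(powR_mulrn k (ltW Y0)) -(powR_mulrn k (ltW y0)) -powRrM.
  by rewrite /powR !gt_eqF//; congr expR; rewrite -mulrA divfK.
have e0 y : 1 < y -> 0 < ln y / ln Y by move=> y1; rewrite divr_gt0 ?ln_gt0.
have C_gt0 : 0 < C by exact: lt_le_trans C0.
split => // [n|y y1|y /andP[y0 y1]]; first exact: h0.
  have [A A0 hA] := hh _ (e0 y y1).
  exists (A * C `^ (ln y / ln Y)) => [|n k]; first by rewrite mulr_gt0// powR_gt0.
  have := hA (r (n + k)%N) (r n) _ (Dr _) (Dr _) (CYk k) (up n k) (lo n k).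
  by rewrite powE// mulrA.
have yV1 : 1 < y^-1 by rewrite invf_gt1.
have [A A0 hA] := hh _ (e0 _ yV1).
exists (A * C `^ (ln y^-1 / ln Y)) => [|n k]; first by rewrite mulr_gt0// powR_gt0.
have := hA (r n) (r (n + k)%N) _ (Dr _) (Dr _) (CYk k) (lo n k) (up n k).
have yk0 : 0 < y ^+ k by rewrite exprn_gt0.
rewrite powE// exprVn => /(ler_wpM2l (ltW yk0)) /le_trans; apply.
rewrite [leLHS](_ : _ = A * C `^ (ln y^-1 / ln Y) * h (r (n + k)%N))//.
by field; rewrite gt_eqF.
Qed.

End Tempered.

(** * Weights that are almost constant on dyadic cells *)

Section Cellwise.
Context {R : realType}.
Implicit Types (D : set R) (h w : R -> R) (om : nat -> R) (s t : R).

(** [om n] is a representative value of w on the cell n, up to a factor independent of n. The set D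
    can leave out a neighbourhood of 1, where norms over (u, 1) degenerate. *)
Definition cellwise D w om : Prop :=
  [/\ forall t, D t -> 0 < w t, forall n, 0 < om n &
      exists2 C, 0 < C & forall t, D t ->
        w t <= C * om (cell t) /\ om (cell t) <= C * w t].

Lemma D01_cell t : D01 t -> dyadic (cell t) < t <= 2 * dyadic (cell t).
Proof. by move=> /andP[t0 t1]; apply: cellP; rewrite t0 ltW. Qed.

Lemma cell_lt_lt s t : D01 s -> D01 t -> (cell t < cell s)%N -> s < t.
Proof.
move=> /D01_cell/andP[_ hs] /D01_cell/andP[ht _] h.
apply: le_lt_trans ht; apply: (le_trans hs).
by have := @dyadic_anti R _ _ h; rewrite -(ler_pM2l (ltr0Sn R 1)) -dyadicS.
Qed.

Lemma cellwise_cst D (c : R) : 0 < c -> cellwise D (fun=> c) (fun=> c).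
Proof. by move=> c0; split => //; exists 1 => // t _; rewrite mul1r. Qed.

Lemma cellwise_id : cellwise (@D01 R) id (@dyadic R).
Proof.
split => [t /andP[]//||]; first exact: dyadic_gt0.
exists 2 => // t /[dup] /andP[t0 _] /D01_cell/andP[h1 h2].
by split => //; rewrite (le_trans (ltW h1))// ler_peMl ?ler1n// ltW.
Qed.

Lemma cellwise_sub D D' w om : D' `<=` D -> cellwise D w om -> cellwise D' w om.
Proof.
by move=> DD [w0 om0 [C C0 hC]]; split => // [t /DD/w0//|]; exists C => // t /DD/hC.
Qed.

Lemma Dhalf_D01 : @Dhalf R `<=` @D01 R.
Proof.
move=> t /andP[t0 t1]; rewrite /D01/= t0 (lt_trans t1)//.
by rewrite invf_lt1// ltr1n.
Qed.

Lemma cellwise_mul D w1 w2 om1 om2 : cellwise D w1 om1 -> cellwise D w2 om2 ->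
  cellwise D (fun t => w1 t * w2 t) (fun n => om1 n * om2 n).
Proof.
move=> [w10 o10 [C1 C10 h1]] [w20 o20 [C2 C20 h2]]; split.
- by move=> t Dt; rewrite mulr_gt0 ?w10 ?w20.
- by move=> n; rewrite mulr_gt0.
exists (C1 * C2) => [|t Dt]; first exact: mulr_gt0.
have [a1 b1] := h1 t Dt; have [a2 b2] := h2 t Dt.
have := w10 t Dt; have := w20 t Dt => wt2 wt1.
split; rewrite mulrACA; apply: ler_pM => //; exact: ltW.
Qed.

Lemma cellwise_inv D w om : cellwise D w om ->
  cellwise D (fun t => (w t)^-1) (fun n => (om n)^-1).
Proof.
move=> [w0 o0 [C C0 h]]; split.
- by move=> t Dt; rewrite invr_gt0 w0.
- by move=> n; rewrite invr_gt0.
exists C => // t Dt; have [a b] := h t Dt; have wt0 := w0 t Dt; have ot0 := o0 (cell t).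
by split; rewrite ler_pdivlMr// mulrC ler_pdivrMr.
Qed.

Lemma cellwise_powR D w om (r : R) : cellwise D w om ->
  cellwise D (fun t => w t `^ r) (fun n => om n `^ r).
Proof.
have pos (e : R) : 0 <= e -> cellwise D w om ->
    cellwise D (fun t => w t `^ e) (fun n => om n `^ e).
  move=> e0 [w0 o0 [C C0 h]]; split.
  - by move=> t Dt; rewrite powR_gt0 ?w0.
  - by move=> n; rewrite powR_gt0.
  exists (C `^ e) => [|t Dt]; first exact: powR_gt0.
  have [a b] := h t Dt; have wt0 := w0 t Dt; have ot0 := o0 (cell t).
  rewrite -!powRM ?(ltW C0) ?(ltW wt0) ?(ltW ot0)//.
  by split; apply: ge0_ler_powR; rewrite ?nnegrE ?mulr_ge0 ?(ltW C0) ?(ltW wt0) ?(ltW ot0).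
move=> hw; have [r0|r0] := leP 0 r; first exact: pos.
have r0' : 0 <= - r by rewrite oppr_ge0 ltW.
have := cellwise_inv (pos _ r0' hw).
by under eq_fun do rewrite powRN invrK; under [X in cellwise _ _ X]eq_fun do rewrite powRN invrK.
Qed.

Lemma cellwise_comp D D' w om h : cellwise D w om -> tempered D' h ->
  (forall t, D t -> D' (w t)) -> (forall n, D' (om n)) ->
  cellwise D (fun t => h (w t)) (fun n => h (om n)).
Proof.
move=> [w0 o0 [C C0 hC]] [h0 hh] Dw Do; split.
- by move=> t /Dw/h0.
- by move=> n; exact: h0.
have [A A0 hA] := hh 1 ltr01.
have C1 : 1 <= 1 + C by rewrite lerDl ltW.
exists (A * (1 + C) `^ 1) => [|t Dt].
  by rewrite mulr_gt0// powR_gt0// (lt_le_trans ltr01).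
have [a b] := hC t Dt; have wt0 := w0 t Dt; have ot0 := o0 (cell t).
have a' : w t <= (1 + C) * om (cell t).
  by apply: (le_trans a); rewrite ler_pM2r// lerDr.
have b' : om (cell t) <= (1 + C) * w t.
  by apply: (le_trans b); rewrite ler_pM2r// lerDr.
by split; apply: hA => //; exact: Dw.
Qed.

Lemma cellwise_tempered h : tempered (@D01 R) h ->
  cellwise (@D01 R) h (fun n => h (dyadic n)).
Proof.
move=> hh; apply: cellwise_comp cellwise_id hh _ _ => // n.
by rewrite /D01/= dyadic_gt0 dyadic_lt1.
Qed.

(** The cut changes w only on [1/2, 1), which meets only the cells 0 and 1 (the point 1/2 lies in
    cell 1); the constant A compares the value 1 with the two representatives there. *)
Lemma cellwise_cut_half w om : cellwise (@Dhalf R) w om ->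
  cellwise (@D01 R) (cut_half w) om.
Proof.
move=> [w0 o0 [C C0 h]]; split => //.
  by move=> t /andP[t0 t1]; rewrite /cut_half; case: ifPn => // th; apply: w0; rewrite /Dhalf/= t0.
exists (C + (om 0%N + om 1%N + (om 0%N)^-1 + (om 1%N)^-1)) => [|t /[dup] Dt' /andP[t0 t1]].
  by rewrite !addr_gt0 ?invr_gt0.
set A := om 0%N + _ + _ + _.
have A0 : 0 < A by rewrite !addr_gt0 ?invr_gt0.
rewrite /cut_half; case: ifPn => [th|].
  have Dt : Dhalf t by rewrite /Dhalf/= t0.
  have [a b] := h t Dt; have wt0 := w0 t Dt; have ot0 := o0 (cell t).
  by split; [apply: (le_trans a)|apply: (le_trans b)]; rewrite ler_pM2r// lerDl ltW.
rewrite -leNgt => th.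
have c01 : (cell t <= 1)%N.
  rewrite leqNgt; apply/negP => h1.
  have /andP[_ h2] := D01_cell Dt'.
  have := @dyadic_anti R _ _ h1; rewrite -(ler_pM2l (ltr0Sn R 1)) -dyadicS => h3.
  have := le_trans th (le_trans h2 h3); rewrite /dyadic expr2 leNgt => /negP; apply.
  by rewrite gtr_pMl ?invr_gt0// invf_lt1// ltr1n.
have i0 := o0 0%N; have i1 := o0 1%N.
have j0 : 0 < (om 0%N)^-1 by rewrite invr_gt0.
have j1 : 0 < (om 1%N)^-1 by rewrite invr_gt0.
rewrite mulr1; move: c01; case: (cell t) => [|[|//]] _.
  split; last by rewrite /A; lra.
  rewrite -(ler_pM2r j0) mul1r -mulrA divff ?gt_eqF// mulr1 /A; lra.
split; last by rewrite /A; lra.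
rewrite -(ler_pM2r j1) mul1r -mulrA divff ?gt_eqF// mulr1 /A; lra.
Qed.

End Cellwise.

(** * The weights of the Gamma norms *)

Section GammaWeights.
Context {R : realType}.
Implicit Types (w : R -> R) (p q : \bar R).

Lemma dyadic_powR_geomlike (r : R) : 0 <= r ->
  geomlike (2^-1 `^ r) (fun n => dyadic n `^ r : R).
Proof.
move=> r0; apply: geomlike_powR => //.
have : geomlike (2^-1 * 1) (fun n => 2^-1 ^+ n * 2^-1 : R).
  by apply: geomlike_mul; [apply: geomlike_exp|apply: geomlike_cst]; rewrite invr_gt0.
by rewrite mulr1; under eq_fun do rewrite -exprSr.
Qed.

Lemma SV_geomlike w : SV w -> geomlike 1 (fun n => w (dyadic n)).
Proof.
move=> /SV_tempered hw; have := dyadic_powR_geomlike (@ler01 R).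
under eq_fun do rewrite powRr1 ?(ltW (dyadic_gt0 _))//.
move=> hd; apply: tempered_geomlike hw hd _ => n.
by rewrite /D01/= dyadic_gt0 dyadic_lt1.
Qed.

Lemma wroot_geomlike q w : (1 <= q)%E -> SV (fun u => u * w u) ->
  geomlike 1 (fun n => wroot q w (dyadic n)).
Proof.
move=> + hw; move: q; apply: lq_index_ind => [r r1|] /=; last exact: geomlike_cst.
have r0 : 0 <= r^-1 by rewrite invr_ge0 (le_trans ler01).
by have := geomlike_powR r0 (SV_geomlike hw); rewrite powR1.
Qed.

Lemma wroot_cellwise q w : (1 <= q)%E -> SV (fun u => u * w u) ->
  cellwise (@D01 R) (wroot q w) (fun n => wroot q w (dyadic n)).
Proof.
move=> + hw; move: q; apply: lq_index_ind => [r r1|] /=; last exact: cellwise_cst.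
by apply: cellwise_powR; apply: cellwise_tempered; exact: SV_tempered hw.
Qed.

(** Chosen so that the integral of w times the p-th power of [star f] becomes the p-th power of an
    L_p norm for dt/t with this weight. *)
Definition inner_weight (p : R) w (s : R) : R := s `^ p^-1 * w s `^ p^-1.

Lemma inner_weight_geomlike (p : R) w : 1 < p -> SV w ->
  geomlike (2^-1 `^ p^-1) (fun n => inner_weight p w (dyadic n)).
Proof.
move=> p1 hw; have p0 : 0 <= p^-1 by rewrite invr_ge0 (le_trans ler01)// ltW.
rewrite -[X in geomlike X _]mulr1; apply: geomlike_mul.
  exact: dyadic_powR_geomlike.
by have := geomlike_powR p0 (SV_geomlike hw); rewrite powR1.
Qed.

Lemma inner_weight_cellwise (p : R) w : SV w ->
  cellwise (@D01 R) (inner_weight p w) (fun n => inner_weight p w (dyadic n)).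
Proof.
move=> hw; apply: cellwise_mul; first exact: cellwise_powR cellwise_id.
by apply: cellwise_powR; apply: cellwise_tempered; exact: SV_tempered.
Qed.

(** For the upper bound all cells met by (t, 1) count; for the lower one only those strictly to the
    right of the cell of t, and the lost cell is recovered by [geomlike_step]. For t < 1/2 at least
    one whole cell remains, which keeps the norm away from 0. *)
Lemma tailnorm_cellwise q w : (1 <= q)%E -> SV (fun u => u * w u) ->
  cellwise (@Dhalf R) (tailnorm q w) (head_norm q (fun n => wroot q w (dyadic n))).
Proof.
move=> q1 hw.
pose be n := wroot q w (dyadic n); rewrite -/be.
have hbe : geomlike 1 be := wroot_geomlike q1 hw.
have [w0 o0 [C C0 hC]] : cellwise (@D01 R) (wroot q w) be := wroot_cellwise q1 hw.
have T0 n : 0 < head_norm q be n by exact: head_norm_gt0.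
have [S S0 hS] := geomlike_step (head_norm_geomlike q1 hbe).
have scaleT (c : R) n : 0 <= c ->
    lq q (fun k => if (k <= n)%N then (c * be k)%:E else 0%E) = (c * head_norm q be n)%:E.
  move=> c0; rewrite EFinM (head_normEfin q1 hbe) -lq_scale//.
    congr lq; apply/funext => k; case: ifP => _; rewrite ?mule0//.
  by move=> k; case: ifP => // _; rewrite lee_fin ltW.
have ub t : Dhalf t -> (tildeL q `]t, 1%R[%classic (EFin \o wroot q w) <=
    (C * head_norm q be (cell t))%:E)%E.
  move=> Dt; have /andP[t0 t1] := Dhalf_D01 Dt.
  rewrite -scaleT ?(ltW C0)//; apply: tildeL_le_lq => //.
    by move=> k; case: ifP => // _; rewrite lee_fin mulr_ge0// ltW.
  move=> s /=; rewrite in_itv/= => /andP[ts s1].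
  have s0 : 0 < s by exact: lt_trans ts.
  have Ds : D01 s by rewrite /D01/= s0.
  split => //; rewrite (leq_cell t0 (ltW ts) (ltW s1)) lee_fin ger0_norm.
    by have [] := hC s Ds.
  exact/ltW/w0.
have lb t : Dhalf t -> ((C^-1 * head_norm q be (cell t).-1)%:E <=
    2%:E * tildeL q `]t, 1%R[%classic (EFin \o wroot q w))%E.
  move=> Dt; have /andP[t0 t1] := Dhalf_D01 Dt; have /andP[_ th] := Dt.
  have Cv0 : 0 < C^-1 by rewrite invr_gt0.
  rewrite -scaleT ?(ltW Cv0)//; apply: lq_le_tildeL => //.
  - by move=> k; case: ifP => // _; rewrite lee_fin mulr_ge0// ltW.
  - by move=> s /=; rewrite in_itv/= => /andP[ts ->]; rewrite (lt_trans t0 ts).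
  move=> s s01; case: ifPn => [|_]; last by rewrite eqxx.
  have /andP[s0 s1] := s01 => sc _.
  have ct1 : (0 < cell t)%N.
    rewrite lt0n; apply/eqP => ct; have /andP[] := D01_cell (Dhalf_D01 Dt).
    by rewrite ct /dyadic expr1 => /lt_trans /(_ th); rewrite ltxx.
  rewrite -ltnS prednK// in sc; split.
    by rewrite /= in_itv/= s1 andbT; apply: cell_lt_lt => //; exact: Dhalf_D01.
  rewrite /= lee_fin ger0_norm; last exact/ltW/w0.
  by rewrite ler_pdivrMl//; have [] := hC s s01.
(* The norm is finite, so passing through [fine] loses nothing. *)
have fin t : Dhalf t -> (tailnorm q w t)%:E =
    tildeL q `]t, 1%R[%classic (EFin \o wroot q w).
  move=> Dt; rewrite /tailnorm fineK// ge0_fin_numE.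
    by apply: (le_lt_trans (ub t Dt)); rewrite ltry.
  have := lb t Dt; rewrite -lee_pdivrMl// => h; apply: le_trans h.
  by rewrite -EFinM lee_fin !mulr_ge0 ?invr_ge0 ?(ltW C0) ?(ltW (T0 _)).
have lb' t : Dhalf t -> C^-1 * head_norm q be (cell t).-1 <= 2 * tailnorm q w t.
  by move=> Dt; rewrite -lee_fin [X in (_ <= X)%E]EFinM fin//; exact: lb.
have ub' t : Dhalf t -> tailnorm q w t <= C * head_norm q be (cell t).
  by move=> Dt; rewrite -lee_fin fin//; exact: ub.
split => //.
  move=> t Dt; rewrite -(pmulr_rgt0 _ (ltr0Sn R 1)); apply: lt_le_trans (lb' t Dt).
  by rewrite mulr_gt0 ?invr_gt0.
exists (C + 2 * C * (1 + S)) => [|t Dt].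
  by rewrite addr_gt0// mulr_gt0 ?addr_gt0// mulr_gt0.
have tn0 : 0 < tailnorm q w t.
  rewrite -(pmulr_rgt0 _ (ltr0Sn R 1)); apply: lt_le_trans (lb' t Dt).
  by rewrite mulr_gt0 ?invr_gt0.
have CS0 : 0 < 2 * C * (1 + S) by rewrite mulr_gt0 ?addr_gt0// mulr_gt0.
split.
  apply: (le_trans (ub' t Dt)); rewrite ler_pM2r// lerDl; exact: ltW.
apply: (@le_trans _ _ (2 * C * (1 + S) * tailnorm q w t)); last first.
  by rewrite ler_pM2r// lerDr ltW.
have := lb' t Dt; rewrite ler_pdivrMl// => h.
rewrite (_ : 2 * C * (1 + S) * _ = (1 + S) * (C * (2 * tailnorm q w t))); last by ring.
apply: (@le_trans _ _ ((1 + S) * head_norm q be (cell t).-1)); last first.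
  by rewrite ler_pM2l// addr_gt0.
case: (cell t) => [|n] /=; first by rewrite ler_peMl ?(ltW (T0 _))// lerDl ltW.
have [_ h'] := hS n; apply: (le_trans h').
by rewrite ler_pM2r// lerDr.
Qed.

End GammaWeights.

Section DyadicStar.
Context {R : realType}.
Local Open Scope ereal_scope.
Implicit Types (f : R -> R) (s t : R).

Definition star_seq f (k : nat) : \bar R := star f (dyadic k).

Lemma star_seq_ge0 f k : 0 <= star_seq f k.
Proof. exact: star_ge0. Qed.

Lemma star_seq_step f k : star_seq f k <= star_seq f k.+1.
Proof. by apply: star_anti; exact: dyadic_anti. Qed.

Lemma star_le_star_seq f t : D01 t -> star f t <= star_seq f (cell t).
Proof. by move=> /D01_cell/andP[h _]; apply: star_anti; exact: ltW. Qed.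

Lemma star_seq_le_star f t : D01 t -> (0 < cell t)%N ->
  star_seq f (cell t).-1 <= star f t.
Proof.
move=> /D01_cell/andP[_ h] c0; apply: star_anti; apply: (le_trans h).
by rewrite -{1}(prednK c0) -dyadicS.
Qed.

End DyadicStar.

(** * Discretization of the iterated norms of the rearrangement *)

Section Discretization.
Context {R : realType}.
Local Open Scope ereal_scope.
Variables (p q : \bar R) (z : R) (W V : R -> R) (al be : nat -> R).
Hypotheses (p1 : 1 <= p) (q1 : 1 <= q).
Hypotheses (hal : geomlike z al) (hbe : geomlike 1%R be).
Hypotheses (hW : cellwise (@D01 R) W al) (hV : cellwise (@D01 R) V be).
Implicit Types (f : R -> R) (s t u : R).

Definition weighted_star f s : \bar R := (W s)%:E * star f s.
Definition head_fun f t : \bar R := tildeL p `]0%R, t[%classic (weighted_star f).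
Definition block_fun f u t : \bar R := tildeL p `]u, t[%classic (weighted_star f).

Let al_gt0 k : (0 < al k)%R. Proof. exact: geomlike_gt0 hal. Qed.
Let be_gt0 k : (0 < be k)%R. Proof. exact: geomlike_gt0 hbe. Qed.
Let al_ge0 k : (0 <= al k)%R. Proof. exact: ltW. Qed.
Let be_ge0 k : (0 <= be k)%R. Proof. exact: ltW. Qed.
Let W_gt0 t : D01 t -> (0 < W t)%R. Proof. by case: hW => h _ _ /h. Qed.
Let V_gt0 t : D01 t -> (0 < V t)%R. Proof. by case: hV => h _ _ /h. Qed.

Let x0 f k : 0 <= star_seq f k. Proof. exact: star_seq_ge0. Qed.
Let xS f k : star_seq f k <= star_seq f k.+1. Proof. exact: star_seq_step. Qed.

Let tail_ge0 f n : 0 <= tail_norm p al (star_seq f) n.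
Proof. exact: tail_norm_ge0 hal _ _ _. Qed.

Let block_ge0 f k n : 0 <= block_norm p al (star_seq f) k n.
Proof. exact: block_norm_ge0 hal _ _ _ _. Qed.

Lemma tildeL_ge0 (r : \bar R) (I : set R) (g : R -> \bar R) : 1 <= r ->
  (forall t, I t -> D01 t) -> 0 <= tildeL r I g.
Proof.
move=> r1 I01; have := @lq_le_tildeL R r I g (fun=> 0) r1 (fun=> lexx _) I01.
rewrite -(@pmule_rge0 _ 2%:E)// => h; apply: le_trans (h _).
  by apply: lq_ge0.
by move=> t _; rewrite eqxx.
Qed.

Lemma itv_D01 u t : (0 <= u)%R -> (t <= 1)%R ->
  forall s, `]u, t[%classic s -> D01 s.
Proof.
move=> u0 t1 s /=; rewrite in_itv/= => /andP[us st].
by rewrite /D01/= (le_lt_trans u0 us) (lt_le_trans st t1).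
Qed.

Lemma weighted_star_le : exists2 C : R, (0 < C)%R & forall f s, D01 s ->
  `|weighted_star f s| <= C%:E * ((al (cell s))%:E * star_seq f (cell s)).
Proof.
have [_ _ [C C0 hC]] := hW; exists C => // f s Ds.
rewrite gee0_abs; last first.
  by rewrite mule_ge0 ?star_ge0// lee_fin ltW// W_gt0.
rewrite muleA -EFinM; apply: lee_pmul; rewrite ?star_ge0//.
- by rewrite lee_fin ltW// W_gt0.
- by have [h _] := hC s Ds; rewrite lee_fin.
- exact: star_le_star_seq.
Qed.

Lemma weighted_star_ge : exists2 C : R, (0 < C)%R & forall f s, D01 s ->
  (0 < cell s)%N ->
  C%:E * ((al (cell s).-1)%:E * star_seq f (cell s).-1) <= `|weighted_star f s|.
Proof.
have [_ _ [C C0 hC]] := hW; have [S S0 hS] := geomlike_step hal.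
exists (S * C)^-1%R => [|f s Ds cs]; first by rewrite invr_gt0 mulr_gt0.
rewrite gee0_abs; last first.
  by rewrite mule_ge0 ?star_ge0// lee_fin ltW// W_gt0.
rewrite muleA -EFinM; apply: lee_pmul; rewrite ?x0//.
- by rewrite lee_fin mulr_ge0// invr_ge0 mulr_ge0// ltW.
- have [_ h] := hC s Ds; rewrite lee_fin ler_pdivrMl ?mulr_gt0//.
  have [h' _] := hS (cell s).-1; rewrite prednK// in h'.
  by apply: (le_trans h'); rewrite -mulrA ler_pM2l.
- exact: star_seq_le_star.
Qed.

Lemma head_fun_le : exists2 C : R, (0 < C)%R & forall f t, D01 t ->
  head_fun f t <= C%:E * tail_norm p al (star_seq f) (cell t).
Proof.
have [C C0 hC] := weighted_star_le; exists C => // f t Dt.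
have /andP[t0 t1] := Dt.
rewrite -lq_scale ?(ltW C0)//; last by move=> k; exact: if_mule_ge0.
apply: tildeL_le_lq => // [k|s].
  by rewrite mule_ge0 ?lee_fin ?(ltW C0)//; exact: if_mule_ge0.
move=> hs; have Ds : D01 s by apply: itv_D01 hs => //; exact: ltW.
split => //; move: hs; rewrite /= in_itv/= => /andP[s0 st].
by rewrite (leq_cell s0 (ltW st) (ltW t1)) hC.
Qed.

(** On the cell m + 1 the rearrangement is at least [star f (dyadic m)], so the entry m is read off
    one cell further to the left; accordingly I has to contain the cells whose predecessor satisfies
    P. *)
Lemma tildeL_weighted_star_ge : exists2 C : R, (0 < C)%R & forall f (P : pred nat) I,
  (forall s, I s -> D01 s) ->
  (forall s, D01 s -> (0 < cell s)%N -> P (cell s).-1 -> I s) ->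
  lq p (fun m => if P m then (al m)%:E * star_seq f m else 0) <=
    C%:E * tildeL p I (weighted_star f).
Proof.
have [C C0 hC] := weighted_star_ge; exists (C^-1 * 2)%R => [|f P I ID PI].
  by rewrite mulr_gt0 ?invr_gt0.
pose a m := if (0 < m)%N && P m.-1 then C%:E * ((al m.-1)%:E * star_seq f m.-1) else 0.
have a0 m : 0 <= a m.
  by rewrite /a; case: ifP => // _; rewrite !mule_ge0 ?lee_fin ?(ltW C0).
have -> : lq p (fun m => if P m then (al m)%:E * star_seq f m else 0) =
    (C^-1)%:E * lq p (fun m => a m.+1).
  rewrite -lq_scale ?invr_ge0 ?(ltW C0)//; congr lq; apply/funext => m.
  rewrite /a /=; case: ifP => _; last by rewrite mule0.
  by rewrite muleA -EFinM mulVf ?mul1e// gt_eqF.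
rewrite EFinM -muleA; apply: lee_wpmul2l; first by rewrite lee_fin invr_ge0 ltW.
apply: (le_trans (lq_shift p1 a0)); apply: lq_le_tildeL => // s Ds.
rewrite /a; case: ifPn => [/andP[cs Ps] _|_]; last by rewrite eqxx.
by split; [exact: PI|exact: hC].
Qed.

Lemma head_fun_ge : exists2 C : R, (0 < C)%R & forall f t, D01 t ->
  tail_norm p al (star_seq f) (cell t) <= C%:E * head_fun f t.
Proof.
have [C C0 hC] := tildeL_weighted_star_ge; exists C => // f t Dt.
apply: (hC f (leq (cell t))).
  by apply: itv_D01 => //; case/andP: Dt => _ /ltW.
move=> s Ds cs; rewrite -ltnS prednK// => ts.
by have /andP[s0 _] := Ds; rewrite /= in_itv/= s0 (cell_lt_lt Ds Dt ts).
Qed.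

Lemma head_fun_ge0 f t : D01 t -> 0 <= head_fun f t.
Proof.
by move=> /andP[t0 t1]; apply: tildeL_ge0 => //; apply: itv_D01 => //; exact: ltW.
Qed.

Lemma outer_fun_le : exists2 C : R, (0 < C)%R & forall f t, D01 t ->
  `|(V t)%:E * head_fun f t| <=
    C%:E * ((be (cell t))%:E * tail_norm p al (star_seq f) (cell t)).
Proof.
have [C C0 hC] := head_fun_le; have [_ _ [D D0 hD]] := hV.
exists (D * C)%R => [|f t Dt]; first exact: mulr_gt0.
rewrite gee0_abs; last by rewrite mule_ge0 ?head_fun_ge0// lee_fin ltW// V_gt0.
apply: (@le_trans _ _ ((D * be (cell t))%:E * (C%:E * tail_norm p al (star_seq f) (cell t)))).
  apply: lee_pmul; rewrite ?head_fun_ge0 ?hC//.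
    by rewrite lee_fin ltW// V_gt0.
  by rewrite lee_fin; have [] := hD t Dt.
by rewrite !EFinM muleACA.
Qed.

Lemma outer_fun_ge : exists2 C : R, (0 < C)%R & forall f t, D01 t ->
  (be (cell t))%:E * tail_norm p al (star_seq f) (cell t) <=
    C%:E * `|(V t)%:E * head_fun f t|.
Proof.
have [C C0 hC] := head_fun_ge; have [_ _ [D D0 hD]] := hV.
exists (D * C)%R => [|f t Dt]; first exact: mulr_gt0.
rewrite gee0_abs; last by rewrite mule_ge0 ?head_fun_ge0// lee_fin ltW// V_gt0.
apply: (@le_trans _ _ ((D * V t)%:E * (C%:E * head_fun f t))).
  apply: lee_pmul; rewrite ?lee_fin ?hC//.
  by have [] := hD t Dt.
by rewrite !EFinM muleACA.
Qed.

Lemma tildeL_gammaY_le : exists2 C : R, (0 < C)%R & forall f,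
  tildeL q `]0%R, 1%R[%classic (fun t => (V t)%:E * head_fun f t) <=
  C%:E * gammaY p q al be (star_seq f).
Proof.
have [C C0 hC] := outer_fun_le; exists C => // f.
rewrite -lq_scale ?(ltW C0)//; last by move=> k; rewrite mule_ge0 ?lee_fin.
apply: tildeL_le_lq => // [k|t ht].
  by rewrite !mule_ge0 ?lee_fin ?(ltW C0).
have Dt : D01 t by apply: itv_D01 ht.
by split => //; exact: hC.
Qed.

Let lee_scaleV (C : R) (a c : \bar R) : (0 < C)%R -> a <= C%:E * c -> C^-1%:E * a <= c.
Proof. by move=> C0 h; rewrite lee_pdivrMl. Qed.

Lemma tildeL_gammaY_ge : exists2 C : R, (0 < C)%R & forall f,
  gammaY p q al be (star_seq f) <=
  C%:E * tildeL q `]0%R, 1%R[%classic (fun t => (V t)%:E * head_fun f t).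
Proof.
have [C C0 hC] := outer_fun_ge; exists (C * 2)%R => [|f]; first exact: mulr_gt0.
have Cv0 : (0 < C^-1)%R by rewrite invr_gt0.
rewrite EFinM -muleA -lee_pdivrMl// -lq_scale ?(ltW Cv0)//; last first.
  by move=> k; rewrite mule_ge0 ?lee_fin.
apply: lq_le_tildeL => // [k|t Dt _].
- by rewrite !mule_ge0 ?lee_fin ?(ltW Cv0).
- by split; [rewrite /= in_itv|apply: lee_scaleV => //; exact: hC].
Qed.

Lemma tildeL_gammaI_le : exists2 C : R, (0 < C)%R & forall f u, D01 u ->
  tildeL q `]0%R, u[%classic (fun t => (V t)%:E * head_fun f t) <=
  C%:E * gammaI p q al be (star_seq f) (cell u).
Proof.
have [C C0 hC] := outer_fun_le; exists C => // f u Du; have /andP[u0 u1] := Du.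
rewrite -lq_scale ?(ltW C0)//; last by move=> k; exact: if_mule_ge0.
apply: tildeL_le_lq => // [k|t ht].
  by rewrite mule_ge0 ?lee_fin ?(ltW C0)//; exact: if_mule_ge0.
have Dt : D01 t by apply: itv_D01 ht => //; exact: ltW.
split => //; move: ht; rewrite /= in_itv/= => /andP[t0 tu].
by rewrite (leq_cell t0 (ltW tu) (ltW u1)) hC.
Qed.

Lemma tildeL_gammaI_ge : exists2 C : R, (0 < C)%R & forall f u, D01 u ->
  gammaI p q al be (star_seq f) (cell u) <=
  C%:E * tildeL q `]0%R, u[%classic (fun t => (V t)%:E * head_fun f t).
Proof.
have [C C0 hC] := outer_fun_ge; have [S S0 hS] := gammaI_step p1 q1 hal hbe.
exists (S * (C * 2))%R => [|f u Du]; first by rewrite !mulr_gt0.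
have /andP[u0 u1] := Du.
apply: (le_trans (hS _ _ (x0 f) (xS f))).
rewrite EFinM -muleA; apply: lee_wpmul2l; first by rewrite lee_fin ltW.
have Cv0 : (0 < C^-1)%R by rewrite invr_gt0.
rewrite EFinM -muleA -lee_pdivrMl// -lq_scale ?(ltW Cv0)//; last first.
  by move=> k; exact: if_mule_ge0.
apply: lq_le_tildeL => // [k||t Dt].
- by rewrite mule_ge0 ?lee_fin ?(ltW Cv0)//; exact: if_mule_ge0.
- by apply: itv_D01 => //; exact: ltW.
- case: ifPn => [ut _|_]; last by rewrite mule0 eqxx.
  split; last by apply: lee_scaleV => //; exact: hC.
  by have /andP[t0 _] := Dt; rewrite /= in_itv/= t0 (cell_lt_lt Dt Du ut).
Qed.

Lemma block_fun_ge0 f u t : D01 u -> D01 t -> 0 <= block_fun f u t.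
Proof.
move=> /andP[u0 _] /andP[_ t1]; apply: tildeL_ge0 => //.
by apply: itv_D01; exact: ltW.
Qed.

Lemma tildeL_gammaJ_le : exists2 C : R, (0 < C)%R & forall f u, D01 u ->
  tildeL q `]u, 1%R[%classic (fun t => (V t)%:E * block_fun f u t) <=
  C%:E * gammaJ p q al be (star_seq f) (cell u).
Proof.
have [C C0 hC] := weighted_star_le; have [_ _ [D D0 hD]] := hV.
exists (D * C)%R => [|f u Du]; first exact: mulr_gt0.
have DC0 : (0 <= D * C)%R by rewrite ltW// mulr_gt0.
have /andP[u0 u1] := Du; have u0' := ltW u0.
rewrite -lq_scale//; last by move=> k; exact: if_mule_ge0.
apply: tildeL_le_lq => // [k|t ht].
  by rewrite mule_ge0 ?lee_fin//; exact: if_mule_ge0.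
have Dt : D01 t by apply: itv_D01 ht.
have /andP[t0 t1] := Dt.
split => //; move: ht; rewrite /= in_itv/= => /andP[ut _].
rewrite (leq_cell u0 (ltW ut) (ltW t1)) gee0_abs; last first.
  by rewrite mule_ge0 ?block_fun_ge0// lee_fin ltW// V_gt0.
apply: (@le_trans _ _ ((D * be (cell t))%:E *
    (C%:E * block_norm p al (star_seq f) (cell t) (cell u)))); last first.
  by rewrite !EFinM muleACA.
apply: lee_pmul; rewrite ?block_fun_ge0//.
- by rewrite lee_fin ltW// V_gt0.
- by rewrite lee_fin; have [] := hD t Dt.
rewrite -lq_scale ?(ltW C0)//; last by move=> m; exact: if_mule_ge0.
apply: tildeL_le_lq => // [m|s hs].
  by rewrite mule_ge0 ?lee_fin ?(ltW C0)//; exact: if_mule_ge0.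
have Ds : D01 s by apply: itv_D01 hs => //; exact: ltW.
have /andP[s0 s1] := Ds.
split => //; move: hs; rewrite /= in_itv/= => /andP[us st].
by rewrite (leq_cell s0 (ltW st) (ltW t1)) (leq_cell u0 (ltW us) (ltW s1)) hC.
Qed.

(** Two cells are lost: the entry m <= n is read off on cell m + 1 <= n + 1, and for that cell to
    lie to the right of u the point u is taken in cell n + 2. *)
Lemma tildeL_gammaJ_ge : exists2 C : R, (0 < C)%R & forall f u n, D01 u ->
  cell u = n.+2 ->
  gammaJ p q al be (star_seq f) n <=
  C%:E * tildeL q `]u, 1%R[%classic (fun t => (V t)%:E * block_fun f u t).
Proof.
have [C C0 hC] := tildeL_weighted_star_ge; have [_ _ [D D0 hD]] := hV.
exists (D * C * 2)%R => [|f u n Du cu]; first by rewrite !mulr_gt0.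
have E0 : (0 < D * C)%R by rewrite !mulr_gt0.
have Ev0 : (0 < (D * C)^-1)%R by rewrite invr_gt0.
have /andP[u0 u1] := Du; have u0' := ltW u0.
rewrite [(_ * 2)%:E]EFinM -muleA -lee_pdivrMl// -lq_scale ?(ltW Ev0)//; last first.
  by move=> k; exact: if_mule_ge0.
apply: lq_le_tildeL => // [k||t Dt].
- by rewrite mule_ge0 ?lee_fin ?(ltW Ev0)//; exact: if_mule_ge0.
- exact: itv_D01.
case: ifPn => [tn _|_]; last by rewrite mule0 eqxx.
have /andP[t0 t1] := Dt.
have ut : (u < t)%R by apply: cell_lt_lt => //; rewrite cu ltnS (leq_trans tn).
split; first by rewrite /= in_itv/= ut.
apply: lee_scaleV => //.
rewrite gee0_abs; last by rewrite mule_ge0 ?block_fun_ge0// lee_fin ltW// V_gt0.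
apply: (@le_trans _ _ ((D * V t)%:E * (C%:E * block_fun f u t))); last first.
  by rewrite !EFinM muleACA.
apply: lee_pmul; rewrite ?lee_fin//; first by have [] := hD t Dt.
apply: (hC f (fun m => cell t <= m <= n)%N) => [|s Ds cs].
  by apply: itv_D01 => //; exact: ltW.
rewrite -ltnS prednK// => /andP[ts sn].
rewrite /= in_itv/= (cell_lt_lt Ds Dt ts) andbT; apply: cell_lt_lt => //.
by rewrite cu -(prednK cs) !ltnS.
Qed.

End Discretization.

(** * Equivalence of norms and transfer to sequences *)

Section NormEquivalence.
Context {R : realType}.
Local Open Scope ereal_scope.
Local Notation I01 := (`](0 : R)%R, 1%R[%classic).
Implicit Types (A B : (R -> R) -> \bar R) (E : ri_space R).

Definition norm_equiv A B : Prop := exists2 C : R, (0 < C)%R &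
  forall f, measurable_fun I01 f -> A f <= C%:E * B f /\ B f <= C%:E * A f.

Lemma norm_equiv_sym A B : norm_equiv A B -> norm_equiv B A.
Proof. by move=> [C C0 h]; exists C => // f /h[]. Qed.

Lemma norm_equiv_trans A B D : norm_equiv A B -> norm_equiv B D -> norm_equiv A D.
Proof.
move=> [C C0 h] [C' C'0 h']; exists (C * C')%R => [|f mf]; first exact: mulr_gt0.
have [h1 h2] := h f mf; have [h3 h4] := h' f mf; split.
  by apply: (le_trans h1); rewrite EFinM -muleA; apply: lee_wpmul2l; rewrite ?lee_fin ?(ltW C0).
by apply: (le_trans h4); rewrite mulrC EFinM -muleA; apply: lee_wpmul2l; rewrite ?lee_fin ?(ltW C'0).
Qed.

Lemma norm_equiv_intro A B : (exists2 C : R, (0 < C)%R &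
    forall f, measurable_fun I01 f -> A f <= C%:E * B f) ->
  (exists2 C : R, (0 < C)%R & forall f, measurable_fun I01 f -> B f <= C%:E * A f) ->
  (forall f, measurable_fun I01 f -> 0 <= A f) ->
  (forall f, measurable_fun I01 f -> 0 <= B f) -> norm_equiv A B.
Proof.
move=> [C C0 h] [C' C'0 h'] A0 B0; exists (C + C')%R => [|f mf]; first exact: addr_gt0.
split.
  by apply: (le_trans (h f mf)); apply: lee_wpmul2r; rewrite ?B0// lee_fin lerDl ltW.
by apply: (le_trans (h' f mf)); apply: lee_wpmul2r; rewrite ?A0// lee_fin lerDr ltW.
Qed.

(* Losing d cells in the lower bound is harmless: om changes by a bounded      *)
(* factor over d steps, and E~ norms of sequences are shift invariant.         *)
Lemma tilde_seq_norm_equiv E (d : nat) (z : R) (w : R -> R) (om : nat -> R)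
    (F : (R -> R) -> R -> \bar R) (A : (R -> R) -> nat -> \bar R) :
  cellwise (@D01 R) w om -> geomlike z om ->
  (forall f n, 0 <= A f n) -> (forall f u, D01 u -> 0 <= F f u) ->
  (exists2 C : R, (0 < C)%R & forall f u, D01 u -> F f u <= C%:E * A f (cell u)) ->
  (exists2 C : R, (0 < C)%R & forall f u n, D01 u -> cell u = (n + d)%N ->
     A f n <= C%:E * F f u) ->
  norm_equiv (fun f => tilde E I01 (fun u => (w u)%:E * F f u))
             (fun f => seq_norm E (fun n => (om n)%:E * A f n)).
Proof.
move=> [w0 om0 [C C0 hC]] hom A0 F0 [K1 K10 h1] [K2 K20 h2].
have omA0 f n : 0 <= (om n)%:E * A f n by rewrite mule_ge0// lee_fin ltW.
have abs f u : D01 u -> `|(w u)%:E * F f u| = (w u)%:E * F f u.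
  by move=> Du; rewrite gee0_abs// mule_ge0 ?F0// lee_fin ltW// w0.
apply: norm_equiv_intro; last 2 first.
- by move=> f _; apply: ri_ge0; exact: rearrangement_nonneg_measurable.
- by move=> f _; exact: seq_norm_ge0.
- exists (C * K1)%R => [|f _]; first exact: mulr_gt0.
  rewrite -seq_norm_scale ?mulr_ge0 ?(ltW C0) ?(ltW K10)//.
  apply: tilde_le_seq_norm => [n|u Du].
    by rewrite mule_ge0 ?omA0// lee_fin mulr_ge0 ?(ltW C0) ?(ltW K10).
  rewrite abs// EFinM muleACA -EFinM; apply: lee_pmul; rewrite ?F0 ?h1//.
    by rewrite lee_fin ltW// w0.
  by rewrite lee_fin; have [] := hC u Du.
have [z0 _ _ lom] := hom.
have z20 : (0 < z / 2 < z)%R by rewrite divr_gt0//= ltr_pdivrMr// ltr_pMr// ltr1n.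
(* The rate z/2 bounds [om n] by a multiple of [om (n + d)]. *)
have [S S0 hS] := lom _ z20.
have y0 : (0 < (z / 2) ^+ d)%R by rewrite exprn_gt0//; case/andP: z20.
pose c := (S / (z / 2) ^+ d * C * K2)%R.
have c0 : (0 < c)%R by rewrite !mulr_gt0// invr_gt0.
exists c => // f _; rewrite -lee_pdivrMl// -seq_norm_scale ?invr_ge0 ?(ltW c0)//.
(* The sequence is delayed by d and is 0 on the first d cells, where the hypothesis gives no lower
   bound for F; [seq_norm_inj] undoes the delay. *)
pose a n := if (d <= n)%N then c^-1%:E * ((om (n - d)%N)%:E * A f (n - d)%N) else 0.
have a0 n : 0 <= a n.
  by rewrite /a; case: ifP => // _; rewrite mule_ge0 ?lee_fin ?invr_ge0 ?(ltW c0).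
apply: (@le_trans _ _ (seq_norm E a)).
  rewrite [X in seq_norm E X <= _](_ : _ = fun n => if xpredT n then a (n + d)%N else 0).
    by apply: (@seq_norm_inj _ _ _ xpredT (addn^~ d)) => // m n _ _ /addIn.
  by apply/funext => n; rewrite /a leq_addl addnK.
apply: seq_norm_le_tilde => // u Du; rewrite abs// /a.
case: ifPn => [du|_]; last by rewrite mule_ge0 ?F0// lee_fin ltW// w0.
set n := (cell u - d)%N; have cu : cell u = (n + d)%N by rewrite subnK.
rewrite lee_pdivrMl//.
have omw : (om n <= S / (z / 2) ^+ d * C * w u)%R.
  have := hS n d; rewrite -ler_pdivlMl// => h; apply: (le_trans h).
  rewrite mulrCA mulrA -!mulrA ler_pM2l// ler_pM2l ?invr_gt0//.
  by rewrite -cu; have [] := hC u Du.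
apply: (@le_trans _ _ ((S / (z / 2) ^+ d * C * w u)%:E * (K2%:E * F f u))).
  apply: lee_pmul; rewrite ?lee_fin ?(ltW (om0 _)) ?A0//.
  exact: h2 cu.
have -> : c%:E * ((w u)%:E * F f u) =
    (S / (z / 2) ^+ d * C * w u)%:E * (K2%:E * F f u).
  by rewrite !muleA -!EFinM; congr (_%:E * _); rewrite /c; ring.
by [].
Qed.

End NormEquivalence.

(** * Change of the sampling sequence *)

Section Reparametrization.
Context {R : realType}.
Implicit Types (r : nat -> R) (E : ri_space R).

Lemma geomlike_bounded z r : z < 1 -> geomlike z r ->
  exists y, 0 < y < 1 /\ exists2 C, 0 < C & forall n k, r (n + k)%N <= C * y ^+ k * r n.
Proof.
move=> z1 [z0 _ ur _].
have zy : z < (1 + z) / 2 by lra.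
exists ((1 + z) / 2); split; last exact: ur.
by apply/andP; split; lra.
Qed.

Lemma geomlike_small z r e : z < 1 -> geomlike z r -> 0 < e -> exists n, r n <= e.
Proof.
move=> z1 hr e0; have [y [/andP[y0 y1] [C C0 hC]]] := geomlike_bounded z1 hr.
have r00 := geomlike_gt0 0%N hr.
have Cr : 0 < C * r 0%N by exact: mulr_gt0.
have := @cvg_expr R y; rewrite ger0_norm ?(ltW y0)// => /(_ y1).
move=> /cvgrPdist_lt /(_ _ (divr_gt0 e0 Cr)) [N _ /(_ N (leqnn _))].
rewrite /= sub0r normrN ger0_norm ?exprn_ge0 ?(ltW y0)// => h.
exists N; have := hC 0%N N; rewrite add0n => h'; apply: (le_trans h').
by rewrite mulrAC mulrC -ler_pdivlMr// ltW.
Qed.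

(** For each n take the least m with r'_m <= r_n: by minimality r'_(m-1) exceeds r_n, and one step
    of r' costs a constant. When m = 0 there is no predecessor, and r_n <= C r_0 is compared with
    r'_0 instead. *)
Lemma comparable_index z z' r r' : z < 1 -> z' < 1 -> geomlike z r -> geomlike z' r' ->
  exists2 K, 1 <= K & forall n, exists m, r n <= K * r' m /\ r' m <= K * r n.
Proof.
move=> z1 z'1 hr hr'.
have [y [/andP[y0 y1] [C C0 hC]]] := geomlike_bounded z1 hr.
have [S S0 hS] := geomlike_step hr'.
have r0 n := geomlike_gt0 n hr; have r'0 n := geomlike_gt0 n hr'.
have A0 : 0 < C * r 0%N / r' 0%N by rewrite divr_gt0// mulr_gt0.
exists (1 + S + C * r 0%N / r' 0%N) => [|n]; first by rewrite -addrA lerDl addr_ge0// ltW.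
set A := C * r 0%N / r' 0%N in A0 *.
have ex : exists m, r' m <= r n by exact: geomlike_small z'1 hr' (r0 n).
pose m := ex_minn ex; have [hm hmin] : r' m <= r n /\ forall k, r' k <= r n -> (m <= k)%N.
  by rewrite /m; case: ex_minnP.
exists m; split; last first.
  by apply: (le_trans hm); rewrite ler_peMl ?(ltW (r0 n))//; lra.
case: m hm hmin => [|m] hm hmin.
  have := hC 0%N n; rewrite add0n => h; apply: (le_trans h).
  have yn1 : y ^+ n <= 1 by rewrite exprn_ile1// ltW.
  apply: (@le_trans _ _ (A * r' 0%N)); last by rewrite ler_pM2r//; lra.
  by rewrite /A divfK ?gt_eqF// ler_pM2r// -[leRHS]mulr1 ler_pM2l.
have h : r n <= r' m.
  rewrite leNgt; apply/negP => /ltW /hmin.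
  by rewrite ltnn.
have [h' _] := hS m; apply: (le_trans h); apply: (le_trans h').
by rewrite ler_pM2r//; lra.
Qed.

(** Indices m < n matched to the same index satisfy r_m <= K^2 r_n, and geometric decay then bounds
    n - m by L. The matching is thus injective on residue classes modulo L + 1, and
    [seq_norm_spread] applies. *)
Lemma seq_norm_reparam E z z' r r' : z < 1 -> z' < 1 ->
  geomlike z r -> geomlike z' r' ->
  exists2 K, 1 <= K & exists2 C, 0 < C & forall (a a' : nat -> \bar R) D,
    0 <= D -> (forall n, 0%E <= a n)%E -> (forall n, 0%E <= a' n)%E ->
    (forall n m, r n <= K * r' m -> r' m <= K * r n -> (a n <= D%:E * a' m)%E) ->
    (seq_norm E a <= (C * D)%:E * seq_norm E a')%E.
Proof.
move=> z1 z'1 hr hr'; have [K K1 hK] := comparable_index z1 z'1 hr hr'.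
have K0 : 0 < K by exact: lt_le_trans K1.
have [y [/andP[y0 y1] [C C0 hC]]] := geomlike_bounded z1 hr.
have KC0 : 0 < K * K * C by rewrite !mulr_gt0.
have [L hL] : exists L : nat, K * K * C * y ^+ L < 1.
  have := @cvg_expr R y; rewrite ger0_norm ?(ltW y0)// => /(_ y1).
  have KCv : 0 < (K * K * C)^-1 by rewrite invr_gt0.
  move=> /cvgrPdist_lt /(_ _ KCv) [N _ /(_ N (leqnn _))].
  rewrite /= sub0r normrN ger0_norm ?exprn_ge0 ?(ltW y0)// => h.
  by exists N; rewrite mulrC -ltr_pdivlMr// div1r.
exists K => //; exists L.+1%:R => // a a' D D0 a0 a'0 haa'.
pose mu n := projT1 (cid (hK n)).
have muP n : r n <= K * r' (mu n) /\ r' (mu n) <= K * r n.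
  by rewrite /mu; case: cid.
have r0 n := geomlike_gt0 n hr.
have far m n : (m < n)%N -> mu m = mu n -> m = n %[mod L.+1] -> False.
  move=> mn mumn /eqP; rewrite eq_sym eqn_mod_dvd ?(ltnW mn)// => dv.
  have Lnm : (L < n - m)%N by apply: dvdn_leq dv; rewrite subn_gt0.
  have [h1 _] := muP m; have [_ h2] := muP n.
  have h3 : r m <= K * K * r n.
    by apply: (le_trans h1); rewrite -mulrA ler_pM2l// mumn.
  have h4 := hC m (n - m)%N; rewrite subnKC ?(ltnW mn)// in h4.
  have yy : y ^+ (n - m) <= y ^+ L.
    by apply: ler_wiXn2l; [exact: ltW|exact: ltW|exact: ltnW].
  have : r m < r m; last by rewrite ltxx.
  apply: (le_lt_trans h3); apply: (@le_lt_trans _ _ (K * K * C * y ^+ L * r m)).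
    rewrite -(mulrA (K * K)) -(mulrA (K * K)) ler_pM2l ?mulr_gt0//.
    by apply: (le_trans h4); rewrite ler_pM2r// ler_pM2l.
  by rewrite gtr_pMl.
have inj m n : mu m = mu n -> m = n %[mod L.+1] -> m = n.
  move=> h1 h2; case: (ltngtP m n) => // mn; first by have := far _ _ mn h1 h2.
  by have := far _ _ mn (esym h1) (esym h2).
apply: (@le_trans _ _ (D%:E * seq_norm E (fun n => a' (mu n)))%E).
  rewrite -seq_norm_scale//; apply: seq_norm_mono => // n.
  by have [h1 h2] := muP n; exact: haa'.
rewrite mulrC EFinM -muleA; apply: lee_wpmul2l => //.
exact: seq_norm_spread.
Qed.

End Reparametrization.

(** * Gamma norms as iterated norms for dt/t *)

Section GammaSpaces.
Context {R : realType}.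
Local Open Scope ereal_scope.
Local Notation I01 := (`](0 : R)%R, 1%R[%classic).
Implicit Types (f : R -> R).

(** An exact identity: writing ds = s ds/s, the extra factors s and t are absorbed by [inner_weight]
    and [wroot]. *)
Lemma GGamma_normE (p : R) (q : \bar R) (w1 w2 : R -> R) f :
  (1 < p)%R -> 1 <= q -> SV (fun u => u * w1 u)%R -> SV w2 ->
  GGamma_norm p q w1 w2 f =
  tildeL q `]0%R, 1%R[%classic (fun t => (wroot q w1 t)%:E *
    head_fun p%:E (inner_weight p w2) f t).
Proof.
move=> p1 q1 [_ hw1 _] [_ hw2 _].
have p0 : (0 < p)%R by exact: lt_trans p1.
have pn0 : p != 0%R by rewrite gt_eqF.
have inner t : (0 < t < 1)%R ->
    (\int[@lebesgue_measure R]_(s in `]0%R, t[) ((w2 s)%:E * star f s `^ p)) `^ p^-1 =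
    head_fun p%:E (inner_weight p w2) f t.
  move=> /andP[t0 t1]; rewrite /head_fun /tildeL; congr (_ `^ _).
  apply: eq_integral => s; rewrite inE/= in_itv/= => /andP[s0 st].
  have s1 : (s < 1)%R by exact: lt_trans t1.
  have w20 : (0 < w2 s)%R by apply: hw2; rewrite s0.
  rewrite gee0_abs; last first.
    by rewrite mule_ge0 ?star_ge0// lee_fin mulr_ge0 ?powR_ge0.
  rewrite /weighted_star poweRM ?star_ge0 ?lee_fin ?mulr_ge0 ?powR_ge0//.
  rewrite muleAC poweR_EFin -EFinM; congr (_%:E * _).
  rewrite /inner_weight powRM ?powR_ge0// -!powRrM mulVf// !powRr1 ?(ltW s0) ?(ltW w20)//.
  by field; rewrite gt_eqF.
have h0 t : (0 < t < 1)%R -> 0 <= head_fun p%:E (inner_weight p w2) f t.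
  by move=> t01; apply: head_fun_ge0 => //; rewrite lee_fin ltW.
move: (head_fun p%:E (inner_weight p w2) f) inner h0 => H inner h0.
move: q q1; apply: lq_index_ind => [r r1|] /=; last first.
  rewrite /ess_sup_on; congr (ess_sup _ _); apply/funext => t; rewrite /patch.
  case: ifPn => //; rewrite inE/= in_itv/= => t01.
  by rewrite inner// mul1e gee0_abs// h0.
have r0 : (0 < r)%R by exact: lt_le_trans r1.
congr (_ `^ _); apply: eq_integral => t; rewrite inE/= in_itv/= => t01.
have /andP[t0 t1] := t01.
have tw0 : (0 < t * w1 t)%R by exact: hw1.
rewrite gee0_abs; last by rewrite mule_ge0 ?h0// lee_fin powR_ge0.
rewrite poweRM// ?lee_fin ?powR_ge0 ?h0//.
rewrite -inner// -poweRrM (mulrC r) muleAC poweR_EFin -EFinM; congr (_%:E * _).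
rewrite -powRrM mulVf ?gt_eqF// powRr1 ?(ltW tw0)//.
by field; rewrite gt_eqF.
Qed.

Lemma GGamma_norm_equiv (p : R) (q : \bar R) (w1 w2 : R -> R) :
  (1 < p)%R -> 1 <= q -> SV (fun u => u * w1 u)%R -> SV w2 ->
  norm_equiv (GGamma_norm p q w1 w2)
    (fun f => gammaY p%:E q (fun n => inner_weight p w2 (dyadic n))
      (fun n => wroot q w1 (dyadic n)) (star_seq f)).
Proof.
move=> p1 q1 hw1 hw2.
have p1' : 1 <= p%:E by rewrite lee_fin ltW.
have hal := inner_weight_geomlike p1 hw2; have hbe := wroot_geomlike q1 hw1.
have hW := inner_weight_cellwise p hw2; have hV := wroot_cellwise q1 hw1.
have [C C0 hC] := tildeL_gammaY_le p1' q1 hal hbe hW hV.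
have [D D0 hD] := tildeL_gammaY_ge p1' q1 hal hbe hW hV.
have Y0 f : 0 <= gammaY p%:E q (fun n => inner_weight p w2 (dyadic n))
      (fun n => wroot q w1 (dyadic n)) (star_seq f).
  by apply: gammaY_ge0 hal hbe _ _ => k; exact: star_seq_ge0.
apply: norm_equiv_intro => [||f _|//].
- by exists C => // f _; rewrite GGamma_normE.
- by exists D => // f _; rewrite GGamma_normE.
- by rewrite GGamma_normE//; apply: tildeL_ge0.
Qed.

End GammaSpaces.

(** * The K-functional of two Gamma spaces *)

Section KFunctional.
Context {R : realType}.
Local Open Scope ereal_scope.
Local Notation I01 := (`](0 : R)%R, 1%R[%classic).
Variables (b w1 w2 w3 w4 : R -> R) (p0 p1 : R) (q0 q1 : \bar R).
Hypotheses (hb : SV b) (hw1 : SV (fun u => u * w1 u)%R) (hw2 : SV w2)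
  (hw3 : SV (fun u => u * w3 u)%R) (hw4 : SV w4)
  (hp0 : (1 < p0)%R) (hp01 : (p0 < p1)%R) (hq0 : 1 <= q0) (hq1 : 1 <= q1).
Implicit Types (f : R -> R) (s t : R) (E : ri_space R).

Let p1_gt1 : (1 < p1)%R. Proof. exact: lt_trans hp01. Qed.
Let p0_gt0 : (0 < p0)%R. Proof. exact: lt_trans hp0. Qed.
Let p1_gt0 : (0 < p1)%R. Proof. exact: lt_trans hp01. Qed.
Let p0E : 1 <= p0%:E. Proof. by rewrite lee_fin ltW. Qed.
Let p1E : 1 <= p1%:E. Proof. by rewrite lee_fin ltW. Qed.

Local Notation Y0 := (GGamma p0 q0 w1 w2).
Local Notation Y1 := (GGamma p1 q1 w3 w4).
Local Notation ala := (fun n => inner_weight p0 w2 (dyadic n)).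
Local Notation bea := (fun n => wroot q0 w1 (dyadic n)).
Local Notation alb := (fun n => inner_weight p1 w4 (dyadic n)).
Local Notation beb := (fun n => wroot q1 w3 (dyadic n)).
Local Notation za := (2^-1 `^ p0^-1 : R)%R.
Local Notation zb := (2^-1 `^ p1^-1 : R)%R.

Let hala : geomlike za ala. Proof. exact: inner_weight_geomlike. Qed.
Let halb : geomlike zb alb. Proof. exact: inner_weight_geomlike. Qed.
Let hbea : geomlike 1%R bea. Proof. exact: wroot_geomlike. Qed.
Let hbeb : geomlike 1%R beb. Proof. exact: wroot_geomlike. Qed.

Let half_powR_lt1 (e : R) : (0 < e)%R -> (2^-1 `^ e < 1 :> R)%R.
Proof.
move=> e0; have := @gt0_ltr_powR R e e0 2^-1%R 1%R.
rewrite powR1 !nnegrE; apply; rewrite ?invr_ge0//.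
by rewrite invf_lt1// ltr1n.
Qed.

Lemma exponent_gap_gt0 : (0 < p0^-1 - p1^-1)%R.
Proof. by rewrite subr_gt0 ltf_pV2 ?posrE. Qed.

Let zbE : (za / zb = 2^-1 `^ (p0^-1 - p1^-1))%R.
Proof. by rewrite powRB//; apply/implyP => _; rewrite invr_eq0 pnatr_eq0. Qed.

Let zb1 : (zb < 1)%R. Proof. by apply: half_powR_lt1; rewrite invr_gt0. Qed.

Let ratio_lt1 : (za / zb < 1)%R.
Proof. by rewrite zbE half_powR_lt1// exponent_gap_gt0. Qed.

Let zab : (za < zb)%R.
Proof. by have := ratio_lt1; rewrite ltr_pdivrMr// mul1r. Qed.

Definition rho_seq : nat -> R := phi_ratio q0 q1 ala bea alb beb.
Definition K_seq f (n : nat) : \bar R :=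
  Kseq p0%:E q0 p1%:E q1 ala bea alb beb (star_seq f) n.

Lemma rho_seq_geomlike : geomlike (2^-1 `^ (p0^-1 - p1^-1))%R rho_seq.
Proof. by rewrite -zbE; exact: phi_ratio_geomlike. Qed.

Lemma rho_seq_gt0 n : (0 < rho_seq n)%R.
Proof. exact: geomlike_gt0 rho_seq_geomlike. Qed.

Lemma K_seq_ge0 f n : 0 <= K_seq f n.
Proof. by apply: Kseq_ge0 hala hbea halb hbeb _ _ _ => // k; exact: star_seq_ge0. Qed.

Lemma GGamma_norm_ge0 (p : R) (q : \bar R) (v1 v2 : R -> R) f :
  (1 < p)%R -> 1 <= q -> SV (fun u => u * v1 u)%R -> SV v2 ->
  0 <= GGamma_norm p q v1 v2 f.
Proof. by move=> *; rewrite GGamma_normE//; apply: tildeL_ge0. Qed.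

Let Y0_ge0 f : 0 <= GGamma_norm p0 q0 w1 w2 f.
Proof. exact: GGamma_norm_ge0. Qed.
Let Y1_ge0 f : 0 <= GGamma_norm p1 q1 w3 w4 f.
Proof. exact: GGamma_norm_ge0. Qed.

Lemma Kfun_ge0 t f : (0 < t)%R -> 0 <= Kfun Y0 Y1 t f.
Proof.
move=> t0; apply: le_ereal_inf_tmp => _ [f0 [f1 [_ _ _ ->]]].
by rewrite adde_ge0 ?Y0_ge0// mule_ge0 ?Y1_ge0// lee_fin ltW.
Qed.

(** For every decomposition, k >= 1 and s <= k t bound its cost at s by k times its cost at t. *)
Lemma Kfun_dilation (k s t : R) f : (0 < s)%R -> (0 < t)%R -> (1 <= k)%R ->
  (s <= k * t)%R -> Kfun Y0 Y1 s f <= k%:E * Kfun Y0 Y1 t f.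
Proof.
move=> s0 t0 k1 skt; have k0 : (0 < k)%R by exact: lt_le_trans k1.
rewrite -lee_pdivrMl//; apply: le_ereal_inf_tmp => _ [f0 [f1 [Yf0 Yf1 ff ->]]].
rewrite lee_pdivrMl//.
apply: (@le_trans _ _ (GGamma_norm p0 q0 w1 w2 f0 + s%:E * GGamma_norm p1 q1 w3 w4 f1)).
  by apply: ereal_inf_lbound; exists f0, f1.
rewrite ge0_muleDr ?Y0_ge0 ?mule_ge0 ?Y1_ge0 ?lee_fin ?(ltW t0)//.
apply: leeD; first by rewrite lee_pemull.
by rewrite muleA -EFinM; apply: lee_wpmul2r; rewrite ?Y1_ge0 ?lee_fin.
Qed.

(** For an arbitrary decomposition, subadditivity of rearrangements at [dyadic k], the double of
    [dyadic k.+1], gives the hypothesis of [Kseq_lower]. *)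
Lemma K_seq_le_Kfun : exists2 C : R, (0 < C)%R & forall f n,
  measurable_fun I01 f -> K_seq f n <= C%:E * Kfun Y0 Y1 (rho_seq n) f.
Proof.
have [C C0 hC] := Kseq_lower p0E hq0 p1E hq1 zab hala hbea halb hbeb.
have [D0 D00 hD0] := GGamma_norm_equiv hp0 hq0 hw1 hw2.
have [D1 D10 hD1] := GGamma_norm_equiv p1_gt1 hq1 hw3 hw4.
have CD : (0 < C * (D0 + D1))%R by rewrite mulr_gt0// addr_gt0.
exists (C * (D0 + D1))%R => // f n mf.
rewrite -lee_pdivrMl//; apply: le_ereal_inf_tmp => _ [f0 [f1 [[mf0 Yf0] [mf1 Yf1] ff ->]]].
rewrite lee_pdivrMl//.
have sub k : star_seq f k <= star_seq f0 k.+1 + star_seq f1 k.+1.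
  rewrite /star_seq (_ : dyadic k = dyadic k.+1 + dyadic k.+1)%R; last first.
    by rewrite dyadicS mulr2n mulrDl mul1r.
  exact: star_add_ae.
apply: (le_trans (hC _ _ _ n (star_seq_ge0 f) (star_seq_ge0 f0) (star_seq_ge0 f1) sub)).
rewrite (EFinM C) -(muleA C%:E); apply: lee_wpmul2l; first by rewrite lee_fin ltW.
have r0 := rho_seq_gt0 n; have r0' := ltW r0.
rewrite ge0_muleDr ?Y0_ge0 ?mule_ge0 ?Y1_ge0 ?lee_fin//.
apply: leeD.
  have [_ h] := hD0 f0 mf0; apply: (le_trans h); apply: lee_wpmul2r => //.
  by rewrite lee_fin lerDl ltW.
rewrite muleCA; apply: lee_wpmul2l => //.
have [_ h] := hD1 f1 mf1; apply: (le_trans h); apply: lee_wpmul2r => //.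
by rewrite lee_fin lerDr ltW.
Qed.

(** The nearly optimal decomposition cuts f at the height [star_seq f n]. Finiteness of [K_seq f n]
    puts the two parts into the two spaces, so that they are admissible in the infimum; otherwise
    there is nothing to prove. *)
Lemma Kfun_le_K_seq : exists2 C : R, (0 < C)%R & forall f n,
  measurable_fun I01 f -> Kfun Y0 Y1 (rho_seq n) f <= C%:E * K_seq f n.
Proof.
have [C C0 hC] := Kseq_upper p0E hq0 p1E hq1 zb1 hala hbea halb hbeb.
have [D0 D00 hD0] := GGamma_norm_equiv hp0 hq0 hw1 hw2.
have [D1 D10 hD1] := GGamma_norm_equiv p1_gt1 hq1 hw3 hw4.
have CD : (0 < (D0 + D1) * C)%R by rewrite mulr_gt0// addr_gt0.
exists ((D0 + D1) * C)%R => // f n mf.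
have [->|Koo] := eqVneq (K_seq f n) +oo.
  by rewrite gt0_muley ?lte_fin// leey.
set c := star_seq f n; have c0 : 0 <= c by exact: star_seq_ge0.
set f0 := large_part c f; set f1 := small_part c f.
have mf0 : measurable_fun I01 f0 by exact: measurable_large_part.
have mf1 : measurable_fun I01 f1 by exact: measurable_small_part.
have dn0 k : (0 <= dyadic k :> R)%R by rewrite ltW// dyadic_gt0.
have hK : gammaY p0%:E q0 ala bea (star_seq f0) +
    (rho_seq n)%:E * gammaY p1%:E q1 alb beb (star_seq f1) <= C%:E * K_seq f n.
  apply: hC; try by move=> k; exact: star_seq_ge0.
  - by move=> k; exact: star_large_part_le.
  - by move=> k; exact: star_small_part_le.
  - by move=> k kn; apply: star_large_part0 => //; rewrite dn0 dyadic_anti// ltnW.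
  - by move=> k; exact: star_small_part_bounded.
have Kfin : C%:E * K_seq f n < +oo.
  by rewrite lte_mul_pinfty ?lee_fin ?(ltW C0)// ltey.
have r0 := rho_seq_gt0 n; have r0' : 0 <= (rho_seq n)%:E by rewrite lee_fin ltW.
have g0 : 0 <= gammaY p0%:E q0 ala bea (star_seq f0).
  by apply: gammaY_ge0 hala hbea _ _ => k; exact: star_seq_ge0.
have g1 : 0 <= gammaY p1%:E q1 alb beb (star_seq f1).
  by apply: gammaY_ge0 halb hbeb _ _ => k; exact: star_seq_ge0.
have [h0 _] := hD0 f0 mf0; have [h1 _] := hD1 f1 mf1.
have g0fin : gammaY p0%:E q0 ala bea (star_seq f0) < +oo.
  apply: le_lt_trans Kfin; apply: le_trans hK.
  by rewrite leeDl// mule_ge0.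
have g1fin : gammaY p1%:E q1 alb beb (star_seq f1) < +oo.
  rewrite ltey; apply/eqP => g1oo.
  have := le_lt_trans hK Kfin; rewrite g1oo gt0_muley ?lte_fin//.
  by rewrite addey ?ltxx// gt_eqF// (lt_le_trans ltNy0).
have Y0f : Y0.(carrier) f0.
  split => //; apply: (le_lt_trans h0).
  by rewrite lte_mul_pinfty ?lee_fin ?(ltW D00).
have Y1f : Y1.(carrier) f1.
  split => //; apply: (le_lt_trans h1).
  by rewrite lte_mul_pinfty ?lee_fin ?(ltW D10).
apply: (@le_trans _ _ (GGamma_norm p0 q0 w1 w2 f0 +
    (rho_seq n)%:E * GGamma_norm p1 q1 w3 w4 f1)).
  apply: ereal_inf_lbound; exists f0, f1; split => //.
  by apply: aeW => x _; exact: large_small_part.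
rewrite (EFinM (D0 + D1)) -(muleA (D0 + D1)%:E).
apply: (@le_trans _ _ ((D0 + D1)%:E * (gammaY p0%:E q0 ala bea (star_seq f0) +
    (rho_seq n)%:E * gammaY p1%:E q1 alb beb (star_seq f1)))); last first.
  by apply: lee_wpmul2l => //; rewrite lee_fin ltW// addr_gt0.
rewrite ge0_muleDr ?mule_ge0//; apply: leeD.
  apply: (le_trans h0); apply: lee_wpmul2r => //.
  by rewrite lee_fin lerDl ltW.
rewrite muleCA; apply: lee_wpmul2l => //.
apply: (le_trans h1); apply: lee_wpmul2r => //.
by rewrite lee_fin lerDr ltW.
Qed.

Lemma ext1_rho_seq_geomlike : geomlike 1%R (fun n => ext1 b (rho_seq n)).
Proof.
apply: tempered_geomlike (ext1_tempered hb) rho_seq_geomlike _ => n.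
exact: rho_seq_gt0.
Qed.

Definition psi_seq (theta : R) n : R := (rho_seq n `^ (- theta) * ext1 b (rho_seq n))%R.

(** The extension [ext1 b] is used because the function is also evaluated at points [rho_seq n],
    which may be 1 or more. *)
Definition interp_fun (theta : R) f t : \bar R :=
  (t `^ (- theta) * ext1 b t)%:E * Kfun Y0 Y1 t f.

Lemma ext1_gt0 t : (0 < t)%R -> (0 < ext1 b t)%R.
Proof. by case: (ext1_tempered hb) => h _ /h. Qed.

Lemma interp_fun_ge0 (theta : R) f t : (0 < t)%R -> 0 <= interp_fun theta f t.
Proof.
move=> t0; rewrite mule_ge0 ?Kfun_ge0// lee_fin mulr_ge0 ?powR_ge0//.
exact/ltW/ext1_gt0.
Qed.

Lemma interp_fun_regular (theta k : R) : (0 <= theta)%R -> (1 <= k)%R ->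
  exists2 C : R, (0 < C)%R & forall f s t, (0 < s)%R -> (0 < t)%R ->
    (s <= k * t)%R -> (t <= k * s)%R ->
    interp_fun theta f s <= C%:E * interp_fun theta f t.
Proof.
move=> th0 k1; have k0 : (0 < k)%R by exact: lt_le_trans k1.
have [_ /(_ _ ltr01)[A A0 hA]] := ext1_tempered hb.
exists (k `^ theta * (A * k `^ 1) * k)%R => [|f s t s0 t0 skt tks].
  by rewrite !mulr_gt0// powR_gt0.
have et0 := ext1_gt0 t0; have es0 := ext1_gt0 s0.
have pw : (s `^ (- theta) <= k `^ theta * t `^ (- theta))%R.
  rewrite !powRN ler_pdivlMr ?powR_gt0// mulrC ler_pdivrMr ?powR_gt0//.
  rewrite -powRM ?(ltW k0) ?(ltW s0)//.
  by apply: ge0_ler_powR; rewrite ?nnegrE ?(ltW t0) ?mulr_ge0 ?(ltW k0) ?(ltW s0).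
rewrite /interp_fun.
apply: (@le_trans _ _ (((k `^ theta * t `^ (- theta)) * (A * k `^ 1 * ext1 b t))%:E *
    (k%:E * Kfun Y0 Y1 t f))).
  apply: lee_pmul; rewrite ?Kfun_ge0//.
  - by rewrite lee_fin mulr_ge0 ?powR_ge0 ?(ltW es0).
  - by rewrite lee_fin ler_pM ?powR_ge0 ?(ltW es0)//; exact: hA.
  - exact: Kfun_dilation.
rewrite !muleA -!EFinM.
have -> : (k `^ theta * t `^ (- theta) * (A * k `^ 1 * ext1 b t) * k =
  k `^ theta * (A * k `^ 1) * k * (t `^ (- theta) * ext1 b t))%R by ring.
by [].
Qed.

Lemma dyadic_geomlike : geomlike 2^-1%R (@dyadic R).
Proof.
have := @dyadic_powR_geomlike R 1 ler01; rewrite powRr1 ?invr_ge0//.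
by under eq_fun do rewrite powRr1 ?(ltW (dyadic_gt0 _))//.
Qed.

(** Three replacements: t by the dyadic point of its cell, as the integrand is stable under bounded
    dilations; the dyadic points by [rho_seq], through [seq_norm_reparam] in both directions; the
    K-functional at [rho_seq n] by [K_seq]. *)
Lemma interp_norm_equiv E (theta : R) : (0 <= theta)%R ->
  norm_equiv (fnorm (interp Y0 Y1 theta b E))
    (fun f => seq_norm E (fun n => (psi_seq theta n)%:E * K_seq f n)).
Proof.
move=> th0; have h2 : (2^-1 < 1 :> R)%R by rewrite invf_lt1// ltr1n.
have hr1 : (2^-1 `^ (p0^-1 - p1^-1) < 1 :> R)%R.
  by rewrite half_powR_lt1// exponent_gap_gt0.
have d0 j : (0 < dyadic j :> R)%R by exact: dyadic_gt0.
have G0 f j : 0 <= interp_fun theta f (dyadic j) by exact: interp_fun_ge0.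
have H0 f n : 0 <= interp_fun theta f (rho_seq n).
  by apply: interp_fun_ge0; exact: rho_seq_gt0.
have psi0 n : (0 < psi_seq theta n)%R.
  by rewrite mulr_gt0 ?powR_gt0 ?rho_seq_gt0// ext1_gt0// rho_seq_gt0.
apply: (@norm_equiv_trans _ _ (fun f => seq_norm E (fun j => interp_fun theta f (dyadic j)))).
  have [C C0 hC] := interp_fun_regular th0 (ler1n R 2).
  have gE f t : D01 t -> `|(t `^ (- theta) * b t)%:E * Kfun Y0 Y1 t f| = interp_fun theta f t.
    move=> /andP[t0 t1]; rewrite -[RHS]gee0_abs ?interp_fun_ge0//.
    by rewrite /interp_fun /ext1 t1.
  have near t : D01 t -> (t <= 2 * dyadic (cell t))%R /\ (dyadic (cell t) <= 2 * t)%R.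
    move=> Dt; have /andP[h1 h3] := D01_cell Dt; split => //.
    apply: (le_trans (ltW h1)); rewrite ler_peMl ?ler1n//.
    by case/andP: Dt => /ltW.
  exists C => // f _; split.
    rewrite -seq_norm_scale ?(ltW C0)//; apply: tilde_le_seq_norm => [k|t Dt].
      by rewrite mule_ge0// lee_fin ltW.
    rewrite gE//; have [n1 n2] := near t Dt; have /andP[t0 _] := Dt.
    exact: hC.
  have Cv0 : (0 < C^-1)%R by rewrite invr_gt0.
  rewrite -lee_pdivrMl// -seq_norm_scale ?(ltW Cv0)//.
  apply: seq_norm_le_tilde => [k|t Dt].
    by rewrite mule_ge0// lee_fin ltW.
  rewrite gE// lee_pdivrMl//; have [n1 n2] := near t Dt; have /andP[t0 _] := Dt.
  exact: hC.
apply: (@norm_equiv_trans _ _ (fun f => seq_norm E (fun n => interp_fun theta f (rho_seq n)))).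
  apply: norm_equiv_intro; try by move=> f _; exact: seq_norm_ge0.
    have [k k1 [C C0 hC]] := seq_norm_reparam E h2 hr1 dyadic_geomlike rho_seq_geomlike.
    have [D D0 hD] := interp_fun_regular th0 k1.
    exists (C * D)%R => [|f _]; first exact: mulr_gt0.
    apply: hC => // [|n m h3 h4]; first exact: ltW.
    by apply: hD => //; exact: rho_seq_gt0.
  have [k k1 [C C0 hC]] := seq_norm_reparam E hr1 h2 rho_seq_geomlike dyadic_geomlike.
  have [D D0 hD] := interp_fun_regular th0 k1.
  exists (C * D)%R => [|f _]; first exact: mulr_gt0.
  apply: hC => // [|n m h3 h4]; first exact: ltW.
  by apply: hD => //; exact: rho_seq_gt0.
have pK0 f n : 0 <= (psi_seq theta n)%:E * K_seq f n.
  by rewrite mule_ge0 ?K_seq_ge0// lee_fin ltW.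
apply: norm_equiv_intro; try by move=> f _; exact: seq_norm_ge0.
  have [C C0 hC] := Kfun_le_K_seq; exists C => // f mf.
  rewrite -seq_norm_scale ?(ltW C0)//; apply: seq_norm_mono => // n.
  by rewrite /interp_fun -/(psi_seq theta n) muleCA; apply: lee_wpmul2l; rewrite ?hC// lee_fin ltW.
have [C C0 hC] := K_seq_le_Kfun; exists C => // f mf.
rewrite -seq_norm_scale ?(ltW C0)//; apply: seq_norm_mono => // n.
by rewrite /interp_fun -/(psi_seq theta n) muleCA; apply: lee_wpmul2l; rewrite ?hC// lee_fin ltW.
Qed.

Local Notation rho_fun := (Defs.rho p0 p1 q0 q1 w1 w2 w3 w4).
Local Notation T0 := (head_norm q0 bea).
Local Notation phi0 := (fundamental q0 ala bea).
Local Notation phi1 := (fundamental q1 alb beb).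
Local Notation tail_seq := (fun f => tail_norm p0%:E ala (star_seq f)).
Local Notation I_seq := (fun f => gammaI p0%:E q0 ala bea (star_seq f)).
Local Notation J_seq := (fun f => gammaJ p1%:E q1 alb beb (star_seq f)).

Let phi0_gt0 n : (0 < phi0 n)%R.
Proof. exact: geomlike_gt0 (fundamental_geomlike hq0 hala hbea). Qed.
Let phi1_gt0 n : (0 < phi1 n)%R.
Proof. exact: geomlike_gt0 (fundamental_geomlike hq1 halb hbeb). Qed.

Lemma psi_seq_geomlike (theta : R) : (0 <= theta)%R ->
  geomlike ((2^-1 `^ (p0^-1 - p1^-1)) `^ theta)^-1%R (psi_seq theta).
Proof.
move=> th0; rewrite -[X in geomlike X _]mulr1; apply: geomlike_mul.
  rewrite (_ : (fun n => _) = fun n => (rho_seq n `^ theta)^-1)%R.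
    by apply: geomlike_inv; exact: geomlike_powR rho_seq_geomlike.
  by apply/funext => n; rewrite powRN.
exact: ext1_rho_seq_geomlike.
Qed.

Lemma psi_seq_gt0 (theta : R) n : (0 < psi_seq theta n)%R.
Proof. by rewrite mulr_gt0 ?powR_gt0 ?rho_seq_gt0// ext1_gt0// rho_seq_gt0. Qed.

Lemma rho_seq_mul_phi1 n : (rho_seq n * phi1 n = phi0 n)%R.
Proof. by rewrite /rho_seq /phi_ratio divfK// gt_eqF. Qed.

Let tail0 f n : 0 <= tail_seq f n.
Proof. by apply: tail_norm_ge0 hala _ _ _ => k; exact: star_seq_ge0. Qed.
Let I0 f n : 0 <= I_seq f n.
Proof. by apply: gammaI_ge0 hala hbea _ _ _ => k; exact: star_seq_ge0. Qed.
Let J0 f n : 0 <= J_seq f n.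
Proof. by apply: gammaJ_ge0 halb hbeb _ _ _ => k; exact: star_seq_ge0. Qed.
Let T0_gt0 n : (0 < T0 n)%R. Proof. exact: head_norm_gt0. Qed.
Let headtail0 f n : 0 <= (T0 n)%:E * tail_seq f n.
Proof. by rewrite mule_ge0// lee_fin ltW. Qed.
Let rJ0 f n : 0 <= (rho_seq n)%:E * J_seq f n.
Proof. by rewrite mule_ge0// lee_fin ltW// rho_seq_gt0. Qed.
Let psi_ge0 theta n : 0 <= (psi_seq theta n)%:E.
Proof. by rewrite lee_fin ltW// psi_seq_gt0. Qed.

Lemma psi_phi0_ge0 theta f n : 0 <= (psi_seq theta n * phi0 n)%:E * star_seq f n.
Proof. by rewrite mule_ge0 ?star_seq_ge0// lee_fin ltW// mulr_gt0// psi_seq_gt0. Qed.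

(** For theta > 0 the weight [psi_seq theta] grows geometrically, so Hardy's inequality moves the
    head part to finer diagonal terms. *)
Lemma head_part_le E theta : (0 < theta)%R ->
  exists2 C : R, (0 < C)%R & forall f,
  seq_norm E (fun n => (psi_seq theta n)%:E * ((T0 n)%:E * tail_seq f n + I_seq f n)) <=
  C%:E * seq_norm E (fun n => (psi_seq theta n * phi0 n)%:E * star_seq f n).
Proof.
move=> th0.
have w1' : (1 < ((2^-1 `^ (p0^-1 - p1^-1)) `^ theta)^-1 :> R)%R.
  rewrite invf_gt1 ?powR_gt0// -powRrM; apply: half_powR_lt1.
  by rewrite mulr_gt0// exponent_gap_gt0.
have [y [/andP[y0 y1] [C C0 hC]]] :=
  head_tail_gammaI_le_series p0E hq0 hala hbea w1' (psi_seq_geomlike (ltW th0)).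
have yi : (0 < (1 - y)^-1)%R by rewrite invr_gt0 subr_gt0.
exists (C * (1 - y)^-1)%R => [|f]; first exact: mulr_gt0.
pose g n := (psi_seq theta n * phi0 n)%:E * star_seq f n.
have g0 n : 0 <= g n by exact: psi_phi0_ge0.
have s0 n : 0 <= \sum_(j <oo) (y ^+ j)%:E * g (n + j)%N.
  by apply: nneseries_ge0 => j _ _; rewrite mule_ge0// lee_fin exprn_ge0// ltW.
apply: (@le_trans _ _ (seq_norm E (fun n => C%:E * \sum_(j <oo) (y ^+ j)%:E * g (n + j)%N))).
  apply: seq_norm_mono => n; first by rewrite mule_ge0// adde_ge0.
  exact: hC (star_seq_ge0 f).
rewrite seq_norm_scale ?(ltW C0)// (EFinM C) -(muleA C%:E).
apply: lee_wpmul2l; first by rewrite lee_fin ltW.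
by apply: seq_norm_series_forward => //; rewrite y0.
Qed.

(** For theta < 1 the product of [psi_seq theta] and [rho_seq] has the rate 2^-((1 - theta) (1/p0 -
    1/p1)) < 1, so the block part moves to coarser diagonal terms. *)
Lemma block_part_le E theta : (0 <= theta < 1)%R ->
  exists2 C : R, (0 < C)%R & forall f,
  seq_norm E (fun n => (psi_seq theta n)%:E * ((rho_seq n)%:E * J_seq f n)) <=
  C%:E * seq_norm E (fun n => (psi_seq theta n * phi0 n)%:E * star_seq f n).
Proof.
move=> /andP[th0 th1].
pose chi n := (psi_seq theta n * rho_seq n)%R.
have hchi : geomlike (((2^-1 `^ (p0^-1 - p1^-1)) `^ theta)^-1 *
    2^-1 `^ (p0^-1 - p1^-1))%R chi.
  exact: geomlike_mul (psi_seq_geomlike th0) rho_seq_geomlike.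
have w1' : (((2^-1 `^ (p0^-1 - p1^-1)) `^ theta)^-1 * 2^-1 `^ (p0^-1 - p1^-1) < 1 :> R)%R.
  rewrite mulrC ltr_pdivrMr ?powR_gt0// mul1r -powRrM.
  set d := (p0^-1 - p1^-1)%R.
  have d0 : (0 < d)%R by exact: exponent_gap_gt0.
  rewrite -[ltLHS]mulr1 -ltr_pdivlMl ?powR_gt0 ?invr_gt0// mulrC -powRB; last first.
    by apply/implyP => _; rewrite invr_eq0 pnatr_eq0.
  rewrite -[ltLHS]invr1 -[ltRHS]invrK ltf_pV2 ?posrE// ?invr_gt0 ?powR_gt0 ?invr_gt0//.
  rewrite -powRN opprB; apply: half_powR_lt1.
  by rewrite -{1}[d]mulr1 -mulrBr mulr_gt0// subr_gt0.
have [y [/andP[y0 y1] [C C0 hC]]] :=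
  gammaJ_le_series p1E hq1 halb hbeb w1' hchi.
have yi : (0 < (1 - y)^-1)%R by rewrite invr_gt0 subr_gt0.
exists (C * (1 - y)^-1)%R => [|f]; first exact: mulr_gt0.
pose g n := (psi_seq theta n * phi0 n)%:E * star_seq f n.
have g0 n : 0 <= g n by exact: psi_phi0_ge0.
have ig0 j n : 0 <= if (j <= n)%N then g (n - j)%N else 0 by case: ifP.
have s0 n : 0 <= \sum_(j <oo) (y ^+ j)%:E * (if (j <= n)%N then g (n - j)%N else 0).
  by apply: nneseries_ge0 => j _ _; rewrite mule_ge0// lee_fin exprn_ge0// ltW.
apply: (@le_trans _ _ (seq_norm E (fun n => C%:E *
    \sum_(j <oo) (y ^+ j)%:E * (if (j <= n)%N then g (n - j)%N else 0)))).
  apply: seq_norm_mono => n; first by rewrite mule_ge0.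
  rewrite muleA -EFinM; apply: (le_trans (hC _ n (star_seq_ge0 f))).
  apply: lee_wpmul2l; first by rewrite lee_fin ltW.
  apply: lee_nneseries => [j _ _|j _].
    rewrite mule_ge0 ?lee_fin ?exprn_ge0 ?(ltW y0)//; case: ifP => // _.
    rewrite mule_ge0 ?star_seq_ge0// lee_fin ltW//.
    by apply: mulr_gt0; [exact: geomlike_gt0 hchi | exact: phi1_gt0].
  apply: lee_wpmul2l; first by rewrite lee_fin exprn_ge0// ltW.
  case: ifP => // _; rewrite /g -rho_seq_mul_phi1 (mulrA (psi_seq theta _)); exact: lexx.
rewrite seq_norm_scale ?(ltW C0)// (EFinM C) -(muleA C%:E).
apply: lee_wpmul2l; first by rewrite lee_fin ltW.
by apply: seq_norm_series_backward => //; rewrite y0.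
Qed.

Let psiK_split E theta f :
  seq_norm E (fun n => (psi_seq theta n)%:E * K_seq f n) <=
  seq_norm E (fun n => (psi_seq theta n)%:E * ((T0 n)%:E * tail_seq f n + I_seq f n)) +
  seq_norm E (fun n => (psi_seq theta n)%:E * ((rho_seq n)%:E * J_seq f n)).
Proof.
apply: le_trans (seq_norm_add _ _ _) => [|n|n]; last 2 first.
- by rewrite mule_ge0// adde_ge0.
- by rewrite mule_ge0.
apply: seq_norm_mono => n; first by rewrite mule_ge0 ?K_seq_ge0.
by rewrite -ge0_muleDr ?adde_ge0.
Qed.

(** Hardy's inequality is available on both sides, and the diagonal is itself below the head part by
    [phi_le_head_tail]. *)
Lemma K_seq_equiv_theta E theta : (0 < theta < 1)%R ->
  norm_equiv (fun f => seq_norm E (fun n => (psi_seq theta n)%:E * K_seq f n))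
    (fun f => seq_norm E (fun n => (psi_seq theta n * phi0 n)%:E * star_seq f n)).
Proof.
move=> /andP[th0 th1].
have [C C0 hC] := head_part_le E th0.
have [D D0 hD] := @block_part_le E theta ltac:(by rewrite (ltW th0)).
have N0 f : 0 <= seq_norm E (fun n => (psi_seq theta n * phi0 n)%:E * star_seq f n).
  by apply: seq_norm_ge0 => n; exact: psi_phi0_ge0.
apply: norm_equiv_intro => [||f _|//].
- exists (C + D)%R => [|f _]; first exact: addr_gt0.
  apply: (le_trans (psiK_split _ _ _)).
  by rewrite EFinD ge0_muleDl ?lee_fin ?(ltW C0) ?(ltW D0)//; exact: leeD.
- exists 1%R => // f _; rewrite mul1e; apply: seq_norm_mono => n.
    exact: psi_phi0_ge0.
  rewrite (EFinM (psi_seq theta n)) -(muleA (psi_seq theta n)%:E); apply: lee_wpmul2l => //.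
  apply: (le_trans (phi_le_head_tail p0E hq0 hala hbea n (star_seq_ge0 f))).
  by rewrite /K_seq /Kseq -addeA leeDl// adde_ge0// ?I0 ?rJ0.
- by apply: seq_norm_ge0 => n; rewrite mule_ge0 ?K_seq_ge0.
Qed.

Lemma psi_seq0 n : psi_seq 0 n = ext1 b (rho_seq n).
Proof. by rewrite /psi_seq oppr0 powRr0 mul1r. Qed.

Lemma psi_seq1 n : (psi_seq 1 n * rho_seq n = ext1 b (rho_seq n))%R.
Proof.
have r0 := rho_seq_gt0 n.
by rewrite /psi_seq powR_inv1 ?(ltW r0)// mulrC mulrA divff ?mul1r// gt_eqF.
Qed.

Let b_seq_ge0 n : (0 <= ext1 b (rho_seq n))%R.
Proof. by rewrite ltW// ext1_gt0// rho_seq_gt0. Qed.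

(** At theta = 0 the weight has no geometric growth, so the head part stays; the block part reduces
    to the diagonal, which the tail norm term absorbs. *)
Lemma K_seq_equiv0 E :
  norm_equiv (fun f => seq_norm E (fun n => (psi_seq 0 n)%:E * K_seq f n))
    (fun f => maxe
      (seq_norm E (fun n => (T0 n * ext1 b (rho_seq n))%:E * tail_seq f n))
      (seq_norm E (fun n => (ext1 b (rho_seq n))%:E * I_seq f n))).
Proof.
have [D D0 hD] := @block_part_le E 0%R ltac:(by rewrite lexx ltr01).
pose NT f := seq_norm E (fun n => (T0 n * ext1 b (rho_seq n))%:E * tail_seq f n).
pose NI f := seq_norm E (fun n => (ext1 b (rho_seq n))%:E * I_seq f n).
have Tb0 n : (0 <= T0 n * ext1 b (rho_seq n))%R by rewrite mulr_ge0// ltW.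
have a0 f n : 0 <= (T0 n * ext1 b (rho_seq n))%:E * tail_seq f n.
  by rewrite mule_ge0// lee_fin.
have i0 f n : 0 <= (ext1 b (rho_seq n))%:E * I_seq f n by rewrite mule_ge0// lee_fin.
have NT0 f : 0 <= NT f by exact: seq_norm_ge0.
have NI0 f : 0 <= NI f by exact: seq_norm_ge0.
have M0 f : 0 <= maxe (NT f) (NI f) by rewrite le_max NT0.
have bT f n : (ext1 b (rho_seq n))%:E * ((T0 n)%:E * tail_seq f n) =
    (T0 n * ext1 b (rho_seq n))%:E * tail_seq f n.
  by rewrite muleA -EFinM (mulrC (T0 n)).
rewrite -/NT -/NI.
apply: norm_equiv_intro => [||f _|f _]; last exact: M0.
- exists (1 + 1 + D)%R => [|f _]; first by rewrite addr_gt0.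
  apply: (le_trans (psiK_split _ _ _)).
  rewrite EFinD ge0_muleDl ?lee_fin ?(ltW D0)//.
  apply: leeD.
    rewrite EFinD ge0_muleDl ?lee_fin// mul1e.
    apply: (@le_trans _ _ (NT f + NI f)); last first.
      by apply: leeD; rewrite le_max lexx ?orbT.
    apply: le_trans (seq_norm_add _ (a0 f) (i0 f)).
    apply: seq_norm_mono => n; first by rewrite mule_ge0// adde_ge0.
    by rewrite psi_seq0 ge0_muleDr// bT.
  apply: (le_trans (hD f)); apply: lee_wpmul2l; first by rewrite lee_fin ltW.
  rewrite le_max; apply/orP; left; apply: seq_norm_mono => n.
    exact: psi_phi0_ge0.
  rewrite psi_seq0 (EFinM (ext1 b (rho_seq n))) -(muleA (ext1 b (rho_seq n))%:E) -bT; apply: lee_wpmul2l; first by rewrite lee_fin.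
  exact: (phi_le_head_tail p0E hq0 hala hbea n (star_seq_ge0 f)).
- exists 1%R => // f _; rewrite mul1e ge_max; apply/andP; split.
    apply: seq_norm_mono => // n; rewrite psi_seq0 -bT.
    apply: lee_wpmul2l; first by rewrite lee_fin.
    by rewrite /K_seq /Kseq -addeA leeDl// adde_ge0// ?I0 ?rJ0.
  apply: seq_norm_mono => // n; rewrite psi_seq0.
  apply: lee_wpmul2l; first by rewrite lee_fin.
  by rewrite /K_seq /Kseq -addeA addeCA leeDl// adde_ge0// ?headtail0 ?rJ0.
- by apply: seq_norm_ge0 => n; rewrite mule_ge0 ?K_seq_ge0.
Qed.

(** At theta = 1 the roles are reversed: the head part reduces to the diagonal, which
    [phi_le_gammaJ] absorbs into the block part, and [psi_seq 1] cancels [rho_seq] up to the factor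
    b. *)
Lemma K_seq_equiv1 E :
  norm_equiv (fun f => seq_norm E (fun n => (psi_seq 1 n)%:E * K_seq f n))
    (fun f => seq_norm E (fun n => (ext1 b (rho_seq n))%:E * J_seq f n)).
Proof.
have [C C0 hC] := @head_part_le E 1%R ltr01.
have b0 f n : 0 <= (ext1 b (rho_seq n))%:E * J_seq f n by rewrite mule_ge0// lee_fin.
have rJ f n : (psi_seq 1 n)%:E * ((rho_seq n)%:E * J_seq f n) =
    (ext1 b (rho_seq n))%:E * J_seq f n.
  by rewrite muleA -EFinM psi_seq1.
apply: norm_equiv_intro => [||f _|f _]; last 2 first.
- by apply: seq_norm_ge0 => n; rewrite mule_ge0 ?K_seq_ge0.
- exact: seq_norm_ge0.
- exists (C + 1)%R => [|f _]; first by rewrite addr_gt0.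
  apply: (le_trans (psiK_split _ _ _)).
  rewrite EFinD ge0_muleDl ?lee_fin ?(ltW C0)// mul1e; apply: leeD; last first.
    by under eq_fun do rewrite rJ.
  apply: (le_trans (hC f)); apply: lee_wpmul2l; first by rewrite lee_fin ltW.
  apply: seq_norm_mono => n; first exact: psi_phi0_ge0.
  rewrite -rho_seq_mul_phi1 (mulrA (psi_seq 1 n)) psi_seq1 (EFinM (ext1 b (rho_seq n)))
    -(muleA (ext1 b (rho_seq n))%:E).
  apply: lee_wpmul2l; first by rewrite lee_fin.
  exact: (phi_le_gammaJ p1E hq1 halb hbeb n (star_seq_ge0 f)).
- exists 1%R => // f _; rewrite mul1e; apply: seq_norm_mono => // n.
  rewrite -rJ; apply: lee_wpmul2l => //.
  by rewrite /K_seq /Kseq leeDr// adde_ge0// ?headtail0 ?I0.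
Qed.

Lemma rho_cellwise : cellwise (@Dhalf R) rho_fun rho_seq.
Proof.
have hid : cellwise (@Dhalf R) id (@dyadic R).
  exact: cellwise_sub (@Dhalf_D01 R) (@cellwise_id R).
have hw (w : R -> R) : SV w -> cellwise (@Dhalf R) w (fun n => w (dyadic n)).
  move=> /SV_tempered/cellwise_tempered; apply: cellwise_sub; exact: Dhalf_D01.
rewrite (_ : rho_seq = fun n => (dyadic n `^ (p0^-1 - p1^-1) *
  ((w2 (dyadic n) `^ p0^-1 * T0 n) / (w4 (dyadic n) `^ p1^-1 * head_norm q1 beb n)))%R).
  apply: cellwise_mul; first exact: cellwise_powR.
  apply: cellwise_mul.
    apply: cellwise_mul; last exact: tailnorm_cellwise.
    by apply: cellwise_powR; exact: hw.
  apply: cellwise_inv; apply: cellwise_mul; last exact: tailnorm_cellwise.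
  by apply: cellwise_powR; exact: hw.
apply/funext => n; rewrite /rho_seq /phi_ratio /fundamental /inner_weight.
have d0 : (0 < dyadic n :> R)%R by exact: dyadic_gt0.
have T1_gt0 : (0 < head_norm q1 beb n)%R by exact: head_norm_gt0.
have w40 : (0 < w4 (dyadic n))%R.
  by case: hw4 => _ h _; apply: h; rewrite d0 dyadic_lt1.
rewrite powRB; last by apply/implyP => _; rewrite gt_eqF.
by field; rewrite !gt_eqF ?powR_gt0.
Qed.

Lemma b_rho_cellwise_half :
  cellwise (@Dhalf R) (fun u => ext1 b (rho_fun u)) (fun n => ext1 b (rho_seq n)).
Proof.
apply: cellwise_comp rho_cellwise (ext1_tempered hb) _ _.
- by move=> t Dt; case: rho_cellwise => h _ _; exact: h.
- by move=> n; exact: rho_seq_gt0.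
Qed.

Lemma b_rho_cellwise :
  cellwise (@D01 R) (cut_half (fun u => ext1 b (rho_fun u))) (fun n => ext1 b (rho_seq n)).
Proof. exact: cellwise_cut_half b_rho_cellwise_half. Qed.

Lemma Bzero_cellwise : cellwise (@D01 R)
  (cut_half (Bzero p0 p1 q0 q1 w1 w2 w3 w4 b)) (fun n => T0 n * ext1 b (rho_seq n))%R.
Proof.
apply: cellwise_cut_half; apply: cellwise_mul; first exact: tailnorm_cellwise.
exact: b_rho_cellwise_half.
Qed.

Lemma powR_divN (u v e : R) : (0 < u)%R -> (0 < v)%R ->
  ((u / v) `^ (- e) * u = u `^ (1 - e) * v `^ e)%R.
Proof.
move=> u0 v0; rewrite powRM ?invr_ge0 ?ltW// -(powR_inv1 (ltW v0)) -powRrM mulN1r opprK.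
rewrite powRD; last by apply/implyP => _; rewrite gt_eqF.
by rewrite powRr1 ?(ltW u0)//; ring.
Qed.

(** As rho = phi0 / phi1, one has rho^-theta phi0 = phi0^(1-theta) phi1^theta, and the powers of t
    combine to t^(1/p); this is the origin of the weight B_theta. *)
Lemma Btheta_cellwise (theta p : R) : (p^-1 = (1 - theta) / p0 + theta / p1)%R ->
  cellwise (@D01 R)
    (fun t => t `^ p^-1 * cut_half (Btheta p0 p1 q0 q1 w1 w2 w3 w4 theta b) t)%R
    (fun n => psi_seq theta n * phi0 n)%R.
Proof.
move=> hp.
have hw (w : R -> R) : SV w -> cellwise (@Dhalf R) w (fun n => w (dyadic n)).
  move=> /SV_tempered/cellwise_tempered; apply: cellwise_sub; exact: Dhalf_D01.
rewrite (_ : (fun n => psi_seq theta n * phi0 n)%R = fun n => (dyadic n `^ p^-1 *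
  ((w2 (dyadic n) `^ p0^-1 * T0 n) `^ (1 - theta) *
   (w4 (dyadic n) `^ p1^-1 * head_norm q1 beb n) `^ theta * ext1 b (rho_seq n)))%R).
  apply: cellwise_mul; first exact: cellwise_powR (@cellwise_id R).
  apply: cellwise_cut_half; apply: cellwise_mul; last exact: b_rho_cellwise_half.
  apply: cellwise_mul; apply: cellwise_powR; apply: cellwise_mul;
    try exact: tailnorm_cellwise.
  - by apply: cellwise_powR; exact: hw.
  - by apply: cellwise_powR; exact: hw.
apply/funext => n.
have d0 : (0 < dyadic n :> R)%R by exact: dyadic_gt0.
have T1_gt0 : (0 < head_norm q1 beb n)%R by exact: head_norm_gt0.
have w20 : (0 < w2 (dyadic n))%R.
  by case: hw2 => _ h _; apply: h; rewrite d0 dyadic_lt1.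
have w40 : (0 < w4 (dyadic n))%R.
  by case: hw4 => _ h _; apply: h; rewrite d0 dyadic_lt1.
rewrite /psi_seq mulrAC /rho_seq /phi_ratio powR_divN//.
have dE : (dyadic n `^ p^-1 = (dyadic n `^ p0^-1) `^ (1 - theta) *
    (dyadic n `^ p1^-1) `^ theta :> R)%R.
  rewrite -!powRrM -powRD; last by apply/implyP => _; rewrite gt_eqF.
  by rewrite hp; congr (_ `^ _)%R; ring.
rewrite dE /fundamental /inner_weight.
have A0 : (0 <= w2 (dyadic n) `^ p0^-1 * T0 n)%R by rewrite mulr_ge0 ?powR_ge0 ?ltW.
have B0 : (0 <= w4 (dyadic n) `^ p1^-1 * head_norm q1 beb n)%R.
  by rewrite mulr_ge0 ?powR_ge0 ?ltW.
rewrite -!(mulrA (dyadic n `^ _)%R) !(@powRM _ (dyadic n `^ _)%R) ?powR_ge0//.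
by ring.
Qed.

(** Membership in [Y0] follows from a finite norm, which makes [K_seq f 0] finite: [gammaI] at index
    0 is the whole discrete norm of [Y0]. *)
Lemma carrier_interp E (theta : R) : (0 <= theta)%R ->
  carrier (interp Y0 Y1 theta b E) =
  [set f | measurable_fun I01 f /\ fnorm (interp Y0 Y1 theta b E) f < +oo].
Proof.
move=> th0; apply/seteqP; split => f /=; first by move=> [[mf _] Nf].
move=> [mf Nf]; split => //; split => //.
have [C C0 hC] := interp_norm_equiv E th0; have [_ h] := hC f mf.
have K0 : K_seq f 0 < +oo.
  have : (psi_seq theta 0)%:E * K_seq f 0 < +oo.
    apply: (@seq_norm_fin R E (fun n => (psi_seq theta n)%:E * K_seq f n) 0).
      by move=> n; rewrite mule_ge0 ?K_seq_ge0.
    by apply: (le_lt_trans h); rewrite lte_mul_pinfty ?lee_fin ?(ltW C0).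
  apply: contraTT; rewrite -!leNgt !leye_eq => /eqP ->.
  by rewrite gt0_muley// lte_fin psi_seq_gt0.
have [D D0 hD] := GGamma_norm_equiv hp0 hq0 hw1 hw2.
have [h' _] := hD f mf; apply: (le_lt_trans h').
rewrite lte_mul_pinfty ?lee_fin ?(ltW D0)//.
apply: le_lt_trans K0; rewrite /K_seq /Kseq.
rewrite (_ : gammaY p0%:E q0 ala bea (star_seq f) = I_seq f 0%N)//.
by rewrite -addeA addeCA leeDl// adde_ge0// ?headtail0 ?rJ0.
Qed.

(** Here d = 1, because on a cell the rearrangement is bounded below by its value at the right
    endpoint, which is the previous dyadic point. *)
Lemma spaceL_norm_equiv E (theta p : R) : (0 < theta < 1)%R ->
  (p^-1 = (1 - theta) / p0 + theta / p1)%R ->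
  norm_equiv (fnorm (spaceL p (cut_half (Btheta p0 p1 q0 q1 w1 w2 w3 w4 theta b)) (tilde E)))
    (fun f => seq_norm E (fun n => (psi_seq theta n * phi0 n)%:E * star_seq f n)).
Proof.
move=> /andP[th0 _] hp.
apply: (tilde_seq_norm_equiv E (d := 1) (Btheta_cellwise hp)
  (geomlike_mul (psi_seq_geomlike (ltW th0)) (fundamental_geomlike hq0 hala hbea))).
- by move=> f n; exact: star_seq_ge0.
- by move=> f u _; exact: star_ge0.
- by exists 1%R => // f u Du; rewrite mul1e; exact: star_le_star_seq.
- exists 1%R => // f u n Du; rewrite addn1 => cu; rewrite mul1e.
  by have := @star_seq_le_star R f u Du; rewrite cu; exact.
Qed.

(** The lost cell is already recovered in [head_fun_ge], hence d = 0. *)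
Lemma spaceLL_norm_equiv E :
  norm_equiv (fnorm (spaceLL p0 (cut_half (Bzero p0 p1 q0 q1 w1 w2 w3 w4 b)) (tilde E)
      (fun u => w2 u `^ p0^-1)%R (tildeL p0%:E)))
    (fun f => seq_norm E (fun n => (T0 n * ext1 b (rho_seq n))%:E * tail_seq f n)).
Proof.
have hW := inner_weight_cellwise p0 hw2.
apply: (tilde_seq_norm_equiv E (d := 0) (F := head_fun p0%:E (inner_weight p0 w2))
  Bzero_cellwise (geomlike_mul (head_norm_geomlike hq0 hbea) ext1_rho_seq_geomlike)).
- exact: tail0.
- by move=> f u Du; apply: head_fun_ge0.
- exact: head_fun_le p0E hala hW.
- have [C C0 hC] := head_fun_ge p0E hala hW; exists C => // f u n Du.
  by rewrite addn0 => <-; exact: hC.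
Qed.

Lemma spaceLLL_norm_equiv E :
  norm_equiv (fnorm (spaceLLL p0 (cut_half (fun u => ext1 b (rho_fun u))) (tilde E)
      (wroot q0 w1) (tildeL q0) (fun u => w2 u `^ p0^-1)%R (tildeL p0%:E)))
    (fun f => seq_norm E (fun n => (ext1 b (rho_seq n))%:E * I_seq f n)).
Proof.
have hW := inner_weight_cellwise p0 hw2; have hV := wroot_cellwise hq0 hw1.
apply: (tilde_seq_norm_equiv E (d := 0) (F := fun f u => tildeL q0 `]0%R, u[%classic
  (fun t => (wroot q0 w1 t)%:E * head_fun p0%:E (inner_weight p0 w2) f t))
  b_rho_cellwise ext1_rho_seq_geomlike).
- exact: I0.
- by move=> f u /andP[u0 u1]; apply: tildeL_ge0 => //; apply: itv_D01 => //; exact: ltW.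
- exact: tildeL_gammaI_le p0E hq0 hala hbea hW hV.
- have [C C0 hC] := tildeL_gammaI_ge p0E hq0 hala hbea hW hV; exists C => // f u n Du.
  by rewrite addn0 => <-; exact: hC.
Qed.

(** The two cells lost in [tildeL_gammaJ_ge] give d = 2. *)
Lemma spaceLLR_norm_equiv E :
  norm_equiv (fnorm (spaceLLR p1 (cut_half (fun u => ext1 b (rho_fun u))) (tilde E)
      (wroot q1 w3) (tildeL q1) (fun u => w4 u `^ p1^-1)%R (tildeL p1%:E)))
    (fun f => seq_norm E (fun n => (ext1 b (rho_seq n))%:E * J_seq f n)).
Proof.
have hW := inner_weight_cellwise p1 hw4; have hV := wroot_cellwise hq1 hw3.
apply: (tilde_seq_norm_equiv E (d := 2) (F := fun f u => tildeL q1 `]u, 1%R[%classic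
  (fun t => (wroot q1 w3 t)%:E * block_fun p1%:E (inner_weight p1 w4) f u t))
  b_rho_cellwise ext1_rho_seq_geomlike).
- exact: J0.
- by move=> f u /andP[u0 u1]; apply: tildeL_ge0 => //; apply: itv_D01 => //; exact: ltW.
- exact: tildeL_gammaJ_le p1E hq1 halb hbeb hW hV.
- have [C C0 hC] := tildeL_gammaJ_ge p1E hq1 halb hbeb hW hV; exists C => // f u n Du.
  by rewrite addn2 => cu; exact: hC.
Qed.

Lemma same_space_intro (X Z : fspace R) :
  carrier X = [set f | measurable_fun I01 f /\ fnorm X f < +oo] ->
  carrier Z = [set f | measurable_fun I01 f /\ fnorm Z f < +oo] ->
  norm_equiv (fnorm X) (fnorm Z) -> same_space X Z.
Proof.
move=> cX cZ [C C0 h]; split; last first.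
  by exists C => // f; rewrite cX => -[mf _]; exact: h.
rewrite cX cZ; apply/seteqP; split => f /= [mf fin]; split => //.
  have [_ h'] := h f mf; apply: (le_lt_trans h').
  (* Norms of an abstract [fspace] carry no sign; a negative one bounds the other by 0. *)
  have [?|?] := leP 0 (fnorm X f); first by rewrite lte_mul_pinfty ?lee_fin ?(ltW C0).
  by apply: (@le_lt_trans _ _ 0); rewrite ?ltry// pmule_rle0// ltW.
have [h' _] := h f mf; apply: (le_lt_trans h').
have [?|?] := leP 0 (fnorm Z f); first by rewrite lte_mul_pinfty ?lee_fin ?(ltW C0).
by apply: (@le_lt_trans _ _ 0); rewrite ?ltry// pmule_rle0// ltW.
Qed.

Lemma norm_equiv_max (A A' B B' : (R -> R) -> \bar R) :
  (forall f, measurable_fun I01 f -> 0 <= A f) ->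
  (forall f, measurable_fun I01 f -> 0 <= B f) ->
  (forall f, measurable_fun I01 f -> 0 <= A' f) ->
  (forall f, measurable_fun I01 f -> 0 <= B' f) ->
  norm_equiv A A' -> norm_equiv B B' ->
  norm_equiv (fun f => maxe (A f) (B f)) (fun f => maxe (A' f) (B' f)).
Proof.
move=> A0 B0 A'0 B'0 [C C0 h] [C' C'0 h'].
have key x x' y y' : 0 <= x' -> 0 <= y' -> x <= C%:E * x' -> y <= C'%:E * y' ->
    maxe x y <= (C + C')%:E * maxe x' y'.
  move=> x0 y0 hx hy; rewrite ge_max; apply/andP; split.
    by apply: (le_trans hx); apply: lee_pmul; rewrite ?lee_fin ?lerDl ?(ltW C0) ?(ltW C'0)// le_max lexx.
  by apply: (le_trans hy); apply: lee_pmul; rewrite ?lee_fin ?lerDr ?(ltW C0) ?(ltW C'0)// le_max lexx orbT.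
exists (C + C')%R => [|f mf]; first exact: addr_gt0.
have [h1 h2] := h f mf; have [h3 h4] := h' f mf.
by split; apply: key; rewrite ?A0 ?B0 ?A'0 ?B'0.
Qed.

Let tilde_ge0 E I g : 0 <= tilde E I g.
Proof. by apply: ri_ge0; exact: rearrangement_nonneg_measurable. Qed.

Lemma interp_theta E (theta p : R) : (0 < theta < 1)%R ->
  (p^-1 = (1 - theta) / p0 + theta / p1)%R ->
  same_space (interp Y0 Y1 theta b E)
    (spaceL p (cut_half (Btheta p0 p1 q0 q1 w1 w2 w3 w4 theta b)) (tilde E)).
Proof.
move=> th hp; have /andP[th0 _] := th.
apply: same_space_intro => //; first by apply: carrier_interp; exact: ltW.
apply: norm_equiv_trans (interp_norm_equiv E (ltW th0)) _.
apply: norm_equiv_trans (K_seq_equiv_theta E th) _.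
exact: norm_equiv_sym (spaceL_norm_equiv E th hp).
Qed.

Lemma interp_0 E :
  same_space (interp Y0 Y1 0 b E)
    (capspace
      (spaceLL p0 (cut_half (Bzero p0 p1 q0 q1 w1 w2 w3 w4 b)) (tilde E)
         (fun u => w2 u `^ p0^-1)%R (tildeL p0%:E))
      (spaceLLL p0 (cut_half (fun u => ext1 b (rho_fun u))) (tilde E) (wroot q0 w1)
         (tildeL q0) (fun u => w2 u `^ p0^-1)%R (tildeL p0%:E))).
Proof.
apply: same_space_intro => //; first exact: carrier_interp.
  apply/seteqP; split => f /=; rewrite gt_max.
    by move=> [[mf ->] [_ ->]].
  by move=> [mf /andP[h1 h2]].
apply: norm_equiv_trans (interp_norm_equiv E (lexx _)) _.
apply: norm_equiv_trans (K_seq_equiv0 E) _.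
apply: norm_equiv_sym; apply: norm_equiv_max (spaceLL_norm_equiv E) (spaceLLL_norm_equiv E).
- by move=> f _; exact: tilde_ge0.
- by move=> f _; exact: tilde_ge0.
- move=> f _; apply: seq_norm_ge0 => n; rewrite mule_ge0 ?tail0// lee_fin.
  by rewrite mulr_ge0// ltW.
- by move=> f _; apply: seq_norm_ge0 => n; rewrite mule_ge0 ?I0// lee_fin.
Qed.

Lemma interp_1 E :
  same_space (interp Y0 Y1 1 b E)
    (spaceLLR p1 (cut_half (fun u => ext1 b (rho_fun u))) (tilde E) (wroot q1 w3)
       (tildeL q1) (fun u => w4 u `^ p1^-1)%R (tildeL p1%:E)).
Proof.
apply: same_space_intro => //; first exact: carrier_interp ler01.
apply: norm_equiv_trans (interp_norm_equiv E ler01) _.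
apply: norm_equiv_trans (K_seq_equiv1 E) _.
exact: norm_equiv_sym (spaceLLR_norm_equiv E).
Qed.


End KFunctional.

Theorem corollary5p13 (R : realType) (E : ri_space R) (b w1 w2 w3 w4 : R -> R)
    (p0 p1 : R) (q0 q1 : \bar R)
    (hb : SV b)
    (hw1 : SV (fun u => u * w1 u)) (hw2 : SV w2)
    (hw3 : SV (fun u => u * w3 u)) (hw4 : SV w4)
    (hp0 : 1 < p0) (hp01 : p0 < p1)
    (hq0 : (1 <= q0)%E) (hq1 : (1 <= q1)%E)
    (h0i : GGamma_cond1 p0 w2) (h0ii : GGamma_cond2 p0 q0 w1 w2)
    (h1i : GGamma_cond1 p1 w4) (h1ii : GGamma_cond2 p1 q1 w3 w4) :
  let Y0 := GGamma p0 q0 w1 w2 in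
  let Y1 := GGamma p1 q1 w3 w4 in
  let rho := Defs.rho p0 p1 q0 q1 w1 w2 w3 w4 in
  let brho := cut_half (fun u => ext1 b (rho u)) in
  [/\ forall theta p : R, 0 < theta < 1 ->
        p^-1 = (1 - theta) / p0 + theta / p1 ->
        same_space (interp Y0 Y1 theta b E)
          (spaceL p (cut_half (Btheta p0 p1 q0 q1 w1 w2 w3 w4 theta b))
             (tilde E)),
      same_space (interp Y0 Y1 0 b E)
        (capspace
          (spaceLL p0 (cut_half (Bzero p0 p1 q0 q1 w1 w2 w3 w4 b)) (tilde E)
             (fun u => w2 u `^ p0^-1) (tildeL p0%:E))
          (spaceLLL p0 brho (tilde E) (wroot q0 w1) (tildeL q0)
             (fun u => w2 u `^ p0^-1) (tildeL p0%:E))) &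
      (tilde E `]0%R, 1%R[%classic (EFin \o b) < +oo)%E ->
        same_space (interp Y0 Y1 1 b E)
          (spaceLLR p1 brho (tilde E) (wroot q1 w3) (tildeL q1)
             (fun u => w4 u `^ p1^-1) (tildeL p1%:E))].
Proof.
move=> Y0 Y1 rho brho; split.
- by move=> theta p th hp; exact: interp_theta.
- exact: interp_0.
- by move=> _; exact: interp_1.
Qed.
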